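(* Let $n,m_1,m_2\ge 1$ be integers, let $\mathbf{X}_1,\dots,\mathbf{X}_n\in\mathbb{R}^{m_1\times m_2}$ be deterministic matrices, let $\mathbf{B}^\star\in\mathbb{R}^{m_1\times m_2}$, and let $y_i=\mathrm{Tr}(\mathbf{X}_i^\top\mathbf{B}^\star)+\xi_i$ for $i=1,\dots,n$, where $\boldsymbol\xi=(\xi_1,\dots,\xi_n)^\top\sim\mathcal{N}(\mathbf{0}_n,\sigma^2\mathbf{I}_n)$, $\sigma>0$. Let $\tau>0$, $\lambda>0$ and suppose that, for some $\delta\in(0,1)$, $\lambda\ge 2\sigma v_{\mathcal X}\big\{\frac2n\log((m_1+m_2)/\delta)\big\}^{1/2}$. Then, with probability at least $1-\delta$ (with respect to $\boldsymbol\xi$), the pseudo-posterior $\hat\pi_n$ with the nuclear-norm prior is such that the probability $$\hat\pi_n\bigg(\mathbf B:\ \ell_n(\mathbf B,\mathbf B^\star)\le\inf_{\substack{\bar{\mathbf B}\in\mathbb{R}^{m_1\times m_2}\\ J\subset[\mathrm{rank}(\bar{\mathbf B})]}}\Big\{\ell_n(\bar{\mathbf B},\mathbf B^\star)+4\lambda\|\mathcal P_{\bar{\mathbf B},J^c}(\bar{\mathbf B})\|_1+\frac{9\lambda^2|J|}{4\kappa_{\bar{\mathbf B},J,3}}\Big\}+8m_1m_2\tau\bigg)$$ is larger than $1-2e^{-\sqrt{m_1m_2}/16}$.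
   Context: Notation: $\langle\mathbf A,\mathbf B\rangle=\mathrm{Tr}(\mathbf A^\top\mathbf B)$; for a matrix $\mathbf A$, $\|\mathbf A\|_1$ is the nuclear norm (sum of singular values) and $\|\mathbf A\|$ the operator norm (largest singular value); $\|\mathbf A\|_{L_2(\mathcal X)}^2=\frac1n\sum_{i=1}^n\langle\mathbf X_i,\mathbf A\rangle^2$; $[r]=\{1,\dots,r\}$. Prediction loss: $\ell_n(\mathbf B,\mathbf B')=\|\mathbf B-\mathbf B'\|_{L_2(\mathcal X)}^2$. Design constant: $$v_{\mathcal X}=\max\Big\{\Big\|\frac1n\sum_{i=1}^n\mathbf X_i\mathbf X_i^\top\Big\|^{1/2},\ \Big\|\frac1n\sum_{i=1}^n\mathbf X_i^\top\mathbf X_i\Big\|^{1/2}\Big\}.$$ Pseudo-posterior: $V_n(\mathbf B)=\frac1{2n}\sum_{i=1}^n(y_i-\langle\mathbf X_i,\mathbf B\rangle)^2+\lambda\|\mathbf B\|_1$, and $\hat\pi_n$ is the probability measure on $\mathbb{R}^{m_1\times m_2}$ with Lebesgue density $\hat\pi_n(\mathbf B)\propto\exp(-V_n(\mathbf B)/\tau)$. Projections: for $\bar{\mathbf B}\in\mathbb{R}^{m_1\times m_2}$ of rank $r$, fix a singular value decomposition $\bar{\mathbf B}=\mathbf V_1\boldsymbol\Sigma\mathbf V_2^\top$, with $\boldsymbol\Sigma$ an $r\times r$ diagonal matrix with positive non-increasing diagonal entries and $\mathbf V_j$ an $m_j\times r$ matrix with orthonormal columns ($j=1,2$). For $J\subset[r]$,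 $\mathbf V_{j,J}$ is the $m_j\times|J|$ matrix consisting of the columns of $\mathbf V_j$ with indices in $J$. For $\mathbf U\in\mathbb{R}^{m_1\times m_2}$, $$\mathcal P_{\bar{\mathbf B},J^c}(\mathbf U)=(\mathbf I_{m_1}-\mathbf V_{1,J}\mathbf V_{1,J}^\top)\mathbf U(\mathbf I_{m_2}-\mathbf V_{2,J}\mathbf V_{2,J}^\top),\qquad \mathcal P^\bot_{\bar{\mathbf B},J^c}(\mathbf U)=\mathbf U-\mathcal P_{\bar{\mathbf B},J^c}(\mathbf U).$$ Compatibility factor: for $c>0$, $$\kappa_{\bar{\mathbf B},J,c}=\inf_{\substack{\mathbf U\in\mathbb{R}^{m_1\times m_2}\\ \|\mathcal P_{\bar{\mathbf B},J^c}(\mathbf U)\|_1<c\|\mathcal P^\bot_{\bar{\mathbf B},J^c}(\mathbf U)\|_1}}\frac{c^2|J|\,\|\mathbf U\|_{L_2(\mathcal X)}^2}{\big(c\|\mathcal P^\bot_{\bar{\mathbf B},J^c}(\mathbf U)\|_1-\|\mathcal P_{\bar{\mathbf B},J^c}(\mathbf U)\|_1\big)^2}.$$ Conventions: $|J|/\kappa_{\bar{\mathbf B},J,c}$ equals $0$ for $J=\varnothing$ (the infimum over the empty set being $+\infty$) and $+\infty$ if $J\neq\varnothing$ and $\kappa_{\bar{\mathbf B},J,c}=0$. *)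

(* Defs.v *)
From HB Require Import structures.
From mathcomp Require Import all_boot all_order all_algebra.
From mathcomp Require Import polyrcf.
From mathcomp Require Import all_classical all_reals all_analysis.

Set Implicit Arguments.
Unset Strict Implicit.
Unset Printing Implicit Defensive.

Import Order.TTheory GRing.Theory Num.Theory.
Import numFieldNormedType.Exports.

Local Open Scope classical_set_scope.
Local Open Scope ring_scope.

(* The product sigma-algebra on 'M[T]_(m, n), generated by the entries (for
   T = R it is the Borel sigma-algebra). *)
Section measurable_matrix.
Context {d : measure_display} {T : measurableType d}.
Variables m n : nat.

Definition mx_coords (k : 'I_(m * n)) (A : 'M[T]_(m, n)) : T := mxvec A 0 k.

Let mx_set0 : g_sigma_preimage mx_coords set0.
Proof. exact: sigma_algebra0. Qed.

Let mx_setC A :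
  g_sigma_preimage mx_coords A -> g_sigma_preimage mx_coords (~` A).
Proof. exact: sigma_algebraC. Qed.

Let mx_bigcup (F : _^nat) : (forall i, g_sigma_preimage mx_coords (F i)) ->
  g_sigma_preimage mx_coords (\bigcup_i (F i)).
Proof. exact: sigma_algebra_bigcup. Qed.

HB.instance Definition _ := @isMeasurable.Build (measure_tuple_display d)
  'M[T]_(m, n) (g_sigma_preimage mx_coords) mx_set0 mx_setC mx_bigcup.

End measurable_matrix.

(* Lebesgue measure on R^n (as n-tuples), by iterated product measures. *)
Fixpoint lebesgue_tuple (R : realType) (n : nat) : set (n.-tuple R) -> \bar R :=
  match n with
  | 0 => dirac [tuple]
  | k.+1 => pushforward (lebesgue_measure \x @lebesgue_tuple R k)%E
      (fun x : R * k.-tuple R => [the k.+1.-tuple R of x.1 :: x.2])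
  end.

Definition mx_of_tuple (T : Type) (m n : nat) (t : (m * n).-tuple T) :
  'M[T]_(m, n) := vec_mx (\row_k tnth t k).

Definition lebesgue_mx (R : realType) (m n : nat) : set 'M[R]_(m, n) -> \bar R :=
  pushforward (@lebesgue_tuple R (m * n)) (@mx_of_tuple R m n).

Section sigma_finite_measureP.
Context d (T : measurableType d) (R : realType) (nu : {measure set T -> \bar R}).
Hypothesis sf : sigma_finite setT nu.
Let f : set T -> \bar R := nu.
HB.instance Definition _ := Measure.copy f nu.
HB.instance Definition _ := Measure_isSigmaFinite.Build _ _ _ f sf.

Lemma sigma_finite_measureP :
  exists mu : {sigma_finite_measure set T -> \bar R},
    nu = mu :> (set T -> \bar R).
Proof. by exists f. Qed.

End sigma_finite_measureP.

Lemma pushforward_sigma_finite d1 d2 (T1 : measurableType d1)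
    (T2 : measurableType d2) (R : realType)
    (mu : {sigma_finite_measure set T1 -> \bar R}) (f : T1 -> T2)
    (g : T2 -> T1) :
  measurable_fun setT f -> measurable_fun setT g -> cancel f g ->
  exists nu : {sigma_finite_measure set T2 -> \bar R}, pushforward mu f = nu.
Proof.
move=> mf mg fK.
pose nu : {measure set T2 -> \bar R} :=
  measure_function_pushforward__canonical__measure_function_Measure mu mf.
have sf : sigma_finite setT (pushforward mu f).
  have [F TF Foo] := sigma_finiteT mu.
  exists (fun i => g @^-1` F i).
    by rewrite -preimage_bigcup -TF preimage_setT.
  move=> i; have [mF Fi] := Foo i; split.
    by rewrite -[X in measurable X]setTI; exact: mg.
  rewrite /pushforward -comp_preimage (_ : g \o f = id)//.
  by apply/funext => x /=; rewrite fK.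
exact: (@sigma_finite_measureP _ _ _ nu sf).
Qed.

Lemma product_sigma_finiteP d1 d2 (T1 : measurableType d1)
    (T2 : measurableType d2) (R : realType)
    (m1 : {sigma_finite_measure set T1 -> \bar R})
    (m2 : {sigma_finite_measure set T2 -> \bar R}) :
  exists nu : {sigma_finite_measure set (T1 * T2)%type -> \bar R},
    (m1 \x m2)%E = nu.
Proof.
apply: (@sigma_finite_measureP _ _ _ (m1 \x m2)%E).
have /sigma_finiteP[F [TF ndF Foo]] := sigma_finiteT m1.
have /sigma_finiteP[G [TG ndG Goo]] := sigma_finiteT m2.
exists (fun n => F n `*` G n).
  rewrite -setXTT TF TG predeqE => -[x y]; split.
    move=> [/= [n _ Fnx] [k _ Gky]]; exists (maxn n k) => //; split.
    - by move: x Fnx; exact/subsetPset/ndF/leq_maxl.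
    - by move: y Gky; exact/subsetPset/ndG/leq_maxr.
  by move=> [n _ []/= ? ?]; split; exists n.
move=> k; have [? ?] := Foo k; have [? ?] := Goo k.
split; first exact: measurableX.
by rewrite /= product_measure1E// lte_mul_pinfty// ge0_fin_numE.
Qed.

Lemma lebesgue_tupleP (R : realType) n :
  exists mu : {sigma_finite_measure set (n.-tuple R) -> \bar R},
    @lebesgue_tuple R n = mu.
Proof.
elim: n => [|n [mu /= ->]].
  by eexists; reflexivity.
have [p ->] := product_sigma_finiteP (@lebesgue_measure R) mu.
apply: (@pushforward_sigma_finite _ _ _ _ R p _
  (fun t : n.+1.-tuple R => (thead t, [tuple of behead t]))).
- exact: measurable_cons.
- apply/measurable_fun_pairP; split.
    exact: measurable_tnth.
  exact: measurable_behead.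
- by move=> [x t]; congr pair; exact/val_inj.
Qed.

Lemma lebesgue_tuple_box (R : realType) n (D : 'I_n -> set R) :
  (forall i, measurable (D i)) ->
  @lebesgue_tuple R n [set t | forall i, D i (tnth t i)] =
  (\prod_(i < n) lebesgue_measure (D i))%E.
Proof.
elim: n D => [|n IH] D mD.
  by rewrite big_ord0 /= diracE mem_set//= => -[].
rewrite big_ord_recl /= /pushforward.
have [mu muE] := lebesgue_tupleP R n.
rewrite muE -IH// muE -product_measure1E//=; last first.
  rewrite (_ : [set _ | _] = \big[setI/setT]_(i < n)
      ((fun t => tnth t i) @^-1` D (lift ord0 i))).
    apply: bigsetI_measurable => i _; rewrite -[X in measurable X]setTI.
    exact: measurable_tnth.
  rewrite -bigcap_seq; apply/seteqP; split => t /= h i.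
    by move=> _; exact: h.
  by apply: (h i); rewrite /= mem_index_enum.
  exact: (mD ord0).
congr (product_measure1 _ _ _); apply/seteqP; split => -[x t] /=.
  move=> h; split; first exact: (h ord0).
  by move=> i; have := h (lift ord0 i); rewrite tnthS.
move=> [h0 h] i; case: (unliftP ord0 i) => [j ->|-> //].
by rewrite tnthS.
Qed.

Lemma measurable_mx_coords d (T : measurableType d) m n (k : 'I_(m * n)) :
  measurable_fun setT (@mx_coords d T m n k).
Proof.
move=> _ Y mY; rewrite setTI; apply: sub_sigma_algebra => /=.
rewrite -bigcup_seq/=; exists k => /=; first by rewrite mem_index_enum.
by exists Y => //; rewrite setTI.
Qed.

Lemma mx_coords_of_tuple d (T : measurableType d) m n (k : 'I_(m * n)) t :
  mx_coords k (mx_of_tuple t) = tnth t k :> T.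
Proof. by rewrite /mx_coords /mx_of_tuple vec_mxK mxE. Qed.

Lemma lebesgue_mxP (R : realType) m n :
  exists mu : {sigma_finite_measure set 'M[R]_(m, n) -> \bar R},
    @lebesgue_mx R m n = mu.
Proof.
rewrite /lebesgue_mx; have [mu ->] := lebesgue_tupleP R (m * n).
apply: (@pushforward_sigma_finite _ _ _ _ R mu (@mx_of_tuple R m n)
  (fun A => [tuple mx_coords k A | k < m * n])).
- move=> _ Y; rewrite setTI.
  suff : measurable `<=` [set Y | measurable (@mx_of_tuple R m n @^-1` Y)].
    by apply.
  apply: smallest_sub.
    split => [|A|F] /=; first by rewrite preimage_set0.
      by rewrite setTD preimage_setC; exact: measurableC.
    by move=> mF; rewrite preimage_bigcup; apply: bigcup_measurable => k _.
  rewrite -bigcup_seq => A [k _ [B mB <-]] /=; rewrite setTI -comp_preimage.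
  rewrite (_ : _ \o _ = fun t => tnth t k); last first.
    by apply/funext => t /=; exact: mx_coords_of_tuple.
  by rewrite -[X in measurable X]setTI; exact: measurable_tnth.
- apply/measurable_fun_tnthP => k.
  rewrite (_ : _ \o _ = mx_coords k); first exact: measurable_mx_coords.
  by apply/funext => A /=; rewrite tnth_mktuple.
- by move=> t; apply: eq_from_tnth => k; rewrite tnth_mktuple mx_coords_of_tuple.
Qed.

Section lebesgue_mx_measure.
Context (R : realType) (m n : nat).

Let leb0 : @lebesgue_mx R m n set0 = 0%E.
Proof. by have [mu ->] := lebesgue_mxP R m n; exact: measure0. Qed.

Let leb_ge0 A : (0 <= @lebesgue_mx R m n A)%E.
Proof. by have [mu ->] := lebesgue_mxP R m n; exact: measure_ge0. Qed.

Let leb_sigma_additive : semi_sigma_additive (@lebesgue_mx R m n).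
Proof.
by have [mu ->] := lebesgue_mxP R m n; exact: measure_semi_sigma_additive.
Qed.

HB.instance Definition _ := isMeasure.Build _ _ _ (@lebesgue_mx R m n)
  leb0 leb_ge0 leb_sigma_additive.

Let leb_sigma_finite : sigma_finite setT (@lebesgue_mx R m n).
Proof. by have [mu ->] := lebesgue_mxP R m n; exact: sigma_finiteT. Qed.

HB.instance Definition _ := Measure_isSigmaFinite.Build _ _ _
  (@lebesgue_mx R m n) leb_sigma_finite.

Lemma lebesgue_mx_box (D : 'I_(m * n) -> set R) :
  (forall k, measurable (D k)) ->
  lebesgue_mx [set A | forall k, D k (mx_coords k A)] =
  (\prod_(k < m * n) lebesgue_measure (D k))%E.
Proof.
move=> mD; rewrite -lebesgue_tuple_box//; congr lebesgue_tuple.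
by apply/seteqP; split => t /= h k; have := h k; rewrite mx_coords_of_tuple.
Qed.

End lebesgue_mx_measure.

Section singular_values.
Context (R : realType) (m n : nat).
Implicit Type A : 'M[R]_(m, n).

(* Square roots of the eigenvalues of A^T A, with multiplicity: a sequence of
   length n, hence padded with zeros when n > m. *)
Definition singular_values A : seq R :=
  let p := char_poly (A^T *m A) in
  flatten [seq nseq (mup x p) (Num.sqrt x) | x <- rootsR p].

Definition nuclear_norm A : R := \sum_(s <- singular_values A) s.

Definition op_norm A : R := \big[Num.max/0]_(s <- singular_values A) s.

End singular_values.

Section trace_regression.
Context (R : realType) (n m1 m2 : nat).
Variable X : 'I_n -> 'M[R]_(m1, m2).

Definition mx_inner (A B : 'M[R]_(m1, m2)) : R := \tr (A^T *m B).

(* The squared norm ||A||_{L_2(X)}^2. *)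
Definition sqnorm_L2X (A : 'M[R]_(m1, m2)) : R :=
  n%:R^-1 * \sum_(i < n) mx_inner (X i) A ^+ 2.

Definition prediction_loss (B B' : 'M[R]_(m1, m2)) : R := sqnorm_L2X (B - B').

Definition design_constant : R :=
  Num.max
    (Num.sqrt (op_norm (n%:R^-1 *: \sum_(i < n) X i *m (X i)^T)))
    (Num.sqrt (op_norm (n%:R^-1 *: \sum_(i < n) (X i)^T *m X i))).

Definition potential (y : 'I_n -> R) (lam : R) (B : 'M[R]_(m1, m2)) : R :=
  (2 * n%:R)^-1 * \sum_(i < n) (y i - mx_inner (X i) B) ^+ 2
  + lam * nuclear_norm B.

Definition pseudo_posterior (y : 'I_n -> R) (lam tau : R)
    (A : set 'M[R]_(m1, m2)) : \bar R :=
  ((\int[@lebesgue_mx R m1 m2]_(B in A) (expR (- potential y lam B / tau))%:E)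
   / (\int[@lebesgue_mx R m1 m2]_B (expR (- potential y lam B / tau))%:E))%E.

End trace_regression.

Record compact_svd (R : realType) (m1 m2 : nat) (B : 'M[R]_(m1, m2)) :=
  CompactSVD {
    svdV1 : 'M[R]_(m1, \rank B) ;
    svdS : 'rV[R]_(\rank B) ;
    svdV2 : 'M[R]_(m2, \rank B) ;
    svdV1_orthonormal : svdV1^T *m svdV1 = 1%:M ;
    svdV2_orthonormal : svdV2^T *m svdV2 = 1%:M ;
    svdS_gt0 : forall i, 0 < svdS 0 i ;
    svdS_nonincreasing :
      forall i j : 'I_(\rank B), (i <= j)%N -> svdS 0 j <= svdS 0 i ;
    svdE : B = svdV1 *m diag_mx svdS *m svdV2^T
  }.

Definition cols_in (R : realType) (m r : nat) (J : {set 'I_r})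
    (V : 'M[R]_(m, r)) : 'M[R]_(m, #|J|) :=
  colsub (@enum_val _ (mem J)) V.

Section compatibility.
Context (R : realType) (n m1 m2 : nat).
Variable X : 'I_n -> 'M[R]_(m1, m2).
Variables (B : 'M[R]_(m1, m2)) (s : compact_svd B) (J : {set 'I_(\rank B)}).

Definition projJc (U : 'M[R]_(m1, m2)) : 'M[R]_(m1, m2) :=
  let V1J := cols_in J (svdV1 s) in
  let V2J := cols_in J (svdV2 s) in
  (1%:M - V1J *m V1J^T) *m U *m (1%:M - V2J *m V2J^T).

Definition projJc_perp (U : 'M[R]_(m1, m2)) : 'M[R]_(m1, m2) := U - projJc U.

(* Equals +oo when no U satisfies the constraint, in particular when J is
   empty. *)
Definition compat_factor (c : R) : \bar R :=
  ereal_inf [set (c ^+ 2 * #|J|%:R * sqnorm_L2X X U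
      / (c * nuclear_norm (projJc_perp U) - nuclear_norm (projJc U)) ^+ 2)%:E
    | U in [set U : 'M[R]_(m1, m2) |
        nuclear_norm (projJc U) < c * nuclear_norm (projJc_perp U)]].

(* In \bar R, 0^-1 = +oo, (+oo)^-1 = 0 and 0 * +oo = 0, so that this ratio is 0
   when J is empty and +oo when J is nonempty and the compatibility factor
   vanishes. *)
Definition card_over_compat (c : R) : \bar R :=
  ((#|J|%:R)%:E / compat_factor c)%E.

End compatibility.

(* xi has law N(0, sigma^2)^{(x) n} = N(0_n, sigma^2 I_n): the joint law is the
   product of the centred normal laws of standard deviation sigma.  Taking some
   D i = setT gives the product rule for all subfamilies. *)
Definition isotropic_gaussian (R : realType) (d : measure_display)
    (T : measurableType d) (P : probability T R) (n : nat) (sigma : R)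
    (xi : 'I_n -> {RV P >-> R}) : Prop :=
  forall D : 'I_n -> set R, (forall i, measurable (D i)) ->
    P [set w | forall i, D i (xi i w)] =
    (\prod_(i < n) normal_prob 0 sigma (D i))%E.

(* Main.v *)
(* Let B be a point, Bb an oracle with index set J, D = Bb - B and p = m1 m2.

   Posterior concentration: changing variables along B |-> (1 - a) B + a Bb with
   a = 1/9 in the normalizing integral and using the convexity of the potential
   V shows that V B - V Bb + (4/9) ||D||^2 <= (7/2) p tau outside a set of
   posterior mass at most (9/8)^p exp(- 7 p / 18).

   Oracle inequality: by the basic inequality for V, it remains to control the
   noise term <sum_i xi_i X_i, D>.  Let Pi be the orthogonal projection of R^n
   onto the fitted values of the range of projJc_perp, a space of dimension at
   most |J| (m1 + m2).  The part of the noise orthogonal to Pi only sees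
   projJc D and is bounded, by duality, with the operator norm of a Gaussian
   matrix series; the remaining part is bounded by |Pi xi|, a chi-square
   variable.  Since kappa <= v^2 / max(m1, m2), with v the design constant, the
   latter is dominated by lam^2 |J| / kappa, with a constant small enough to end
   up with 9/4.

   The two tail bounds come from moment recursions obtained by Gaussian
   integration by parts for polynomials.  When p <= 100 the posterior lower
   bound is negative and there is nothing to prove. *)

Require Import Defs.
From mathcomp Require Import all_boot all_order all_algebra.
From mathcomp Require Import complex polyrcf ring lra zify.
From mathcomp Require Import all_classical all_reals all_analysis.
From mathcomp Require Import measurable_realfun.

Set Implicit Arguments.
Unset Strict Implicit.
Unset Printing Implicit Defensive.

Import Order.TTheory GRing.Theory Num.Theory.
Import numFieldNormedType.Exports.

Local Open Scope classical_set_scope.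
Local Open Scope ring_scope.

(** * Singular values and the nuclear norm *)

(** The constant 9/4 leaves no slack for the usual argument. Let a and b be the nuclear norms of
    [projJc_perp D] and [projJc D], q = ||D|| and t = lam sqrt(|J| / kappa). If the noise only has
    operator norm at most lam / 2, the oracle bound contains lam (3a - b) <= 3 t q, and 3 t q <=
    (9/4) t^2 + q^2 spends all the curvature that the posterior mode would provide. The change of
    variables behind the concentration keeps only the fraction 8/9 of q^2. The noise split pays for
    this loss. Its first part acts on [projJc D] alone, so its norm may reach (2/3) lam: 2a - 2b +
    (4/3) b = (2/3)(3a - b) keeps the cone constant 3 and lowers the linear term to 2 t q. The
    larger threshold also multiplies the tail exponent by (4/3)^2 = 16/9, which frees probability
    for the second event. The chi-square part adds (4/5) t q, and (14/5)^2 <= 4 (9/4) (8/9) closes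
    the account. The oracle is a near-minimizer fixed before the noise is drawn, so one projection
    and one pair of events suffice. An infimum that may not be attained costs p tau, the gap between
    7 p tau and 8 p tau. *)

Section char_poly_spectrum.
Variable R : realType.

(** Sylvester's identity: the determinant of [M] is computed by two block eliminations, one from the
    right and one from the left. The powers of 'X account for the different sizes. *)
Lemma char_poly_mulmxC m n (A : 'M[R]_(m, n)) (B : 'M[R]_(n, m)) :
  char_poly (A *m B) * 'X^n = char_poly (B *m A) * 'X^m.
Proof.
pose Ap := map_mx polyC A; pose Bp := map_mx polyC B.
pose M := block_mx 'X%:M Ap Bp 1%:M.
have detM : \det M = char_poly (A *m B).
  have : M *m block_mx 1%:M 0 (- Bp) 1%:M =
      block_mx (char_poly_mx (A *m B)) Ap 0 1%:M.
    rewrite mulmx_block !mulmx1 !mulmx0 !mul1mx addrN add0r.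
    by rewrite add0r mulmxN -map_mxM.
  move=> /(congr1 determinant); rewrite det_mulmx det_lblock det_ublock.
  by rewrite !det1 !mulr1.
have : block_mx 1%:M 0 (- Bp) 'X%:M *m M =
    block_mx 'X%:M Ap 0 (char_poly_mx (B *m A)).
  rewrite mulmx_block !mulmx1 !mul0mx !mul1mx !addr0.
  rewrite mulNmx mul_mx_scalar mul_scalar_mx addNr.
  by rewrite mulNmx addrC /char_poly_mx map_mxM.
move=> /(congr1 determinant); rewrite det_mulmx det_lblock det_ublock.
by rewrite det1 mul1r !det_scalar detM mulrC => ->; rewrite mulrC.
Qed.

Lemma mup_prod_XsubC (s : seq R) x :
  mup x (\prod_(z <- s) ('X - z%:P)) = count_mem x s.
Proof.
elim: s => [|z s IH]; first by rewrite big_nil mupNroot// rootE hornerC oner_eq0.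
rewrite big_cons mupM ?polyXsubC_eq0//; last first.
  by rewrite monic_neq0// monic_prod_XsubC.
by rewrite IH -['X - z%:P]expr1 mup_XsubCX /=; case: eqP.
Qed.

(** For a split polynomial, [rootsR] lists each root once and [mup] restores its number of
    occurrences in [s], so the flattened list is a rearrangement of [map F s]. *)
Lemma sum_rootsR_prod_XsubC (F : R -> R) (s : seq R) :
  let p := \prod_(z <- s) ('X - z%:P) in
  \sum_(x <- flatten [seq nseq (mup x p) (F x) | x <- rootsR p]) x =
  \sum_(z <- s) F z.
Proof.
set p := \prod_(z <- s) _ => /=.
have p0 : p != 0 by rewrite monic_neq0// monic_prod_XsubC.
rewrite big_flatten big_map -[RHS](big_undup_iterop_count +%R) /=.
have rp : perm_eq (rootsR p) (undup s).
  apply: uniq_perm; [|exact: undup_uniq|].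
    apply: (@sorted_uniq _ <%R); [exact: lt_trans|exact: ltxx|].
    exact: sorted_roots.
  move=> x; have := roots_on_rootsR p0 x; rewrite in_itv /= => <-.
  by rewrite mem_undup root_prod_XsubC.
rewrite (perm_big _ rp) /=; apply: eq_bigr => x _.
rewrite /p mup_prod_XsubC Monoid.iteropE.
by elim: (count_mem x s) => [|k IH] /=; rewrite ?big_nil ?big_cons ?IH.
Qed.

End char_poly_spectrum.

(** * The trace inner product *)

Section inner_product.
Variable R : realType.

Lemma mx_innerE m n (A B : 'M[R]_(m, n)) :
  mx_inner A B = \sum_i \sum_j A i j * B i j.
Proof.
rewrite /mx_inner /mxtrace exchange_big /=.
apply: eq_bigr => i _; rewrite mxE; apply: eq_bigr => j _.
by rewrite mxE.
Qed.

Lemma mx_innerC m n (A B : 'M[R]_(m, n)) : mx_inner A B = mx_inner B A.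
Proof.
by rewrite !mx_innerE; do 2 (apply: eq_bigr => ? _); rewrite mulrC.
Qed.

Lemma mx_innerDr m n (A B C : 'M[R]_(m, n)) :
  mx_inner A (B + C) = mx_inner A B + mx_inner A C.
Proof. by rewrite /mx_inner mulmxDr mxtraceD. Qed.

Lemma mx_innerZr m n a (A B : 'M[R]_(m, n)) :
  mx_inner A (a *: B) = a * mx_inner A B.
Proof. by rewrite /mx_inner -scalemxAr mxtraceZ. Qed.

Lemma mx_innerNr m n (A B : 'M[R]_(m, n)) : mx_inner A (- B) = - mx_inner A B.
Proof. by rewrite -scaleN1r mx_innerZr mulN1r. Qed.

Lemma mx_innerBr m n (A B C : 'M[R]_(m, n)) :
  mx_inner A (B - C) = mx_inner A B - mx_inner A C.
Proof. by rewrite mx_innerDr mx_innerNr. Qed.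

Lemma mx_inner0r m n (A : 'M[R]_(m, n)) : mx_inner A 0 = 0.
Proof. by rewrite /mx_inner mulmx0 mxtrace0. Qed.

Lemma mx_inner_sumr m n I (r : seq I) (P : pred I) (A : 'M[R]_(m, n)) F :
  mx_inner A (\sum_(i <- r | P i) F i) = \sum_(i <- r | P i) mx_inner A (F i).
Proof. by rewrite /mx_inner mulmx_sumr raddf_sum. Qed.

Lemma mx_innerDl m n (A B C : 'M[R]_(m, n)) :
  mx_inner (A + B) C = mx_inner A C + mx_inner B C.
Proof. by rewrite !(mx_innerC _ C) mx_innerDr. Qed.

Lemma mx_innerZl m n a (A B : 'M[R]_(m, n)) :
  mx_inner (a *: A) B = a * mx_inner A B.
Proof. by rewrite !(mx_innerC _ B) mx_innerZr. Qed.

Lemma mx_innerBl m n (A B C : 'M[R]_(m, n)) :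
  mx_inner (A - B) C = mx_inner A C - mx_inner B C.
Proof. by rewrite !(mx_innerC _ C) mx_innerBr. Qed.

Lemma mx_inner0l m n (A : 'M[R]_(m, n)) : mx_inner 0 A = 0.
Proof. by rewrite mx_innerC mx_inner0r. Qed.

Lemma mx_inner_suml m n I (r : seq I) (P : pred I) (A : 'M[R]_(m, n)) F :
  mx_inner (\sum_(i <- r | P i) F i) A = \sum_(i <- r | P i) mx_inner (F i) A.
Proof.
by rewrite mx_innerC mx_inner_sumr; apply: eq_bigr => i _; rewrite mx_innerC.
Qed.

Lemma mx_inner_mull m n k (A : 'M[R]_(m, k)) (B : 'M[R]_(k, n)) C :
  mx_inner (A *m B) C = mx_inner B (A^T *m C).
Proof. by rewrite /mx_inner trmx_mul mulmxA. Qed.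

Lemma mx_inner_mulr m n k (A : 'M[R]_(m, k)) (B : 'M[R]_(k, n)) C :
  mx_inner (A *m B) C = mx_inner A (C *m B^T).
Proof. by rewrite /mx_inner trmx_mul -mulmxA mxtrace_mulC mulmxA. Qed.

Lemma mx_inner_trmx m n (A B : 'M[R]_(m, n)) :
  mx_inner A^T B^T = mx_inner A B.
Proof. by rewrite /mx_inner -trmx_mul mxtrace_tr mxtrace_mulC. Qed.

Lemma mx_inner_ge0 m n (A : 'M[R]_(m, n)) : 0 <= mx_inner A A.
Proof.
by rewrite mx_innerE; do 2 (apply: sumr_ge0 => ? _); rewrite -expr2 sqr_ge0.
Qed.

Lemma mx_inner_eq0 m n (A : 'M[R]_(m, n)) : mx_inner A A = 0 -> A = 0.
Proof.
rewrite mx_innerE => /eqP; rewrite psumr_eq0; last first.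
  by move=> i _; apply: sumr_ge0 => j _; rewrite -expr2 sqr_ge0.
move=> /allP h; apply/matrixP => i j; rewrite mxE.
have := h i; rewrite mem_index_enum => /(_ isT) /=.
rewrite psumr_eq0; last by move=> k _; rewrite -expr2 sqr_ge0.
move=> /allP /(_ j); rewrite mem_index_enum => /(_ isT) /=.
by rewrite mulf_eq0 orbb => /eqP.
Qed.

Lemma mx_inner_amgm m n (A B : 'M[R]_(m, n)) :
  2 * mx_inner A B <= mx_inner A A + mx_inner B B.
Proof.
have := mx_inner_ge0 (A - B).
rewrite mx_innerBr !mx_innerBl (mx_innerC B A); lra.
Qed.

Lemma mx_inner_cs m n (A B : 'M[R]_(m, n)) :
  mx_inner A B ^+ 2 <= mx_inner A A * mx_inner B B.
Proof.
have B0 := mx_inner_ge0 B.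
move: B0; rewrite le_eqVlt => /orP[/eqP B0|B0].
  by rewrite (mx_inner_eq0 (esym B0)) !mx_inner0r expr0n /= mulr0.
have := mx_inner_ge0 (mx_inner B B *: A - mx_inner A B *: B).
rewrite !(mx_innerBr, mx_innerBl, mx_innerZr, mx_innerZl) (mx_innerC B A).
set a := mx_inner A A; set b := mx_inner B B in B0 *; set c := mx_inner A B.
have -> : b * (b * a - c * c) - c * (b * c - c * b) =
    b * (a * b - c ^+ 2) by ring.
by rewrite pmulr_rge0// subr_ge0.
Qed.

End inner_product.

(** * Matrices with orthonormal columns *)

Section orthonormal.
Variable R : realType.

Definition orthonormal m r (V : 'M[R]_(m, r)) := V^T *m V = 1%:M.

Lemma orthonormal_isometry m r k (V : 'M[R]_(m, r)) (A B : 'M[R]_(r, k)) :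
  orthonormal V -> mx_inner (V *m A) (V *m B) = mx_inner A B.
Proof. by move=> oV; rewrite mx_inner_mull mulmxA oV mul1mx. Qed.

Lemma bessel m r k (V : 'M[R]_(m, r)) (A : 'M[R]_(m, k)) : orthonormal V ->
  mx_inner (V^T *m A) (V^T *m A) <= mx_inner A A.
Proof.
move=> oV; have := mx_inner_ge0 (A - V *m (V^T *m A)).
rewrite !(mx_innerBr, mx_innerBl) (orthonormal_isometry _ _ oV).
rewrite (mx_innerC A) !mx_inner_mull; lra.
Qed.

Lemma orthonormal_row_mx m r k (V : 'M[R]_(m, r)) (W : 'M[R]_(m, k)) :
  orthonormal V -> orthonormal W -> V^T *m W = 0 -> orthonormal (row_mx V W).
Proof.
rewrite /orthonormal => oV oW VW.
have WV : W^T *m V = 0 by apply: trmx_inj; rewrite trmx_mul trmxK VW trmx0.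
rewrite tr_row_mx mul_col_row oV oW VW WV.
by rewrite -scalar_mx_block.
Qed.

Lemma mx_inner_diag r (d : 'rV[R]_r) (A : 'M[R]_r) :
  mx_inner (diag_mx d) A = \sum_i d 0 i * A i i.
Proof.
rewrite mx_innerE; apply: eq_bigr => i _.
rewrite (bigD1 i)//= big1 ?addr0 ?mxE ?eqxx ?mulr1n// => j ji.
by rewrite !mxE eq_sym (negPf ji) mul0r.
Qed.

Lemma mxE_inner m n (A : 'M[R]_(m, n)) i j :
  A i j = mx_inner (delta_mx i 0 : 'cV_m) (A *m (delta_mx j 0 : 'cV_n)).
Proof.
rewrite /mx_inner trmx_delta -colE -rowE.
by rewrite /mxtrace big_ord1 !mxE.
Qed.

Lemma mx_inner_colE m r k (V : 'M[R]_(m, r)) (A : 'M[R]_(m, k)) (W : 'M[R]_(k, r)) i :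
  (V^T *m A *m W) i i = mx_inner (col i V) (A *m col i W).
Proof.
by rewrite mxE_inner !colE mx_inner_mull !mulmxA.
Qed.

Lemma orthonormal_col m r (V : 'M[R]_(m, r)) i :
  orthonormal V -> mx_inner (col i V) (col i V) = 1.
Proof.
move=> oV; rewrite -[X in mx_inner _ X]mul1mx -mx_inner_colE mulmx1 oV.
by rewrite mxE eqxx.
Qed.

(* [op_le t W]: the operator norm of [W] is at most [t]. *)
Definition op_le m n (t : R) (W : 'M[R]_(m, n)) :=
  forall (u : 'cV_m) (v : 'cV_n), mx_inner u u = 1 -> mx_inner v v = 1 ->
  mx_inner u (W *m v) <= t.

Lemma op_le1 m n r (V : 'M[R]_(m, r)) (W : 'M[R]_(n, r)) :
  orthonormal V -> orthonormal W -> op_le 1 (V *m W^T).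
Proof.
move=> oV oW u v u1 v1; rewrite -mulmxA mx_innerC mx_inner_mull.
have := mx_inner_amgm (W^T *m v) (V^T *m u).
have := bessel u oV; have := bessel v oW; lra.
Qed.

End orthonormal.

(** * Singular value formula and duality for the nuclear norm *)

Section nuclear_norm.
Variables (R : realType) (m n : nat).
Implicit Types B : 'M[R]_(m, n).

(** Links the definition by roots of a characteristic polynomial to the factorization used
    everywhere else. With B^T B = V2 diag(d) V2^T, Sylvester's identity moves V2 to the other side,
    leaving the roots [d] and n - rank zeros, whose square roots add nothing. *)
Lemma nuclear_norm_svd B (s : compact_svd B) :
  nuclear_norm B = \sum_i svdS s 0 i.
Proof.
pose d : 'rV[R]_(\rank B) := \row_i (svdS s 0 i) ^+ 2.
have gram : B^T *m B = (svdV2 s *m diag_mx d) *m (svdV2 s)^T.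
  rewrite {1 2}(svdE s) !trmx_mul trmxK tr_diag_mx.
  rewrite !mulmxA -(mulmxA (svdV2 s *m diag_mx _)) (svdV1_orthonormal s) mulmx1.
  rewrite -(mulmxA (svdV2 s)) mulmx_diag; congr (_ *m diag_mx _ *m _).
pose rs := nseq (n - \rank B) 0 ++ [seq d 0 i | i <- index_enum 'I_(\rank B)].
have charE : char_poly (B^T *m B) = \prod_(z <- rs) ('X - z%:P).
  have Xr0 : 'X^(\rank B) != 0 :> {poly R} by rewrite monic_neq0// monicXn.
  apply: (mulIf Xr0); rewrite gram char_poly_mulmxC mulmxA.
  rewrite (svdV2_orthonormal s) mul1mx char_poly_trig ?diag_mx_is_trig//.
  rewrite big_cat big_map /= mulrAC [RHS]mulrC; congr (_ * _).
    by apply: eq_bigr => i _; rewrite mxE eqxx mulr1n.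
  rewrite -{1}(subnK (rank_leq_col B)) exprD; congr (_ * _).
  by elim: (n - _)%N => [|k IH]; rewrite ?big_nil// big_cons -IH subr0 exprS.
rewrite /nuclear_norm /singular_values charE sum_rootsR_prod_XsubC.
rewrite big_cat big_map /= big1_seq ?add0r; last first.
  by move=> z /=; rewrite mem_nseq => /andP[_ /eqP ->]; rewrite sqrtr0.
by apply: eq_bigr => i _; rewrite mxE sqrtr_sqr ger0_norm// ltW// svdS_gt0.
Qed.

Hypothesis svd : forall B, compact_svd B.

Lemma mx_inner_svd (W B : 'M[R]_(m, n)) (s : compact_svd B) :
  mx_inner W B =
  \sum_i svdS s 0 i * mx_inner (col i (svdV1 s)) (W *m col i (svdV2 s)).
Proof.
rewrite mx_innerC {1}(svdE s) -mulmxA mx_inner_mull mx_inner_mulr trmxK.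
rewrite mx_inner_diag; apply: eq_bigr => i _.
by rewrite mx_inner_colE.
Qed.

Lemma nuclear_norm_dual (W B : 'M[R]_(m, n)) t :
  op_le t W -> mx_inner W B <= t * nuclear_norm B.
Proof.
move=> Wt; rewrite (mx_inner_svd W (svd B)) (nuclear_norm_svd (svd B)) mulr_sumr.
apply: ler_sum => i _; rewrite mulrC ler_wpM2r ?(ltW (svdS_gt0 _ _))//.
by apply: Wt; apply: orthonormal_col;
  [exact: svdV1_orthonormal|exact: svdV2_orthonormal].
Qed.

(** V1 V2^T has operator norm at most 1 and attains the duality bound. The nuclear norm is thus a
    maximum of linear forms, from which the triangle inequality and convexity follow. *)
Lemma nuclear_norm_cert B :
  mx_inner (svdV1 (svd B) *m (svdV2 (svd B))^T) B = nuclear_norm B.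
Proof.
set s := svd B; rewrite (mx_inner_svd _ s) (nuclear_norm_svd s).
apply: eq_bigr => i _; rewrite -mx_inner_colE !mulmxA.
rewrite (svdV1_orthonormal s) mul1mx (svdV2_orthonormal s).
by rewrite mxE eqxx mulr1.
Qed.

Lemma nuclear_norm_ge0 B : 0 <= nuclear_norm B.
Proof.
rewrite (nuclear_norm_svd (svd B)); apply: sumr_ge0 => i _.
by rewrite ltW// svdS_gt0.
Qed.

Lemma nuclear_norm_le B t :
  (forall W, op_le 1 W -> mx_inner W B <= t) -> nuclear_norm B <= t.
Proof.
by move=> h; rewrite -nuclear_norm_cert; apply: h; apply: op_le1;
  [exact: svdV1_orthonormal|exact: svdV2_orthonormal].
Qed.

Lemma nuclear_norm_triangle A B :
  nuclear_norm (A + B) <= nuclear_norm A + nuclear_norm B.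
Proof.
apply: nuclear_norm_le => W W1; rewrite mx_innerDr.
by rewrite lerD// -[leRHS]mul1r nuclear_norm_dual.
Qed.

Lemma nuclear_normZ_le a B : 0 <= a ->
  nuclear_norm (a *: B) <= a * nuclear_norm B.
Proof.
move=> a0; apply: nuclear_norm_le => W W1; rewrite mx_innerZr.
by rewrite ler_wpM2l// -[leRHS]mul1r nuclear_norm_dual.
Qed.

Lemma nuclear_norm_convex (t : R) A B : 0 <= t -> t <= 1 ->
  nuclear_norm ((1 - t) *: A + t *: B) <=
  (1 - t) * nuclear_norm A + t * nuclear_norm B.
Proof.
move=> t0 t1; apply: (le_trans (nuclear_norm_triangle _ _)).
by rewrite lerD// nuclear_normZ_le// subr_ge0.
Qed.

Lemma nuclear_normN B : nuclear_norm (- B) = nuclear_norm B.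
Proof.
rewrite /nuclear_norm /singular_values.
suff -> : (- B)^T *m (- B) = B^T *m B by [].
have -> : (- B)^T = - B^T by apply/matrixP => i j; rewrite !mxE.
by rewrite mulmxN mulNmx opprK.
Qed.

Lemma nuclear_norm_dual_norm (W B : 'M[R]_(m, n)) t :
  op_le t W -> `|mx_inner W B| <= t * nuclear_norm B.
Proof.
move=> Wt; rewrite ler_norml nuclear_norm_dual// andbT lerNl -mx_innerNr.
by rewrite -nuclear_normN nuclear_norm_dual.
Qed.

(* With [C = Q1 S Q2^T], the matrix [V W^T + Q1 Q2^T] has operator norm at most
   1 and certifies the lower bound by duality. *)
Lemma nuclear_norm_add_orth r (A : 'M[R]_r) C (V : 'M[R]_(m, r))
    (W : 'M[R]_(n, r)) :
  orthonormal V -> orthonormal W -> V^T *m C = 0 -> C *m W = 0 ->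
  mx_inner (V *m W^T) (V *m A *m W^T) + nuclear_norm C <=
  nuclear_norm (V *m A *m W^T + C).
Proof.
move=> oV oW VC CW; set s := svd C.
pose Q1 := svdV1 s; pose Q2 := svdV2 s.
have oQ1 : orthonormal Q1 := svdV1_orthonormal s.
have oQ2 : orthonormal Q2 := svdV2_orthonormal s.
have diag0 k (X : 'M[R]_(k, \rank C)) : X *m diag_mx (svdS s) = 0 -> X = 0.
  move=> /matrixP X0; apply/matrixP => i j; have := X0 i j; rewrite mul_mx_diag.
  by rewrite !mxE => /eqP; rewrite mulf_eq0 (gt_eqF (svdS_gt0 s j)) orbF => /eqP.
have CQ2 : C *m Q2 = Q1 *m diag_mx (svdS s).
  have e : Q1 *m diag_mx (svdS s) *m Q2^T *m Q2 = Q1 *m diag_mx (svdS s).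
    by rewrite -(mulmxA _ Q2^T) oQ2 mulmx1.
  by rewrite -e -svdE.
have Q1C : Q1^T *m C = diag_mx (svdS s) *m Q2^T.
  have e : Q1^T *m (Q1 *m diag_mx (svdS s) *m Q2^T) = diag_mx (svdS s) *m Q2^T.
    by rewrite !mulmxA oQ1 mul1mx.
  by rewrite -e -svdE.
have VQ1 : V^T *m Q1 = 0.
  by apply: diag0; rewrite -mulmxA -CQ2 mulmxA VC mul0mx.
have WQ2 : W^T *m Q2 = 0.
  apply: diag0; apply: trmx_inj; rewrite !trmx_mul trmxK trmx0 tr_diag_mx.
  by rewrite mulmxA -Q1C -mulmxA CW mulmx0.
have := nuclear_norm_dual (V *m A *m W^T + C)
  (op_le1 (orthonormal_row_mx oV oQ1 VQ1) (orthonormal_row_mx oW oQ2 WQ2)).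
rewrite mul1r tr_row_mx mul_row_col; apply: le_trans.
rewrite mx_innerDr !mx_innerDl nuclear_norm_cert.
have -> : mx_inner (Q1 *m Q2^T) (V *m A *m W^T) = 0.
  rewrite mx_inner_mull !mulmxA -[Q1^T *m V]trmxK trmx_mul trmxK VQ1.
  by rewrite trmx0 !mul0mx mx_inner0r.
have -> : mx_inner (V *m W^T) C = 0 by rewrite mx_inner_mull VC mx_inner0r.
by rewrite addr0 add0r.
Qed.

(** By duality: both sides expand along the pairs of columns of V and W, where a matrix of operator
    norm at most 1 yields at most 1 and V W^T yields exactly 1. *)
Lemma nuclear_norm_diag_le r (V : 'M[R]_(m, r)) (W : 'M[R]_(n, r)) (d : 'rV[R]_r) :
  orthonormal V -> orthonormal W -> (forall i, 0 <= d 0 i) ->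
  nuclear_norm (V *m diag_mx d *m W^T) <=
  mx_inner (V *m W^T) (V *m diag_mx d *m W^T).
Proof.
move=> oV oW d0; apply: nuclear_norm_le => X X1.
have inE Y : mx_inner Y (V *m diag_mx d *m W^T) =
    \sum_i d 0 i * mx_inner (col i V) (Y *m col i W).
  rewrite mx_innerC -mulmxA mx_inner_mull mx_inner_mulr trmxK mx_inner_diag.
  by apply: eq_bigr => i _; rewrite mx_inner_colE.
rewrite !inE; apply: ler_sum => i _; rewrite ler_wpM2l//.
have -> : mx_inner (col i V) (V *m W^T *m col i W) = 1.
  by rewrite -mx_inner_colE !mulmxA oV mul1mx oW mxE eqxx.
by apply: X1; exact: orthonormal_col.
Qed.

Lemma nuclear_norm_partial_isometry r (V : 'M[R]_(m, r)) (W : 'M[R]_(n, r)) :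
  orthonormal V -> orthonormal W -> r%:R <= nuclear_norm (V *m W^T).
Proof.
move=> oV oW; rewrite -[leRHS]mul1r.
have := nuclear_norm_dual (V *m W^T) (op_le1 oV oW); apply: le_trans.
by rewrite (orthonormal_isometry _ _ oV) mx_inner_trmx /mx_inner oW mxtrace1.
Qed.

(** The entry is tested against a matrix unit, of operator norm 1. This control by the nuclear norm
    makes its sublevel sets bounded, hence of finite Lebesgue measure. *)
Lemma entry_le_nuclear_norm B i j : `|B i j| <= nuclear_norm B.
Proof.
have d1 k (l : 'I_k) : orthonormal (delta_mx l 0 : 'cV[R]_k).
  by rewrite /orthonormal trmx_delta mul_delta_mx; apply/matrixP => a b;
    rewrite !ord1 !mxE.
have := nuclear_norm_dual_norm B (op_le1 (d1 m i) (d1 n j)).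
by rewrite mul1r mx_inner_mulr trmxK -mxE_inner.
Qed.

End nuclear_norm.

Section orthogonal_projection.
Variable R : realType.

(** With a full-rank factorization F = C D, the Gram matrix C^T C is invertible and Pi = C (C^T
    C)^-1 C^T; its trace is the rank of F. *)
Lemma orthogonal_projection n k (F : 'M[R]_(n, k)) :
  exists Pi : 'M[R]_n, [/\ Pi^T = Pi, Pi *m Pi = Pi, Pi *m F = F &
    \tr Pi <= k%:R].
Proof.
have [r [C [D [FE rk Gu]]]] : exists r (C : 'M[R]_(n, r)) (D : 'M[R]_(r, k)),
    [/\ F = C *m D, (r <= k)%N & C^T *m C \in unitmx].
  exists (\rank F), (col_base F), (row_base F).
  split; [by rewrite mulmx_base|exact: rank_leq_col|].
  rewrite -row_free_unit; apply: inj_row_free => v vG.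
  have /mx_inner_eq0 : mx_inner (v *m (col_base F)^T) (v *m (col_base F)^T) = 0.
    by rewrite mx_inner_mulr trmxK -mulmxA vG mx_inner0r.
  have /row_freeP[E CE] : row_free (col_base F)^T.
    by rewrite /row_free mxrank_tr; exact: col_base_full.
  by move=> /(congr1 (mulmx^~ E)); rewrite -mulmxA CE mulmx1 mul0mx.
exists (C *m invmx (C^T *m C) *m C^T); split.
- by rewrite !trmx_mul trmx_inv trmx_mul !trmxK mulmxA.
- by rewrite -!mulmxA (mulmxA C^T C) (mulmxA (C^T *m C)) mulmxV// mul1mx.
- by rewrite FE !mulmxA -(mulmxA _ C^T) -(mulmxA C) mulVmx// mulmx1.
- by rewrite mxtrace_mulC mulmxA mulmxV// mxtrace1 ler_nat.
Qed.

End orthogonal_projection.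

(** * Quadratic forms of symmetric matrices and the operator norm *)

Section op_norm_symmetric.
Variable R : realType.

Lemma le_op_norm m (M : 'M[R]_m) x :
  root (char_poly (M^T *m M)) x -> Num.sqrt x <= op_norm M.
Proof.
move=> rx; rewrite /op_norm.
have p0 : char_poly (M^T *m M) != 0 by rewrite monic_neq0// char_poly_monic.
have : Num.sqrt x \in singular_values M.
  apply/flattenP; exists (nseq (mup x (char_poly (M^T *m M))) (Num.sqrt x)).
    apply/mapP; exists x => //.
    by have := roots_on_rootsR p0 x; rewrite in_itv /= rx => <-.
  by rewrite mem_nseq -XsubC_dvd// dvdp_XsubCl rx eqxx.
elim: (singular_values M) => [//|y s IH].
rewrite inE big_cons => /orP[/eqP <-|/IH h].
  by rewrite le_max lexx.
by rewrite le_max h orbT.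
Qed.

Lemma op_norm_ge0 m n (M : 'M[R]_(m, n)) : 0 <= op_norm M.
Proof.
rewrite /op_norm; elim: (singular_values M) => [|y s IH]; first by rewrite big_nil.
by rewrite big_cons le_max IH orbT.
Qed.

(* Each eigenvalue [d] of the complexified [M] is real, and [d ^+ 2] is an
   eigenvalue of [M^T M], so [`|d|] is a singular value. *)
Lemma op_norm_quad m (M : 'M[R]_m) (u : 'cV[R]_m) : M^T = M ->
  mx_inner u (M *m u) <= op_norm M * mx_inner u u.
Proof.
move=> MT; pose f : {rmorphism R -> complex R} := real_complex R.
pose Mc := map_mx f M; pose uc := map_mx f u.
have conjf k l (A : 'M[R]_(k, l)) : map_mx Num.Def.conjC (map_mx f A) = map_mx f A.
  apply/matrixP => i j; rewrite !mxE; apply/CrealP.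
  by rewrite realE; case: (lerP 0 (A i j)) => h;
    rewrite -[0]/(f 0) /f /= !lecR ?h// (ltW h) orbT.
have Mherm : Mc \is hermsymmx.
  apply/is_hermitianmxP; rewrite expr0 scale1r map_trmx.
  by rewrite MT conjf.
set P := spectralmx Mc; set D := spectral_diag Mc.
have McE : Mc = invmx P *m diag_mx D *m P.
  by apply/orthomx_spectralP/hermitian_normalmx.
have Pu : P \is unitarymx by exact: spectral_unitarymx.
have PV := invmx_unitary Pu.
have Dreal i : exists2 d, D 0 i = f d & `|d| <= op_norm M.
  have /mxOverP /(_ 0 i) := hermitian_spectral_diag_real Mherm.
  rewrite -/D => /complex_realP[d Dd]; exists d => //.
  rewrite -sqrtr_sqr; apply: le_op_norm.
  rewrite MT -(fmorph_root f) map_char_poly map_mxM -/Mc rmorphXn -eigenvalue_root_char.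
  have PMc : row i P *m Mc = f d *: row i P.
    rewrite {1}McE !mulmxA -row_mul mulmxV ?spectral_unit// row1 -rowE.
    by rewrite row_diag_mx -scalemxAl -rowE Dd.
  apply/eigenvalueP; exists (row i P).
    by rewrite mulmxA PMc -scalemxAl PMc scalerA expr2.
  apply/negP => /eqP r0; have := row_unitarymxP Pu i i.
  by rewrite r0 linear0l eqxx => /eqP; rewrite eq_sym oner_eq0.
pose w := P *m uc.
(* Used for A = M and for A = 1, so that both sides of the inequality become weighted sums of the
   same squares of coordinates in the eigenbasis. *)
have quadE (A : 'M[R]_m) E : map_mx f A = invmx P *m diag_mx E *m P ->
    f (mx_inner u (A *m u)) = \sum_i E 0 i * `|w i 0| ^+ 2.
  move=> AE; transitivity (((map_mx Num.Def.conjC w)^T *m (diag_mx E *m w)) 0 0).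
    have PT : (map_mx Num.Def.conjC P)^T = invmx P by rewrite PV map_trmx.
    rewrite /w map_mxM conjf trmx_mul PT -mulmxA.
    rewrite !mulmxA -(mulmxA _ _ P) -!mulmxA (mulmxA (invmx P)) (mulmxA (invmx P *m _)) -AE.
    by rewrite -map_mxM map_trmx -map_mxM mxE /mx_inner /mxtrace big_ord1.
  rewrite mxE; apply: eq_bigr => i _.
  by rewrite mul_diag_mx !mxE mulrCA normCKC.
rewrite -lecR -[real_complex_def _ _]/(f _) -[X in _ <= X]/(f _) (quadE _ _ McE).
rewrite rmorphM /= -[X in mx_inner _ X]mul1mx.
rewrite (quadE _ (const_mx 1)); last first.
  by rewrite map_mx1 diag_const_mx mulmx1 mulVmx// spectral_unit.
rewrite mulr_sumr; apply: ler_sum => i _; rewrite [const_mx _ _ _]mxE mul1r.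
rewrite ler_wpM2r ?exprn_ge0//.
by have [d -> dM] := Dreal i; rewrite /= lecR (le_trans (ler_norm _)).
Qed.

End op_norm_symmetric.

(** * Convexity of trace moments *)

Section trace_inequality.
Variable R : realType.

(** Discrete maximum principle: an interior maximum exceeding both endpoint values would propagate,
    by midpoint convexity, down to index 0. *)
Lemma convex_seq_le (g : nat -> R) M :
  (forall a, (0 < a < M)%N -> 2 * g a <= g a.-1 + g a.+1) ->
  forall a, (a <= M)%N -> g a <= Num.max (g 0%N) (g M).
Proof.
move=> cvx.
have key : forall k a, (a <= M)%N -> (k <= a)%N -> (forall b, (b <= M)%N -> g b <= g a) ->
    Num.max (g 0%N) (g M) < g a -> forall j, (j <= k)%N -> g (a - j)%N = g a.
  move=> k a aM + amax lt; elim: k => [|k IH] ka j.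
    by rewrite leqn0 => /eqP ->; rewrite subn0.
  rewrite leq_eqVlt ltnS => /orP[/eqP ->|]; last exact/IH/ltnW.
  have gk := IH (ltnW ka) k (leqnn k).
  have ak : (0 < a - k < M)%N.
    rewrite subn_gt0 ka /= ltn_neqAle (leq_trans (leq_subr _ _) aM) andbT.
    apply/eqP => e; move: lt; rewrite -gk e gt_max => /andP[_].
    by rewrite ltxx.
  have := cvx _ ak; rewrite gk -subnS.
  have h1 := amax (a - k).+1; have h2 := amax (a - k.+1)%N.
  have {}h1 := h1 (proj2 (andP ak)).
  have {}h2 := h2 (leq_trans (leq_subr _ _) aM).
  by move=> h; apply/eqP; rewrite eq_le h2 /=; lra.
pose a0 := [arg max_(i > (ord0 : 'I_M.+1)) g i]%O.
have amax : forall b, (b <= M)%N -> g b <= g a0.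
  move=> b bM; rewrite /a0; case: arg_maxP => //= i _ h.
  by have := h (Ordinal (bM : (b < M.+1)%N)) isT.
move=> a aM; apply: (le_trans (amax a aM)); rewrite leNgt; apply/negP => lt.
have a0M : (a0 <= M)%N by rewrite -ltnS.
have := key a0 a0 a0M (leqnn _) amax lt a0 (leqnn _); rewrite subnn => g0.
by move: lt; rewrite gt_max g0 ltxx.
Qed.

Variable m : nat.
Implicit Types A H : 'M[R]_m.

Lemma exprmxD H a b : H ^+ (a + b) = H ^+ a *m H ^+ b.
Proof. exact: exprD. Qed.

Lemma exprmxS H a : H ^+ a.+1 = H *m H ^+ a.
Proof. exact: exprS. Qed.

Lemma exprmxSr H a : H ^+ a.+1 = H ^+ a *m H.
Proof. exact: exprSr. Qed.

Lemma expr0mx H : H ^+ 0 = 1%:M.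
Proof. by []. Qed.

Lemma tr_exprmx H k : H^T = H -> (H ^+ k)^T = H ^+ k.
Proof.
move=> HT; elim: k => [|k IH]; first by rewrite expr0mx trmx1.
by rewrite exprmxS trmx_mul IH HT -exprmxSr exprmxS.
Qed.

Lemma mx_inner_sandwich A H a b c d : A^T = A -> H^T = H ->
  mx_inner (H ^+ a *m A *m H ^+ b) (H ^+ c *m A *m H ^+ d) =
  \tr (A *m H ^+ (a + c) *m A *m H ^+ (d + b)).
Proof.
move=> AT HT; rewrite /mx_inner !trmx_mul !tr_exprmx// AT.
by rewrite -!mulmxA mxtrace_mulC !exprmxD -!mulmxA.
Qed.

(* By AM-GM, [a |-> tr (A H^(2a) A H^(2(M - a)))] is midpoint-convex, and its
   two endpoint values coincide; odd powers [q] need one more AM-GM. *)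
Lemma tr_sandwich_le A H M q : A^T = A -> H^T = H -> (q <= M.*2)%N ->
  \tr (A *m H ^+ q *m A *m H ^+ (M.*2 - q)) <= \tr (A *m A *m H ^+ M.*2).
Proof.
move=> AT HT qM.
pose g a := \tr (A *m H ^+ a.*2 *m A *m H ^+ (M - a).*2).
have amgm a b : (a <= M)%N -> (b <= M)%N ->
    2 * \tr (A *m H ^+ (a + b) *m A *m H ^+ (M.*2 - (a + b))) <= g a + g b.
  move=> aM bM.
  have := mx_inner_amgm (H ^+ a *m A *m H ^+ (M - a)) (H ^+ b *m A *m H ^+ (M - b)).
  rewrite !mx_inner_sandwich// !addnn.
  by have -> : (M - b + (M - a) = M.*2 - (a + b))%N by rewrite -addnn; lia.
have g0 : g 0%N = \tr (A *m A *m H ^+ M.*2).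
  by rewrite /g double0 expr0mx subn0 mulmx1.
have gM : g M = g 0%N.
  rewrite g0 /g subnn double0 expr0mx mulmx1 -[in RHS]mulmxA.
  by rewrite [in RHS]mxtrace_mulC.
have gle a : (a <= M)%N -> g a <= g 0%N.
  move=> aM; have := @convex_seq_le g M _ a aM; rewrite gM maxxx; apply.
  move=> {aM}a /andP[a0 aM].
  have := amgm a.-1 a.+1 (leq_trans (leq_pred _) (ltnW aM)) aM.
  have -> : (a.-1 + a.+1 = a.*2)%N by rewrite -addnn; lia.
  by rewrite -doubleB.
rewrite -g0; have := odd_double_half q; case: (odd q) => /= qE; last first.
  have aM : (q./2 <= M)%N by rewrite -leq_double; lia.
  have := gle _ aM; rewrite /g doubleB.
  by rewrite (_ : q./2.*2 = q)// -[RHS]qE.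
have aM : (q./2.+1 <= M)%N by rewrite -leq_double -addnn; move: qM; rewrite -addnn; lia.
have := amgm _ _ (ltnW aM) aM.
have -> : (q./2 + q./2.+1 = q)%N by rewrite -addnn in qE; lia.
have := gle _ aM; have := gle _ (ltnW aM); lra.
Qed.

End trace_inequality.

(** * Lebesgue measure on matrices and Gibbs measures *)

Section coordinate_boxes.
Context (R : realType) (d : measure_display) (X : measurableType d) (N : nat).
Variable c : 'I_N -> X -> R.
Hypothesis measurable_coords : @measurable _ X = g_sigma_preimage c.

Definition box (D : 'I_N -> set R) : set X := [set x | forall k, D k (c k x)].

Definition cube (r : R) : set X := box (fun=> `[- r, r]%classic).

Lemma measurable_fun_coord k : measurable_fun setT (c k).
Proof.
move=> _ Y mY; rewrite setTI measurable_coords; apply: sub_sigma_algebra => /=.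
rewrite -bigcup_seq/=; exists k => /=; first by rewrite mem_index_enum.
by exists Y => //; rewrite setTI.
Qed.

Lemma measurable_fun_coords d' (T : measurableType d') (f : T -> X) :
  (forall k, measurable_fun setT (fun t => c k (f t))) ->
  measurable_fun setT f.
Proof.
move=> mf _ Y; rewrite setTI.
suff : measurable `<=` [set Y | measurable (f @^-1` Y)] by apply.
rewrite measurable_coords; apply: smallest_sub.
  split => [|A|F] /=; first by rewrite preimage_set0.
    by rewrite setTD preimage_setC; exact: measurableC.
  by move=> mF; rewrite preimage_bigcup; apply: bigcup_measurable => k _.
rewrite -bigcup_seq => A [k _ [B mB <-]] /=; rewrite setTI.
by have := mf k measurableT B mB; rewrite setTI.
Qed.

Lemma measurable_box D : (forall k, measurable (D k)) -> measurable (box D).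
Proof.
move=> mD; rewrite (_ : box D = \big[setI/setT]_(k < N) (c k @^-1` D k)).
  apply: bigsetI_measurable => k _; rewrite -[X in measurable X]setTI.
  exact: measurable_fun_coord.
rewrite -bigcap_seq; apply/seteqP; split => x /= h k.
  by move=> _; exact: h.
by apply: (h k); rewrite /= mem_index_enum.
Qed.

(** Boxes form a pi-system generating the sigma-algebra, and cubes exhaust the space with finite
    mass. The coordinates are abstract so that the lemma serves both for matrices (scaling of
    Lebesgue measure) and for tuples (the law of the noise). *)
Lemma box_measure_unique (m1 m2 : {measure set X -> \bar R}) :
  (forall D, (forall k, measurable (D k)) -> m1 (box D) = m2 (box D)) ->
  (forall r : R, m1 (cube r) < +oo)%E ->
  forall A, measurable A -> m1 A = m2 A.
Proof.
move=> m12 fin A mA.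
pose G : set (set X) :=
  [set A | exists D, (forall k, measurable (D k)) /\ A = box D].
have GI : setI_closed G.
  move=> _ _ [D [mD ->]] [E [mE ->]].
  exists (fun k => D k `&` E k); split.
    by move=> k; exact: measurableI.
  apply/seteqP; split => x /=.
    by move=> [xD xE] k; split.
  by move=> h; split => k; have [] := h k.
have box1 k (B : set R) : c k @^-1` B =
    box (fun l => if l == k then B else setT).
  apply/seteqP; split => x /=.
    by move=> xB l; case: eqP => [->|].
  by move/(_ k); rewrite eqxx.
apply: (measure_unique G (fun n => cube n%:R)) => //.
- rewrite measurable_coords; apply/seteqP; split.
    apply: smallest_sub; first exact: smallest_sigma_algebra.
    rewrite -bigcup_seq => B [k _ [Y mY <-]]; apply: sub_sigma_algebra.
    rewrite setTI box1; eexists; split; last by reflexivity.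
    by move=> l /=; case: eqP.
  apply: smallest_sub; first exact: smallest_sigma_algebra.
  by move=> _ [D [mD ->]]; rewrite -measurable_coords; exact: measurable_box.
- by move=> n; eexists; split; last reflexivity; move=> k /=.
- rewrite predeqE => x; split => // _.
  pose r := \sum_k `|c k x|.
  exists (Num.truncn r).+1 => //; rewrite /cube /box /= => k.
  rewrite in_itv /= -ler_norml.
  have cr : `|c k x| <= r.
    by rewrite /r (bigD1 k)//= lerDl sumr_ge0.
  by apply: (le_trans cr); exact/ltW/real_truncnS_gt/num_real.
- by move=> _ [D [mD ->]]; exact: m12.
Qed.

End coordinate_boxes.

(** * Scaling of Lebesgue measure *)

Section dilation.
Variable R : realType.

Lemma lebesgue_measure_dilation (s b : R) (D : set R) : 0 < s -> measurable D ->
  lebesgue_measure ((fun x => s * x + b) @^-1` D) =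
  (s^-1%:E * lebesgue_measure D)%E.
Proof.
move=> s0 mD; pose psi (x : measurableTypeR R) : measurableTypeR R := s * x + b.
have mpsi : measurable_fun setT psi.
  by apply: measurable_funD => //; exact: measurable_funM.
pose nu : {measure set _ -> \bar R} := mscale (NngNum (ltW s0))
  (measure_function_pushforward__canonical__measure_function_Measure
     (@lebesgue_measure R) mpsi).
suff -> : lebesgue_measure D = nu D.
  by rewrite /nu /= /mscale /= muleA -EFinM mulVf ?gt_eqF// mul1e.
apply: lebesgue_measure_unique => // _ [[x y] _ <-].
rewrite /nu /= /mscale /= /pushforward.
have -> : psi @^-1` `]x, y]%classic = `](x - b) / s, (y - b) / s]%classic.
  apply/seteqP; split => z /=; rewrite !in_itv /=.
    by rewrite ltr_pdivrMr// ler_pdivlMr// ltrBlDr lerBrDr mulrC.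
  by rewrite ltr_pdivrMr// ler_pdivlMr// ltrBlDr lerBrDr mulrC.
rewrite !lebesgue_measure_itv /= !lte_fin ltr_pM2r ?invr_gt0// ltrD2r.
case: ifP => _; last by rewrite mule0.
by rewrite -!EFinB -EFinM; congr EFin; field; rewrite gt_eqF.
Qed.

Variables m n : nat.
Notation leb := (@lebesgue_mx R m n).

Lemma measurable_mx_coords_gen :
  @measurable _ 'M[R]_(m, n) = g_sigma_preimage (@mx_coords _ R m n).
Proof. by []. Qed.

Lemma mx_coordsE k : exists ij : 'I_m * 'I_n,
  forall A : 'M[R]_(m, n), mx_coords k A = A ij.1 ij.2.
Proof.
by case/mxvec_indexP: k => i j; exists (i, j) => A; rewrite /mx_coords mxvecE.
Qed.

Lemma measurable_mx_entry i j :
  measurable_fun setT (fun A : 'M[R]_(m, n) => A i j).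
Proof.
rewrite (_ : (fun _ => _) = mx_coords (mxvec_index i j)).
  exact: measurable_mx_coords.
by apply/funext => A; rewrite /mx_coords mxvecE.
Qed.

Lemma measurable_fun_mx d (T : measurableType d) (f : T -> 'M[R]_(m, n)) :
  (forall i j, measurable_fun setT (fun t => f t i j)) -> measurable_fun setT f.
Proof.
move=> mf; apply: (measurable_fun_coords measurable_mx_coords_gen) => k.
have [ij ijE] := mx_coordsE k.
by under eq_fun do rewrite ijE; exact: mf.
Qed.

Lemma lebesgue_mx_cube (r : R) : (leb (cube (@mx_coords _ R m n) r) < +oo)%E.
Proof.
rewrite /cube /box (lebesgue_mx_box (D := fun=> `[- r, r]%classic)); last first.
  by move=> k; exact: measurable_itv.
elim: (m * n)%N => [|k IH]; first by rewrite big_ord0 ltry.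
rewrite big_ord_recl lte_mul_pinfty// ?ge0_fin_numE//.
by rewrite lebesgue_measure_itv; case: ifP => _; rewrite ?ltry// -EFinB ltry.
Qed.

Lemma measurable_affine_mx (s : R) (B : 'M[R]_(m, n)) :
  measurable_fun setT (fun A : 'M[R]_(m, n) => s *: A + B).
Proof.
apply: measurable_fun_mx => i j; under eq_fun do rewrite !mxE.
apply: measurable_funD => //; apply: measurable_funM => //.
exact: measurable_mx_entry.
Qed.

(** Lebesgue measure and s^(mn) times its image under A |-> s A + B agree on boxes, since each side
    of a box contributes one factor 1/s. *)
Lemma ge0_integral_dilation (s : R) (B : 'M[R]_(m, n)) (f : 'M[R]_(m, n) -> \bar R) :
  0 < s -> measurable_fun setT f -> (forall A, 0 <= f A)%E ->
  (\int[leb]_A f A = (s ^+ (m * n))%:E * \int[leb]_A f (s *: A + B)%R)%E.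
Proof.
move=> s0 mf f0; pose psi A := s *: A + B.
have mpsi : measurable_fun setT psi by exact: measurable_affine_mx.
have sp0 : 0 <= s ^+ (m * n) by rewrite exprn_ge0// ltW.
pose push : {measure set _ -> \bar R} :=
  measure_function_pushforward__canonical__measure_function_Measure leb mpsi.
pose nu : {measure set _ -> \bar R} := mscale (NngNum sp0) push.
have e A : measurable A -> leb A = nu A.
  apply: (box_measure_unique measurable_mx_coords_gen); last first.
    by move=> r; exact: lebesgue_mx_cube.
  move=> D mD; rewrite /nu /= /mscale /= /pushforward.
  pose D' k := (fun x => s * x + mx_coords k B) @^-1` D k.
  have -> : psi @^-1` box (@mx_coords _ R m n) D = box (@mx_coords _ R m n) D'.
    apply/seteqP; split => x /= h k; have := h k; rewrite /D' /= /psi;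
      have [ij ijE] := mx_coordsE k; by rewrite !ijE !mxE.
  have mD' k : measurable (D' k).
    rewrite /D' -[X in measurable X]setTI.
    apply: (_ : measurable_fun setT _) => //.
    by apply: measurable_funD => //; exact: measurable_funM.
  rewrite /box !lebesgue_mx_box// /D'.
  under [in RHS]eq_bigr do rewrite lebesgue_measure_dilation//.
  have -> : (\prod_(k < m * n) (s^-1%:E * lebesgue_measure (D k)) =
      (s^-1 ^+ (m * n))%:E * \prod_(k < m * n) lebesgue_measure (D k))%E.
    rewrite big_split /=; congr (_ * _)%E.
    by rewrite prodEFin prodr_const card_ord.
  by rewrite muleA -EFinM exprVn mulfV ?mul1e// expf_neq0// gt_eqF.
rewrite (eq_measure_integral nu); last by move=> A mA _; exact: e.
rewrite ge0_integral_mscale//; congr (_ * _)%E.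
by rewrite ge0_integral_pushforward// preimage_setT.
Qed.

End dilation.

(** * Positivity, finiteness and concentration of Gibbs integrals *)

Section gibbs.
Variables (R : realType) (m n : nat).
Notation leb := (@lebesgue_mx R m n).
Implicit Types (V N : 'M[R]_(m, n) -> R).

(** The density vanishes nowhere, so a zero integral would make the whole space, hence the cube
    [-1, 1]^(mn), negligible. *)
Lemma gibbs_gt0 V : measurable_fun setT V ->
  (0 < \int[leb]_A (expR (- V A))%:E)%E.
Proof.
move=> mV; rewrite lt0e integral_ge0 ?andbT; last by move=> A _; rewrite lee_fin expR_ge0.
apply/eqP => I0.
have mf : measurable_fun setT (fun A => (expR (- V A))%:E).
  apply/measurable_EFinP/measurableT_comp => //.
  exact: measurable_funN.
have := (ae_eq_integral_abs leb measurableT mf).1.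
under eq_integral do rewrite gee0_abs ?lee_fin ?expR_ge0//.
move=> /(_ I0) [E [mE E0 sub]].
have : leb (cube (@mx_coords _ R m n) 1) = 0%E.
  apply: (subset_measure0 _ mE) => //; last first.
    move=> A _; apply: sub => /= h.
    by have /eqP := h I; rewrite eqe gt_eqF ?expR_gt0.
  by apply: measurable_box => // k; exact: measurable_itv.
rewrite /cube /box (lebesgue_mx_box (D := fun=> `[- 1, 1]%classic)); last first.
  by move=> k; exact: measurable_itv.
rewrite lebesgue_measure_itv /= lte_fin.
have -> : (-1 < 1 :> R) by lra.
rewrite -EFinB prodEFin prodr_const => -[] /eqP.
by rewrite expf_eq0 => /andP[_ /eqP]; lra.
Qed.

(* Change of variables [A |-> (1 - a) A + a B] in the normalizing integral. *)
Lemma gibbs_chernoff V (B : 'M[R]_(m, n)) (bad : set 'M[R]_(m, n)) (a g : R) :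
  a < 1 -> measurable_fun setT V -> measurable bad ->
  (forall A, bad A -> V ((1 - a) *: A + a *: B) <= V A - g) ->
  (((1 - a) ^+ (m * n) * expR g)%:E * \int[leb]_(A in bad) (expR (- V A))%:E <=
   \int[leb]_A (expR (- V A))%:E)%E.
Proof.
move=> a1 mV mbad Vbad.
have mf : measurable_fun setT (fun A => (expR (- V A))%:E).
  by apply/measurable_EFinP/measurableT_comp => //; exact: measurable_funN.
have a1' : 0 < 1 - a by rewrite subr_gt0.
rewrite [leRHS](ge0_integral_dilation (a *: B) a1')//.
rewrite EFinM -muleA lee_pmul2l ?lte_fin ?exprn_gt0//.
pose psi (A : 'M[R]_(m, n)) := (1 - a) *: A + a *: B.
have mpsi : measurable_fun setT psi by exact: measurable_affine_mx.
have mfp : measurable_fun setT (fun A => (expR (- V (psi A)))%:E).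
  exact: (measurableT_comp mf mpsi).
apply: (@le_trans _ _ (\int[leb]_(A in bad) (expR (- V (psi A)))%:E)%E).
  rewrite -ge0_integralZl//; last exact: measurable_funTS.
  apply: ge0_le_integral => //.
  - by apply: measurable_funTS; exact: emeasurable_funM.
  - exact: measurable_funTS.
  move=> A /Vbad h; rewrite -EFinM lee_fin -expRD ler_expR; lra.
exact: ge0_subset_integral.
Qed.

(* A dilation by 2 shows that the integral [I r] over [{N <= r}] satisfies
   [I (2 r) <= C + I r / 2], whence a bound uniform in [r]. *)
Lemma gibbs_lty N (c : R) : 0 < c -> measurable_fun setT N ->
  (forall (A : 'M[R]_(m, n)) i j, `|A i j| <= N A) -> (forall A, 0 <= N A) ->
  (forall A, N (2 *: A) = 2 * N A) ->
  (\int[leb]_A (expR (- (c * N A)))%:E < +oo)%E.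
Proof.
move=> c0 mN Nge N0 N2.
pose L r : set 'M[R]_(m, n) := [set A | N A <= r].
have indL r A : \1_(L r) A = (N A <= r)%R%:R :> R.
  by rewrite indicE; congr (nat_of_bool _)%:R; apply/idP/idP; rewrite inE.
have mL r : measurable (L r).
  rewrite (_ : L r = setT `&` N @^-1` `]-oo, r]%classic); last first.
    by rewrite setTI; apply/seteqP; split => A; rewrite /= in_itv.
  by apply: mN => //; exact: measurable_itv.
pose w (k r : R) A : \bar R := (\1_(L r) A * expR (- (k * N A)))%:E.
have mw k r : measurable_fun setT (w k r).
  apply/measurable_EFinP/measurable_funM; first exact: measurable_indic.
  by apply: measurableT_comp => //; apply: measurable_funN; exact: measurable_funM.
have w0 k r A : (0 <= w k r A)%E by rewrite lee_fin mulr_ge0// expR_ge0.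
pose I r := (\int[leb]_A w c r A)%E.
have I0 r : (0 <= I r)%E by apply: integral_ge0.
have lebL r : (leb (L r) < +oo)%E.
  apply: le_lt_trans (lebesgue_mx_cube m n r); apply: le_measure; rewrite ?inE//.
    by apply: measurable_box => // k; exact: measurable_itv.
  move=> A /= LA; rewrite /cube /box /= => k; rewrite in_itv /= -ler_norml.
  by have [ij ->] := mx_coordsE R k; exact: le_trans (Nge _ _ _) LA.
have wle k r A : 0 <= k -> (w k r A <= (\1_(L r) A)%:E)%E.
  move=> k0; rewrite lee_fin ler_piMr//.
  by rewrite -expR0 ler_expR oppr_le0 mulr_ge0.
have mind r : measurable_fun setT (fun A => (\1_(L r) A : R)%:E).
  by apply/measurable_EFinP; exact: measurable_indic.
have lebE r : leb (L r) = (\int[leb]_A (\1_(L r) A : R)%:E)%E.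
  by rewrite integral_indic// setIT.
have Ifin r : (I r < +oo)%E.
  apply: le_lt_trans (lebL r); rewrite lebE.
  by apply: ge0_le_integral => // A _; apply/wle/ltW.
pose p := (m * n)%N.
(* Beyond level r0, the dilated integrand 2^p exp(- 2 c N) is at most exp(- c N) / 2; below it, 2^p
   is a crude bound. *)
have [r0 r0P] : exists r0 : R, 2 ^+ p * expR (- (c * r0)) <= 2^-1.
  exists (ln (2 ^+ p.+1) / c).
  rewrite mulrCA mulfV ?gt_eqF// mulr1 expRN lnK; last first.
    by rewrite posrE exprn_gt0.
  by rewrite exprS invfM mulrCA mulfV ?mulr1// expf_neq0.
pose C := ((2 ^+ p)%:E * leb (L r0))%E.
have Cfin : (C < +oo)%E by rewrite /C lte_mul_pinfty// ?lee_fin ?exprn_ge0.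
have I2 r : (I (2 * r)%R <= C + 2^-1%:E * I r)%E.
  rewrite /I (ge0_integral_dilation 0 (ltr0Sn R 1))//.
  rewrite -ge0_integralZl//; last first.
    exact: (measurableT_comp (mw c (2 * r)) (@measurable_affine_mx _ _ _ 2 0)).
  have mC : measurable_fun setT (fun A => ((2 ^+ p)%:E * (\1_(L r0) A : R)%:E)%E).
    exact: measurable_funeM.
  have mI : measurable_fun setT (fun A => (2^-1%:E * w c r A)%E).
    exact: measurable_funeM.
  rewrite /C lebE -!ge0_integralZl// -ge0_integralD//; last first.
    by move=> A _; rewrite mule_ge0// lee_fin.
  apply: ge0_le_integral => //.
  - by move=> A _; rewrite mule_ge0// lee_fin exprn_ge0.
  - apply: measurable_funeM => //.
    exact: (measurableT_comp (mw c (2 * r)) (@measurable_affine_mx _ _ _ 2 0)).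
  - exact: emeasurable_funD.
  move=> A _; rewrite /w -!EFinM -EFinD lee_fin addr0 !indL N2.
  rewrite ler_pM2l ?ltr0n//; case: (leP (N A) r) => [_|_]; last first.
    by rewrite !mul0r !mulr0 addr0 mulr_ge0.
  rewrite !mul1r; case: (leP (N A) r0) => [_|Nr0].
    rewrite mulr1 -[leLHS]addr0 lerD ?mulr_ge0 ?expR_ge0//.
    by rewrite ler_piMr ?exprn_ge0// -expR0 ler_expR oppr_le0 !mulr_ge0// ltW.
  rewrite mulr0 add0r mulrCA [2 * _]mulr_natl mulr2n opprD expRD mulrA.
  rewrite ler_wpM2r ?expR_ge0//; apply: le_trans r0P.
  by rewrite ler_wpM2l ?exprn_ge0// ler_expR lerN2 ler_pM2l// ltW.
(* [I r <= I (2 r)], and [I r] is finite, so the half can be absorbed on the left. *)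
have Ib r : 0 <= r -> (I r <= 2%:E * C)%E.
  move=> r_ge0; have : (I r <= C + 2^-1%:E * I r)%E.
    apply: le_trans (I2 r); apply: ge0_le_integral => // A _.
    rewrite lee_fin ler_wpM2r ?expR_ge0// !indL ler_nat.
    by case: (leP (N A) r) => // h; rewrite (le_trans h)// ler_peMl// ler1n.
  have C0 : (0 <= C)%E by rewrite /C mule_ge0// lee_fin exprn_ge0.
  have /fineK <- : I r \is a fin_num by rewrite ge0_fin_numE.
  have /fineK <- : C \is a fin_num by rewrite ge0_fin_numE.
  by rewrite -!EFinM -EFinD !lee_fin; lra.
have IE r : I r = (\int[leb]_(A in L r) (expR (- (c * N A)))%:E)%E.
  rewrite integral_mkcond; apply: eq_integral => A _.
  rewrite /w /patch indicE; case: ifP => _; first by rewrite mul1r.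
  by rewrite mul0r.
have LT : \bigcup_k L k%:R = setT.
  rewrite predeqE => A; split => // _; exists (Num.truncn (N A)).+1 => //.
  by rewrite /L /=; exact/ltW/real_truncnS_gt/num_real.
rewrite -LT; apply: (@le_lt_trans _ _ (2%:E * C)%E); last first.
  by rewrite lte_mul_pinfty// lee_fin.
have mE : measurable_fun setT (fun A => (expR (- (c * N A)))%:E).
  by apply/measurable_EFinP/measurableT_comp => //; apply: measurable_funN;
    exact: measurable_funM.
have cv : (\int[leb]_(A in L k%:R) (expR (- (c * N A)))%:E)%E @[k --> \oo] -->
    (\int[leb]_(A in \bigcup_k L k%:R) (expR (- (c * N A)))%:E)%E.
  apply: (ge0_nondecreasing_set_cvg_integral (F := fun k => L k%:R)) => //.
  - move=> j k jk; apply/subsetPset => A; rewrite /L /= => /le_trans; apply.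
    by rewrite ler_nat.
  - by move=> k; exact: measurable_funTS.
rewrite -(cvg_lim _ cv)//; apply: lime_le.
  by apply/cvg_ex; eexists; exact: cv.
by apply: nearW => k; rewrite -IE; exact: Ib.
Qed.

End gibbs.

(** * Moments of Gaussian vectors *)

Section density.
Import HBNNSimple.
Context d (T : measurableType d) (R : realType).
Variables (mu nu : {measure set T -> \bar R}) (g : T -> R).
Hypotheses (mg : measurable_fun setT g) (g0 : forall x, 0 <= g x).
Hypothesis nuE : forall A, measurable A -> nu A = (\int[mu]_(x in A) (g x)%:E)%E.

(** The identity holds on the level sets of simple functions by [nuE], and monotone convergence
    carries it over on both sides. *)
Lemma ge0_integral_density (f : T -> \bar R) : measurable_fun setT f ->
  (forall x, 0 <= f x)%E ->
  (\int[nu]_x f x = \int[mu]_x (f x * (g x)%:E))%E.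
Proof.
move=> mf f0; pose h := nnsfun_approx measurableT mf.
have mh n : measurable_fun setT (fun x => (h n x)%:E).
  exact/measurable_EFinP.
have mhg n : measurable_fun setT (fun x => ((h n x)%:E * (g x)%:E)%E).
  by apply: emeasurable_funM => //; exact/measurable_EFinP.
have hcvg x : (h n x)%:E @[n --> \oo] --> f x by exact: cvg_nnsfun_approx.
have nu_lim : (\int[nu]_x (h n x)%:E)%E @[n --> \oo] --> (\int[nu]_x f x)%E.
  have -> : (\int[nu]_x f x = \int[nu]_x limn (fun n => (h n x)%:E))%E.
    by apply: eq_integral => x _; apply/esym/cvg_lim.
  apply: cvg_monotone_convergence => //.
    by move=> n x _; rewrite lee_fin.
  by move=> x _ a b ab; rewrite lee_fin; exact/lefP/nd_nnsfun_approx.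
have mu_lim : (\int[mu]_x ((h n x)%:E * (g x)%:E))%E @[n --> \oo] -->
    (\int[mu]_x (f x * (g x)%:E))%E.
  have -> : (\int[mu]_x (f x * (g x)%:E) =
      \int[mu]_x limn (fun n => (h n x)%:E * (g x)%:E))%E.
    apply: eq_integral => x _; apply/esym/cvg_lim => //.
    exact: cvgeZr.
  apply: cvg_monotone_convergence => //.
    by move=> n x _; rewrite mule_ge0// lee_fin.
  move=> x _ a b ab; rewrite lee_wpmul2r// ?lee_fin//.
  exact/lefP/nd_nnsfun_approx.
suff e n : (\int[nu]_x (h n x)%:E = \int[mu]_x ((h n x)%:E * (g x)%:E))%E.
  apply: (cvg_unique _ nu_lim) => //.
  by rewrite (_ : (fun n => _) = fun n => (\int[mu]_x ((h n x)%:E * (g x)%:E))%E)//;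
    apply/funext => n; exact: e.
have mind r : measurable (h n @^-1` [set r]).
  by rewrite -[X in measurable X]setTI; exact: measurable_funP.
transitivity (\sum_(r \in range (h n)) (r%:E * nu (h n @^-1` [set r])))%E.
  by rewrite integralT_nnsfun sintegralE.
have mindg r : measurable_fun setT
    (fun x => ((\1_(h n @^-1` [set r]) x : R)%:E * (g x)%:E)%E).
  apply: emeasurable_funM; first exact/measurable_EFinP/measurable_indic.
  exact/measurable_EFinP.
have hE x : ((h n x)%:E * (g x)%:E =
    \sum_(r \in range (h n)) (r%:E * ((\1_(h n @^-1` [set r]) x)%:E * (g x)%:E)))%E.
  rewrite fimfunE -fsumEFin// ge0_mule_fsuml; last first.
    by move=> r; exact: nnfun_muleindic_ge0.
  by apply: eq_fsbigr => r _; rewrite EFinM muleA.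
under [RHS]eq_integral do rewrite hE.
rewrite ge0_integral_fsum//.
- apply: eq_fsbigr => r; rewrite inE => -[x _ hx].
  rewrite ge0_integralZl//; last by rewrite -hx lee_fin.
  congr (_ * _)%E; rewrite nuE// integral_mkcond; apply: eq_integral => y _.
  rewrite patchE indicE; case: ifP => _; first by rewrite mul1e.
  by rewrite mul0e.
- by move=> x0 _; rewrite mule_ge0// lee_fin.
- by move=> r; exact: measurable_funeM.
- move=> r x _; rewrite -!EFinM lee_fin mulrA mulr_ge0//.
  by have := nnfun_muleindic_ge0 (h n) r x; rewrite lee_fin.
Qed.

Lemma integral_density (f : T -> R) : measurable_fun setT f ->
  (\int[nu]_x (f x)%:E = \int[mu]_x (f x * g x)%:E)%E.
Proof.
move=> mf; have mF : measurable_fun setT (fun x => (f x)%:E) by exact/measurable_EFinP.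
rewrite [LHS]integralE [RHS]integralE.
have mp := measurable_funepos mF; have mn := measurable_funeneg mF.
rewrite !ge0_integral_density//; congr (_ - _)%E; apply: eq_integral => x _.
  rewrite !funeposE EFinM; have [fx|fx] := leP 0 (f x).
    by rewrite !max_l ?mule_ge0 ?lee_fin.
  rewrite !max_r ?mul0e// -?EFinM lee_fin; [by rewrite nmulr_rle0|exact: ltW].
rewrite !funenegE -!EFinN; have [fx|fx] := leP 0 (f x).
  by rewrite !max_r ?mul0e// lee_fin oppr_le0// mulr_ge0.
rewrite !max_l -?EFinM ?mulNr// lee_fin oppr_ge0; last exact: ltW.
by rewrite nmulr_rle0.
Qed.

Lemma integrable_density (f : T -> R) : measurable_fun setT f ->
  mu.-integrable setT (fun x => (f x * g x)%:E) ->
  nu.-integrable setT (fun x => (f x)%:E).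
Proof.
move=> mf /integrableP[_ h]; apply/integrableP; split.
  exact/measurable_EFinP.
rewrite (ge0_integral_density (f := fun x => `|(f x)%:E|%E))//; last first.
  by apply: measurableT_comp => //; exact/measurable_EFinP.
apply: le_lt_trans h; rewrite le_eqVlt; apply/orP; left; apply/eqP.
by apply: eq_integral => x _; rewrite /= -EFinM normrM (ger0_norm (g0 x)).
Qed.

End density.

(** * Moments of the centred normal law *)

Section normal_moments.
Variables (R : realType) (s : R).
Hypothesis s0 : 0 < s.
Notation mu := (@lebesgue_measure R).
Notation phi := (normal_pdf 0 s).

Lemma normal_pdf_expE x : phi x = normal_peak s * expR (- (x ^+ 2 / (2 * s ^+ 2))).
Proof.
by rewrite normal_pdfE ?gt_eqF// /normal_fun subr0 mulNr mulr_natl.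
Qed.

Lemma expR_exprn_le k (y : R) : 0 <= y -> y ^+ k <= k%:R ^+ k * expR y.
Proof.
case: k => [|k] y0; first by rewrite !expr0 mul1r -expR0 ler_expR.
have k0 : (0 : R) < k.+1%:R by rewrite ltr0n.
have : y / k.+1%:R <= expR (y / k.+1%:R).
  by apply: le_trans (expR_ge1Dx _); rewrite lerDr.
rewrite ler_pdivrMr// => h.
have := lerXn2r k.+1 y0 (mulr_ge0 (expR_ge0 _) (ltW k0)) h.
by rewrite exprMn -expRM_natl mulrCA mulfV ?gt_eqF// mulr1 mulrC.
Qed.

(** Half of the Gaussian exponent absorbs the power: |x|^k <= k^k exp |x|, and completing the square
    bounds |x| - x^2 / (2 s^2) by s^2 - x^2 / (4 s^2). The normal density of variance 2 s^2 is then
    an explicit majorant, both for integrability and for decay at infinity. *)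
Lemma normal_decay k : exists2 C : R, 0 <= C & forall x,
  `|x ^+ k * phi x| <= C * normal_pdf 0 (Num.sqrt 2 * s) x.
Proof.
have s2 : 0 < Num.sqrt 2 * s by rewrite mulr_gt0// sqrtr_gt0.
have p0 := normal_peak_gt0 (negbT (gt_eqF s0)).
have q0 := normal_peak_gt0 (negbT (gt_eqF s2)).
exists (normal_peak s * (k%:R ^+ k * expR (s ^+ 2)) / normal_peak (Num.sqrt 2 * s)).
  by rewrite !mulr_ge0// ?invr_ge0 ?exprn_ge0 ?expR_ge0// ltW.
move=> x; rewrite normal_pdf_expE normal_pdfE ?gt_eqF// /normal_fun subr0.
rewrite normrM normrX (ger0_norm (mulr_ge0 (ltW p0) (expR_ge0 _))).
rewrite -[leRHS]mulrA (mulKf (negbT (gt_eqF q0))) mulrCA -[leRHS]mulrA ler_pM2l//.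
apply: (@le_trans _ _ (k%:R ^+ k * expR `|x| * expR (- (x ^+ 2 / (2 * s ^+ 2))))).
  by rewrite ler_wpM2r ?expR_ge0// expR_exprn_le.
rewrite -[leLHS]mulrA -[leRHS]mulrA ler_wpM2l ?exprn_ge0// -!expRD ler_expR.
rewrite exprMn sqr_sqrtr// mulNr.
have -> : x ^+ 2 = `|x| ^+ 2 by rewrite real_normK ?num_real.
set y := `|x|.
have -> : s ^+ 2 - y ^+ 2 / (2 * s ^+ 2 *+ 2) =
  y - y ^+ 2 / (2 * s ^+ 2) + (y / (2 * s) - s) ^+ 2.
  by field; rewrite gt_eqF.
by rewrite lerDl sqr_ge0.
Qed.

Lemma measurable_exprn_pdf k : measurable_fun setT (fun x : R => x ^+ k * phi x).
Proof.
apply: measurable_funM; last exact: measurable_normal_pdf.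
exact: measurable_funX.
Qed.

Lemma integrable_exprn_pdf k :
  mu.-integrable setT (fun x : R => (x ^+ k * phi x)%:E).
Proof.
have [C C0 h] := normal_decay k.
apply: (@le_integrable _ _ _ mu setT _ _
    (fun x => C%:E * (normal_pdf 0 (Num.sqrt 2 * s) x)%:E)%E) => //.
- by apply/measurable_EFinP; exact: measurable_exprn_pdf.
- move=> x _; rewrite -EFinM !abse_EFin lee_fin.
  rewrite (ger0_norm (mulr_ge0 C0 _)) ?h//; exact: normal_pdf_ge0.
- by apply: integrableZl => //; exact: integrable_normal_pdf.
Qed.

(** For k = 0 the exponent [k.-1] is 0 rather than -1, but the factor [k%:R] removes that term. *)
Lemma is_derive_exprn_pdf k (x : R) :
  is_derive x 1 (fun x : R => x ^+ k * phi x)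
    (k%:R * (x ^+ k.-1 * phi x) - s ^- 2 * (x ^+ k.+1 * phi x)).
Proof.
pose p : {poly R} := (- (2 * s ^+ 2)^-1) *: 'X^2.
have pE z : p.[z] = - (z ^+ 2 / (2 * s ^+ 2)).
  by rewrite hornerZ hornerXn mulNr mulrC.
have dp : p^`().[x] = - (s ^- 2 * x).
  rewrite derivZ derivXn hornerZ hornerMn hornerXn /= expr1 mulr2n.
  by field; rewrite gt_eqF.
have e : (fun x : R => x ^+ k * phi x) =
    (fun x => normal_peak s * ('X^k.[x] * (expR \o horner p) x)).
  by apply/funext => z; rewrite normal_pdf_expE /= pE hornerXn mulrCA.
rewrite e !normal_pdf_expE -pE.
have dk : is_derive x 1 (horner ('X^k : {poly R})) ('X^k : {poly R})^`().[x].
  exact: is_derive_poly.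
have de : is_derive x 1 (expR \o horner p) (expR p.[x] * p^`().[x]).
  exact: is_derive1_comp.
refine (is_derive_eq (is_deriveZ (normal_peak s) (is_deriveM dk de)) _).
rewrite dp derivXn hornerMn !hornerXn /GRing.scale /=.
rewrite -[x ^+ k.-1 *+ k]mulr_natl (exprS x k).
by move: (expR _) (x ^+ k) (x ^+ k.-1) (s ^- 2) (normal_peak s) => *; ring.
Qed.

Lemma cvg_exprn_pdf (e : R) k : `|e| = 1 ->
  (e * n.+1%:R) ^+ k * phi (e * n.+1%:R) @[n --> \oo] --> (0 : R).
Proof.
move=> e1; have [C C0 h] := normal_decay k.
pose D := C * (normal_peak (Num.sqrt 2 * s) * (4 * s ^+ 2)).
have s2 : 0 < Num.sqrt 2 * s by rewrite mulr_gt0// sqrtr_gt0.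
have bound n : `|(e * n.+1%:R) ^+ k * phi (e * n.+1%:R)| <= D * harmonic n.
  have n1 : 1 <= n.+1%:R :> R by rewrite ler1n.
  apply: (le_trans (h _)); rewrite /D -mulrA ler_wpM2l//.
  rewrite normal_pdfE ?gt_eqF// -mulrA ler_wpM2l ?normal_peak_ge0//.
  rewrite /normal_fun subr0 exprMn -(real_normK (num_real e)) e1 expr1n mul1r.
  rewrite exprMn sqr_sqrtr// mulNr expRN /harmonic /=.
  have sn0 : 0 < s ^+ 2 by rewrite exprn_gt0.
  set z := _ ^+ 2 / _.
  have zE : n.+1%:R / (4 * s ^+ 2) <= z.
    have -> : z = n.+1%:R * (n.+1%:R / (4 * s ^+ 2)).
      by rewrite /z; field; rewrite gt_eqF.
    by rewrite ler_peMl// divr_ge0// mulr_ge0// ltW.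
  rewrite -[leRHS]invf_div lef_pV2 ?posrE ?expR_gt0// ?divr_gt0 ?mulr_gt0//.
  by apply: (le_trans zE); apply: le_trans (expR_ge1Dx z); rewrite lerDr.
apply/norm_cvg0P.
apply: (@squeeze_cvgr _ _ _ _ (cst 0) (fun n : nat => D * harmonic n)).
- by apply: nearW => n; rewrite /= normr_ge0 bound.
- exact: cvg_cst.
- by rewrite -[0](mulr0 D); apply: cvgMr; exact: cvg_harmonic.
Qed.

(** Integration by parts on the line: the derivative of x^k phi is integrated over [-(n+1), n+1],
    the boundary terms vanish by decay, and dominated convergence gives a zero total integral. *)
Lemma integral_exprn_pdf k :
  (\int[mu]_x (x ^+ k.+1 * phi x)%:E =
   (s ^+ 2 * k%:R)%:E * \int[mu]_x (x ^+ k.-1 * phi x)%:E)%E.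
Proof.
pose f (x : R) := k%:R * (x ^+ k.-1 * phi x) - s ^- 2 * (x ^+ k.+1 * phi x).
pose F (x : R) := x ^+ k * phi x.
have fi : mu.-integrable setT (fun x => (f x)%:E).
  rewrite /f; under eq_fun do rewrite EFinB !EFinM.
  by apply: integrableB => //; apply: integrableZl => //;
    under eq_fun do rewrite -EFinM; exact: integrable_exprn_pdf.
have fE : (\int[mu]_x (f x)%:E = k%:R%:E * \int[mu]_x (x ^+ k.-1 * phi x)%:E -
    (s ^- 2)%:E * \int[mu]_x (x ^+ k.+1 * phi x)%:E)%E.
  rewrite -!integralZl//; try exact: integrable_exprn_pdf.
  rewrite -integralB//; last 2 first.
  - by apply: integrableZl => //; exact: integrable_exprn_pdf.
  - by apply: integrableZl => //; exact: integrable_exprn_pdf.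
pose itv n : set R := `[- n.+1%:R, n.+1%:R]%classic.
have dF (x : R) : is_derive x 1 F (f x) := is_derive_exprn_pdf k x.
have cF : continuous F.
  move=> x; apply/differentiable_continuous/derivable1_diffP.
  by have [] := dF x.
have cf : continuous f.
  have cM j : continuous (fun x : R => x ^+ j * phi x).
    move=> x; apply: cvgM; first exact: exprn_continuous.
    by apply: continuous_normal_pdf; rewrite gt_eqF.
  move=> x; apply: cvgB; (apply: cvgM; [exact: cvg_cst|exact: cM]).
have ftc n : (\int[mu]_(x in itv n) (f x)%:E =
    (F n.+1%:R)%:E - (F (- n.+1%:R)%R)%:E)%E.
  apply: continuous_FTC2.
  - by rewrite -subr_gt0 opprK addr_gt0// ltr0n.
  - exact: continuous_subspaceT.
  - split.
    + by move=> x _; have [] := dF x.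
    + exact/cvg_at_right_filter/cF.
    + exact/cvg_at_left_filter/cF.
  - by move=> x _; rewrite derive1E; have [_ <-] := dF x.
have lim0 : ((F n.+1%:R)%:E - (F (- n.+1%:R)%R)%:E)%E @[n --> \oo] --> (0%:E : \bar R).
  have h1 := cvg_exprn_pdf k (normr1 R).
  have h2 := cvg_exprn_pdf k (normrN1 R).
  rewrite -[0](subrr (0 : R)) EFinB.
  apply: cvgeB => //.
    by apply/cvg_EFin; [exact: nearW|]; under eq_fun do rewrite /= -[_.+1%:R]mul1r.
  by apply/cvg_EFin; [exact: nearW|]; under eq_fun do rewrite /= -mulN1r.
have limf : (\int[mu]_(x in itv n) (f x)%:E)%E @[n --> \oo] -->
    (\int[mu]_x (f x)%:E)%E.
  pose fn n x := (((fun x => (f x)%:E) \_ (itv n)) x)%E.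
  have mfE : measurable_fun setT (fun x => (f x)%:E) by exact: measurable_int fi.
  have -> : (fun n => \int[mu]_(x in itv n) (f x)%:E)%E =
      (fun n => \int[mu]_x fn n x)%E.
    by apply/funext => n; rewrite integral_mkcond.
  have [] := @dominated_convergence _ _ _ mu setT measurableT fn
    (fun x => (f x)%:E) (fun x => `|(f x)%:E|%E) => //.
  - move=> n; have mi : measurable (itv n) := measurable_itv _.
    by apply/(measurable_restrictT _ mi); exact: measurable_funTS.
  - apply: aeW => x _; apply: (@cvg_near_cst _ _ ((f x)%:E) _ \oo).
    exists (Num.truncn `|x|) => // n /= xn.
    have xi : itv n x.
      rewrite /itv /= in_itv /= -ler_norml.
      apply: (le_trans (ltW (real_truncnS_gt (num_real _)))).
      by rewrite ler_nat ltnS.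
    by rewrite /fn patchE mem_set.
  - exact: integrable_abse.
  - apply: aeW => x n _; rewrite /fn patchE; case: ifP => // _.
    by rewrite abse0.
have f0 : (\int[mu]_x (f x)%:E = 0)%E.
  apply: (cvg_unique _ limf) => //.
  have -> : (fun n => \int[mu]_(x in itv n) (f x)%:E)%E =
      (fun n => (F n.+1%:R)%:E - (F (- n.+1%:R)%R)%:E)%E.
    by apply/funext => n; rewrite ftc.
  exact: lim0.
have i1 := integrable_fin_num measurableT (integrable_exprn_pdf k.-1).
have i2 := integrable_fin_num measurableT (integrable_exprn_pdf k.+1).
move: f0; rewrite fE -(fineK i1) -(fineK i2) -!EFinM -EFinB => -[] /eqP.
rewrite subr_eq0 => /eqP e; congr EFin.
by rewrite -mulrA e mulrA mulfV ?mul1r// expf_neq0// gt_eqF.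
Qed.

Lemma integrable_normal_exprn k :
  (normal_prob 0 s).-integrable setT (fun x : R => (x ^+ k)%:E).
Proof.
apply: (integrable_density (mu := mu) (g := phi)) => //.
- exact: measurable_normal_pdf.
- by move=> x; exact: normal_pdf_ge0.
- exact: integrable_exprn_pdf.
Qed.

Definition normal_moment k : R := fine (\int[normal_prob 0 s]_x (x ^+ k)%:E)%E.

Lemma normal_momentE k :
  (\int[normal_prob 0 s]_x (x ^+ k)%:E = (normal_moment k)%:E)%E.
Proof.
rewrite fineK//; apply: integrable_fin_num => //.
exact: integrable_normal_exprn.
Qed.

Lemma normal_momentS k :
  normal_moment k.+1 = s ^+ 2 * k%:R * normal_moment k.-1.
Proof.
have dE j : (\int[normal_prob 0 s]_x (x ^+ j)%:E =
    \int[mu]_x (x ^+ j * phi x)%:E)%E.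
  apply: integral_density => //; first exact: measurable_normal_pdf.
  by move=> x; exact: normal_pdf_ge0.
apply: EFin_inj; rewrite -normal_momentE EFinM -normal_momentE !dE.
exact: integral_exprn_pdf.
Qed.

End normal_moments.

(** * A product model of the Gaussian vector *)

Section gaussian_vector.
Variables (R : realType) (s : R).
Hypothesis s0 : 0 < s.
Notation N := (normal_prob 0 s).

(** One coordinate is added at a time, and Fubini factors the moments of monomials. The masses of
    boxes are carried along because they identify this model with the law of any [xi] satisfying
    [isotropic_gaussian]. *)
Lemma gaussian_tuple n : exists mu : {sigma_finite_measure set (n.-tuple R) -> \bar R},
  (forall D : 'I_n -> set R, (forall i, measurable (D i)) ->
    mu [set t | forall i, D i (tnth t i)] = (\prod_(i < n) N (D i))%E) /\
  forall a : 'I_n -> nat,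
    mu.-integrable setT (fun t => (\prod_(i < n) tnth t i ^+ a i)%:E) /\
    (\int[mu]_t (\prod_(i < n) tnth t i ^+ a i)%:E =
      (\prod_(i < n) normal_moment s (a i))%:E)%E.
Proof.
elim: n => [|n [mu [muE mum]]].
  pose mu0 : {sigma_finite_measure set (0.-tuple R) -> \bar R} := dirac [tuple].
  exists mu0; split => [D mD|a].
    by rewrite big_ord0 /= diracE mem_set// => -[].
  have -> : (fun t : 0.-tuple R => (\prod_(i < 0) tnth t i ^+ a i)%:E) =
      EFin \o cst 1 by apply/funext => t; rewrite /= big_ord0.
  split.
    exact: (finite_measure_integrable_cst (dirac ([tuple] : 0.-tuple R)) 1).
  rewrite (_ : EFin \o cst 1 = cst 1%E)// integral_cst//.
  by rewrite mul1e big_ord0 /= diracE mem_set.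
have [p pE] := product_sigma_finiteP N mu.
pose cons (x : R * n.-tuple R) : n.+1.-tuple R := [the n.+1.-tuple R of x.1 :: x.2].
have mcons : measurable_fun setT cons by exact: measurable_cons.
have [nu nuE] : exists nu : {sigma_finite_measure set (n.+1.-tuple R) -> \bar R},
    pushforward p cons = nu.
  apply: (@pushforward_sigma_finite _ _ _ _ R p cons
    (fun t : n.+1.-tuple R => (thead t, [tuple of behead t]))) => //.
    apply/measurable_fun_pairP; split; first exact: measurable_tnth.
    exact: measurable_behead.
  by move=> [x t]; congr pair; exact/val_inj.
exists nu; split => [D mD|a].
  rewrite -nuE big_ord_recl /pushforward -muE// -pE.
  rewrite -product_measure1E//; last 2 first.
  - exact: (mD ord0).
  - have := @measurable_box R _ _ n (fun i (t : n.-tuple R) => tnth t i) erefl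
      (fun i => D (lift ord0 i)); apply => // i.
  congr (product_measure1 _ _ _); apply/seteqP; split => -[x t] /=.
    move=> h; split; first exact: (h ord0).
    by move=> i; have := h (lift ord0 i); rewrite tnthS.
  move=> [h0 h] i; case: (unliftP ord0 i) => [j ->|-> //].
  by rewrite tnthS.
pose b i := a (lift ord0 i); have [hi hE] := mum b.
pose h (t : n.-tuple R) := \prod_(i < n) tnth t i ^+ b i.
pose F (x : R * n.-tuple R) := (x.1 ^+ a ord0 * h x.2)%:E.
pose f (t : n.+1.-tuple R) := (\prod_(i < n.+1) tnth t i ^+ a i)%:E.
have fF : f \o cons = F.
  apply/funext => -[x t]; rewrite /f /F /= big_ord_recl /=; congr (_ * _)%:E.
  by apply: eq_bigr => i _; rewrite tnthS.
have mh : measurable_fun setT h by have /measurable_EFinP := measurable_int _ hi.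
have mF : measurable_fun setT F.
  apply/measurable_EFinP/measurable_funM.
    by apply: measurable_funX; exact: measurable_fst.
  by apply: (measurableT_comp mh); exact: measurable_snd.
have mf : measurable_fun setT f.
  apply/measurable_EFinP.
  rewrite (_ : (fun t => _) = fun t : n.+1.-tuple R =>
     thead t ^+ a ord0 * h [tuple of behead t]); last first.
    apply/funext => t; rewrite big_ord_recl; congr (_ * _).
    apply: eq_bigr => i _; rewrite tnth_behead; congr (tnth _ _ ^+ _).
    by apply/val_inj; rewrite /= inordK// ltnS.
  apply: measurable_funM.
    by apply: measurable_funX; exact: measurable_tnth.
  by apply: (measurableT_comp mh); exact: measurable_behead.
have xi := integrable_normal_exprn s0 (a ord0).
have Fi : (N \x mu)%E.-integrable setT F.
  apply/integrable12ltyP => //.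
  have -> : (\int[N]_x \int[mu]_y `|F (x, y)| =
      \int[N]_x (`|(x ^+ a ord0)%:E| * \int[mu]_y `|(h y)%:E|))%E.
    apply: eq_integral => x _; rewrite -ge0_integralZl//.
    - by apply: eq_integral => y _; rewrite /F /= normrM EFinM.
    - by apply: measurableT_comp => //; exact/measurable_EFinP.
  have /integrableP[_ hfin] := hi; have /integrableP[mx xfin] := xi.
  have x0 : (0 <= \int[N]_x `|(x ^+ a ord0)%:E|)%E by exact: integral_ge0.
  have h0 : (0 <= \int[mu]_y `|(h y)%:E|)%E by exact: integral_ge0.
  have mx' : measurable_fun setT (fun x : R => `|(x ^+ a ord0)%:E|%E).
    exact: measurableT_comp.
  rewrite ge0_integralZr//; apply: lte_mul_pinfty => //.
  by rewrite ge0_fin_numE.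
rewrite -nuE -pE in mcons *.
split.
  by apply: integrable_pushforward => //; rewrite preimage_setT fF.
rewrite integral_pushforward//; last by rewrite preimage_setT fF.
rewrite preimage_setT fF; have := integral12_prod_meas1 Fi => <-.
transitivity (\int[N]_x ((x ^+ a ord0)%:E *
    (\prod_(i < n) normal_moment s (b i))%:E))%E.
  apply: eq_integral => x _; rewrite /fubini_F /F /=.
  by under eq_integral do rewrite EFinM; rewrite integralZl// -hE.
by rewrite integralZr// normal_momentE// -EFinM big_ord_recl.
Qed.

End gaussian_vector.

(** * Gaussian integration by parts *)

Section gaussian_ibp.
Context (R : realType) (d : measure_display) (T : measurableType d).
Variables (P : probability T R) (n : nat) (s : R) (xi : 'I_n -> {RV P >-> R}).
Hypotheses (s0 : 0 < s) (xi_gauss : isotropic_gaussian s xi).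

Definition monomial (a : 'I_n -> nat) (w : T) : R := \prod_i xi i w ^+ a i.

Lemma monomial_law a :
  P.-integrable setT (fun w => (monomial a w)%:E) /\
  (\int[P]_w (monomial a w)%:E = (\prod_i normal_moment s (a i))%:E)%E.
Proof.
have [mu [muE mum]] := gaussian_tuple s0 n.
pose X (w : T) : n.-tuple R := [tuple xi i w | i < n].
have mX : measurable_fun setT X.
  apply/measurable_fun_tnthP => i; rewrite (_ : _ \o _ = xi i)//.
  by apply/funext => w /=; rewrite tnth_mktuple.
pose nu : {measure set _ -> \bar R} :=
  measure_function_pushforward__canonical__measure_function_Measure P mX.
have e A : measurable A -> nu A = mu A.
  apply: (@box_measure_unique R _ _ n (fun i (t : n.-tuple R) => tnth t i) erefl).
    move=> D mD; rewrite /box muE// -xi_gauss//; congr (P _).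
    by apply/seteqP; split => w /= h i; have := h i; rewrite tnth_mktuple.
  move=> r; apply: (@le_lt_trans _ _ 1%E); last exact: ltry.
  apply: (@probability_le1 _ _ _ P); rewrite -[X in measurable X]setTI.
  have mX' := mX; apply: mX' => //; apply: measurable_box => //.
pose f (t : n.-tuple R) := (\prod_(i < n) tnth t i ^+ a i)%:E.
have fX : f \o X = fun w => (monomial a w)%:E.
  apply/funext => w; rewrite /f /=; congr (_%:E).
  by apply: eq_bigr => i _; rewrite tnth_mktuple.
have [/integrableP[mf fi] fE] := mum a.
have Pi : P.-integrable setT (f \o X).
  apply/integrableP; split; first exact: (measurableT_comp mf mX).
  have := @ge0_integral_pushforward _ _ _ _ R X mX P setT (abse \o f).
  rewrite preimage_setT => <-//.
  - by rewrite (@eq_measure_integral _ _ _ _ mu)// => A mA _; exact: e.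
  - exact: measurableT_comp.
  - by move=> t _; exact: abse_ge0.
split; first by rewrite -fX.
have := @integral_pushforward _ _ _ _ R X mX P setT f mf.
rewrite preimage_setT -fX -fE => <-//.
by rewrite (@eq_measure_integral _ _ _ _ mu)// => A mA _; exact: e.
Qed.

Definition expect (f : T -> R) : R := (\int[P]_w f w)%R.

Definition integ (f : T -> R) := P.-integrable setT (fun w => (f w)%:E).

Lemma expectD f g : integ f -> integ g ->
  expect (fun w => f w + g w) = expect f + expect g.
Proof. by move=> fi gi; rewrite /expect RintegralD. Qed.

Lemma expectZ c f : integ f -> expect (fun w => c * f w) = c * expect f.
Proof. by move=> fi; rewrite /expect RintegralZl. Qed.

Lemma integD f g : integ f -> integ g -> integ (fun w => f w + g w).
Proof.
move=> fi gi; rewrite /integ; under eq_fun do rewrite EFinD.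
exact: integrableD.
Qed.

Lemma integZ c f : integ f -> integ (fun w => c * f w).
Proof.
move=> fi; rewrite /integ; under eq_fun do rewrite EFinM.
exact: integrableZl.
Qed.

Lemma expect_le f g : integ f -> integ g -> (forall w, f w <= g w) ->
  expect f <= expect g.
Proof. by move=> fi gi fg; apply: le_Rintegral. Qed.

Lemma expect_cst c : expect (fun=> c) = c.
Proof. rewrite /expect /Rintegral integral_cst//.
transitivity (fine (c%:E * 1)%E); last by rewrite mule1.
by congr (fine (_ * _)%E); exact: probability_setT. Qed.

(* [gpoly f f']: [f] is a polynomial in the variables [xi i], and [f' i] is its
   formal partial derivative with respect to [xi i]. *)
Inductive gpoly : (T -> R) -> ('I_n -> T -> R) -> Prop :=
| gpoly_cst c : gpoly (fun=> c) (fun _ _ => 0)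
| gpoly_var j f f' : gpoly f f' ->
    gpoly (fun w => xi j w * f w)
      (fun i w => xi j w * f' i w + (i == j)%:R * f w)
| gpoly_add f f' g g' : gpoly f f' -> gpoly g g' ->
    gpoly (fun w => f w + g w) (fun i w => f' i w + g' i w).

Lemma gpoly_eq f f' g g' : gpoly f f' -> (forall w, f w = g w) ->
  (forall i w, f' i w = g' i w) -> gpoly g g'.
Proof.
move=> h fg fg'; rewrite (_ : g = f); last by apply/funext => w; rewrite fg.
rewrite (_ : g' = f')//; apply/funext => i; apply/funext => w.
by rewrite fg'.
Qed.

Lemma gpoly_scale c f f' : gpoly f f' ->
  gpoly (fun w => c * f w) (fun i w => c * f' i w).
Proof.
elim=> [b|j g g' _ IH|g g' h h' _ IHg _ IHh].
- by apply: (gpoly_eq (gpoly_cst (c * b))) => // i w; rewrite mulr0.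
- by apply: (gpoly_eq (gpoly_var j IH)) => [w|i w]; ring.
- by apply: (gpoly_eq (gpoly_add IHg IHh)) => [w|i w]; ring.
Qed.

Lemma gpoly_mul f f' g g' : gpoly f f' -> gpoly g g' ->
  gpoly (fun w => f w * g w) (fun i w => f' i w * g w + f w * g' i w).
Proof.
move=> + gg; elim=> [c|j h h' _ IH|h h' k k' _ IHh _ IHk].
- by apply: (gpoly_eq (gpoly_scale c gg)) => // i w; rewrite mul0r add0r.
- by apply: (gpoly_eq (gpoly_var j IH)) => [w|i w]; ring.
- by apply: (gpoly_eq (gpoly_add IHh IHk)) => [w|i w]; ring.
Qed.

Lemma gpoly_xi j : gpoly (xi j) (fun i _ => (i == j)%:R).
Proof.
by apply: (gpoly_eq (gpoly_var j (gpoly_cst 1))) => [w|i w]; ring.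
Qed.

Lemma gpoly_sum I (r : seq I) (f : I -> T -> R) f' :
  (forall k, gpoly (f k) (f' k)) ->
  gpoly (fun w => \sum_(k <- r) f k w) (fun i w => \sum_(k <- r) f' k i w).
Proof.
move=> h; elim: r => [|k r IH].
  by apply: (gpoly_eq (gpoly_cst 0)) => [w|i w]; rewrite big_nil.
by apply: (gpoly_eq (gpoly_add (h k) IH)) => [w|i w]; rewrite big_cons.
Qed.

(** Needed because integration by parts leaves expectations of partial derivatives, whose
    integrability also comes from being polynomial. *)
Lemma gpoly_diff f f' i : gpoly f f' -> exists g', gpoly (f' i) g'.
Proof.
elim=> [c|j g g' gg [h hh]|g g' h h' _ [k kk] _ [l ll]].
- by eexists; exact: (gpoly_cst 0).
- eexists; apply: gpoly_add; first exact: gpoly_var hh.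
  exact: gpoly_scale gg.
- by eexists; exact: gpoly_add kk ll.
Qed.

Definition inc (a : 'I_n -> nat) j i := (a i + (i == j))%N.
Definition dec (a : 'I_n -> nat) j i := (a i - (i == j))%N.

Lemma monomial_inc a j w : monomial (inc a j) w = xi j w * monomial a w.
Proof.
rewrite /monomial (bigD1 j)//= [in RHS](bigD1 j)//= /inc eqxx addn1 exprS mulrA.
congr (_ * _); apply: eq_bigr => i ij; by rewrite (negPf ij) addn0.
Qed.

Lemma dec_inc a i : dec (inc a i) i = a.
Proof.
by apply/funext => k; rewrite /inc /dec; case: eqP => _; rewrite ?addn1 ?subn1 ?addn0 ?subn0.
Qed.

Lemma inc_dec a i : (0 < a i)%N -> inc (dec a i) i = a.
Proof.
move=> ai; apply/funext => k; rewrite /inc /dec; case: eqP => [->|_].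
  by rewrite subn1 addn1 prednK.
by rewrite subn0 addn0.
Qed.

Lemma dec_incC a i j : i != j -> dec (inc a j) i = inc (dec a i) j.
Proof.
move=> ij; apply/funext => k; rewrite /inc /dec.
have [->|kj] := eqVneq k j; last by rewrite !addn0.
by rewrite eq_sym (negPf ij) !subn0.
Qed.

(** The monomial factor makes the induction work: a variable multiplying f is moved into the
    exponents [a]. *)
Lemma integ_gpoly f f' : gpoly f f' ->
  forall a, integ (fun w => monomial a w * f w).
Proof.
elim=> [c|j g g' _ IH|g g' h h' _ IHg _ IHh] a.
- have := integZ c (monomial_law a).1.
  by apply: eq_integrable => // w _; rewrite mulrC.
- by apply: eq_integrable (IH (inc a j)) => // w _; rewrite monomial_inc; congr EFin; ring.
- by apply: eq_integrable (integD (IHg a) (IHh a)) => // w _; rewrite mulrDr.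
Qed.

Lemma gpoly_integ f f' : gpoly f f' -> integ f.
Proof.
move=> /integ_gpoly /(_ (fun=> 0%N)); apply: eq_integrable => // w _.
by rewrite /monomial big1 ?mul1r.
Qed.

Lemma expect_monomial a : expect (monomial a) = \prod_i normal_moment s (a i).
Proof. by rewrite /expect /Rintegral (monomial_law a).2. Qed.

Lemma expect_monomial_inc a i : expect (monomial (inc a i)) =
  s ^+ 2 * (a i)%:R * expect (monomial (dec a i)).
Proof.
rewrite !expect_monomial (bigD1 i)//= [in RHS](bigD1 i)//= /inc /dec eqxx.
rewrite addn1 normal_momentS// subn1 -!mulrA; do 4 congr (_ * _).
by apply: eq_bigr => k ki; rewrite (negPf ki) addn0 subn0.
Qed.

Lemma gaussian_ibp f f' i : gpoly f f' ->
  expect (fun w => xi i w * f w) = s ^+ 2 * expect (f' i).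
Proof.
move=> ff.
(* Same strengthening by a monomial factor. When [a i = 0] the truncated [dec a i] is [a] itself,
   but its term has coefficient [(a i)%:R = 0]. *)
suff h a : expect (fun w => xi i w * (monomial a w * f w)) =
    s ^+ 2 * (expect (fun w => monomial a w * f' i w) +
      (a i)%:R * expect (fun w => monomial (dec a i) w * f w)).
  have m0 w : monomial (fun=> 0%N) w = 1 by rewrite /monomial big1.
  have := h (fun=> 0%N); rewrite mul0r addr0.
  under [X in expect X]eq_fun do rewrite m0 mul1r.
  by under [in RHS]eq_fun do rewrite m0 mul1r.
elim: ff a => [c|j g g' gg IH|g g' h h' gg IHg hh IHh] a.
- have -> : (fun w => xi i w * (monomial a w * c)) =
      (fun w => c * monomial (inc a i) w).
    by apply/funext => w; rewrite monomial_inc; ring.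
  have -> : (fun w => monomial (dec a i) w * c) =
      (fun w => c * monomial (dec a i) w) by apply/funext => w; rewrite mulrC.
  have -> : (fun w => monomial a w * 0) = (fun=> 0).
    by apply/funext => w; rewrite mulr0.
  rewrite expect_cst add0r !expectZ; try exact: (monomial_law _).1.
  by rewrite expect_monomial_inc; ring.
- have -> : (fun w => xi i w * (monomial a w * (xi j w * g w))) =
      (fun w => xi i w * (monomial (inc a j) w * g w)).
    by apply/funext => w; rewrite monomial_inc; ring.
  rewrite IH; congr (_ * _).
  have [h gh] := gpoly_diff i gg.
  have -> : (fun w => monomial a w * (xi j w * g' i w + (i == j)%:R * g w)) =
      (fun w => monomial (inc a j) w * g' i w + (i == j)%:R * (monomial a w * g w)).
    by apply/funext => w; rewrite monomial_inc; ring.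
  rewrite expectD; [|exact: (integ_gpoly gh _)|exact/integZ/(integ_gpoly gg _)].
  rewrite expectZ; last exact: (integ_gpoly gg _).
  have -> : (fun w => monomial (dec a i) w * (xi j w * g w)) =
      (fun w => monomial (inc (dec a i) j) w * g w).
    by apply/funext => w; rewrite monomial_inc; ring.
  rewrite -addrA; congr (_ + _).
  have [->|ij] := eqVneq i j; last first.
    by rewrite mul0r add0r /inc (negPf ij) addn0 -/inc dec_incC.
  have -> : (inc a j j)%:R = (a j)%:R + 1 :> R by rewrite /inc eqxx natrD.
  rewrite dec_inc /= mulrDl !mul1r addrC; congr (_ + _).
  have [->|aj] := posnP (a j); first by rewrite !mul0r.
  by rewrite inc_dec.
- have [k gk] := gpoly_diff i gg; have [l hl] := gpoly_diff i hh.
  have -> : (fun w => xi i w * (monomial a w * (g w + h w))) =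
      (fun w => monomial (inc a i) w * g w + monomial (inc a i) w * h w).
    by apply/funext => w; rewrite !monomial_inc; ring.
  rewrite expectD; [|exact: (integ_gpoly gg _)|exact: (integ_gpoly hh _)].
  have e u : (fun w => xi i w * (monomial a w * u w)) =
      (fun w => monomial (inc a i) w * u w).
    by apply/funext => w; rewrite monomial_inc; ring.
  rewrite -!e IHg IHh.
  have -> b u v : (fun w => monomial b w * (u w + v w)) =
      (fun w => monomial b w * u w + monomial b w * v w).
    by apply/funext => w; rewrite mulrDr.
  have -> b u v : (fun w => monomial b w * (u w + v w)) =
      (fun w => monomial b w * u w + monomial b w * v w).
    by apply/funext => w; rewrite mulrDr.
  rewrite !expectD; [ring|exact: (integ_gpoly gg _)|exact: (integ_gpoly hh _)|
    exact: (integ_gpoly gk _)|exact: (integ_gpoly hl _)].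
Qed.

End gaussian_ibp.

(** * Trace moments of Gaussian matrix series *)

Section gaussian_series.
Context (R : realType) (d : measure_display) (T : measurableType d).
Variables (P : probability T R) (n : nat) (s : R) (xi : 'I_n -> {RV P >-> R}).
Hypotheses (s0 : 0 < s) (xi_gauss : isotropic_gaussian s xi).
Notation gpoly := (@gpoly _ _ _ P n xi).
Notation expect := (@expect _ _ _ P).

Definition mgpoly a b (F : T -> 'M[R]_(a, b)) (F' : 'I_n -> T -> 'M[R]_(a, b)) :=
  forall k l, gpoly (fun w => F w k l) (fun i w => F' i w k l).

Lemma mgpoly_mul a b c (F : T -> 'M[R]_(a, b)) F' (G : T -> 'M[R]_(b, c)) G' :
  mgpoly F F' -> mgpoly G G' ->
  mgpoly (fun w => F w *m G w) (fun i w => F' i w *m G w + F w *m G' i w).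
Proof.
move=> FF GG k l.
apply: (gpoly_eq (gpoly_sum (index_enum 'I_b) (fun j => gpoly_mul (FF k j) (GG j l)))).
  by move=> w; rewrite mxE.
by move=> i w; rewrite !mxE -big_split.
Qed.

Lemma mgpoly_tr a (F : T -> 'M[R]_a) F' : mgpoly F F' ->
  gpoly (fun w => \tr (F w)) (fun i w => \tr (F' i w)).
Proof. by move=> FF; apply: gpoly_sum => k; exact: FF. Qed.

Lemma mgpoly_cst a b (C : 'M[R]_(a, b)) : mgpoly (fun=> C) (fun _ _ => 0).
Proof.
by move=> k l; apply: (gpoly_eq (gpoly_cst _ (C k l))) => // i w; rewrite mxE.
Qed.

Lemma mgpoly_eq a b (F : T -> 'M[R]_(a, b)) F' G G' : mgpoly F F' ->
  (forall w, F w = G w) -> (forall i w, F' i w = G' i w) -> mgpoly G G'.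
Proof.
by move=> FF FG FG' k l; apply: (gpoly_eq (FF k l)) => [w|i w]; rewrite ?FG ?FG'.
Qed.

Section linear.
Variables (a b : nat) (A : 'I_n -> 'M[R]_(a, b)).

Definition gseries w : 'M[R]_(a, b) := \sum_i xi i w *: A i.

Lemma mgpoly_gseries : mgpoly gseries (fun i _ => A i).
Proof.
move=> k l; apply: (gpoly_eq (gpoly_sum (index_enum 'I_n)
  (fun j => gpoly_scale (A j k l) (gpoly_xi xi j)))).
  by move=> w; rewrite summxE; apply: eq_bigr => j _; rewrite mxE mulrC.
move=> i w; rewrite (bigD1 i)//= eqxx mulr1 big1 ?addr0// => j ji.
by rewrite eq_sym (negPf ji) mulr0.
Qed.

End linear.

Variables (m : nat) (A : 'I_n -> 'M[R]_m) (v : R).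
Hypothesis AT : forall i, (A i)^T = A i.
Hypothesis Av : forall u : 'cV_m,
  mx_inner u ((\sum_i A i *m A i) *m u) <= v * mx_inner u u.
Notation H := (gseries A).

Lemma tr_gseries w : (H w)^T = H w.
Proof.
rewrite /gseries linear_sum /=; apply: eq_bigr => i _.
by rewrite linearZ /= AT.
Qed.

Lemma mgpoly_exp q : mgpoly (fun w => H w ^+ q)
  (fun i w => \sum_(a < q) H w ^+ a *m A i *m H w ^+ (q.-1 - a)).
Proof.
elim: q => [|q IH].
  by apply: (mgpoly_eq (mgpoly_cst 1%:M)) => // i w; rewrite big_ord0.
apply: (mgpoly_eq (mgpoly_mul (mgpoly_gseries A) IH)) => [w|i w].
  by rewrite exprmxS.
rewrite big_ord_recl /= subn0 expr0mx mul1mx; congr (_ + _).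
rewrite mulmx_sumr; apply: eq_bigr => j _.
rewrite /bump /= add1n exprmxS !mulmxA subnS -subn1 subnAC subn1.
by [].
Qed.

Lemma gpoly_trexp q :
  exists f', gpoly (fun w => \tr (H w ^+ q)) f'.
Proof. by eexists; apply: mgpoly_tr; exact: mgpoly_exp. Qed.

Lemma trace_quad_le k (B : 'M[R]_(m, k)) :
  \tr (B^T *m (\sum_i A i *m A i) *m B) <= v * \tr (B^T *m B).
Proof.
rewrite /mxtrace mulr_sumr; apply: ler_sum => j _.
rewrite mx_inner_colE; apply: (le_trans (Av _)).
by rewrite -{2}[col j B]mul1mx -mx_inner_colE mulmx1.
Qed.

Lemma expect_sum I (r : seq I) (f : I -> T -> R) :
  (forall k, exists f', gpoly (f k) f') ->
  expect (fun w => \sum_(k <- r) f k w) = \sum_(k <- r) expect (f k).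
Proof.
move=> h; elim: r => [|k r IH].
  under [X in expect X]eq_fun do rewrite big_nil.
  by rewrite expect_cst big_nil.
under [X in expect X]eq_fun do rewrite big_cons.
rewrite expectD ?IH ?big_cons//; first by have [f' /(gpoly_integ s0 xi_gauss)] := h k.
have fin : forall k, {f' & gpoly (f k) f'} by move=> l; exact: cid.
exact: (gpoly_integ s0 xi_gauss (gpoly_sum r (fun k => projT2 (fin k)))).
Qed.

(** Noncommutative Khintchine by recursion. Integrating by parts in tr H^(2p+2) = sum_i xi_i tr(A_i
    H^(2p+1)) and using Leibniz gives 2p + 1 terms tr(A_i H^a A_i H^(2p-a)). Each is at most
    tr(A_i^2 H^(2p)) by [tr_sandwich_le], and the quadratic form of sum_i A_i^2 is at most v. *)
Lemma expect_trace_step p :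
  expect (fun w => \tr (H w ^+ p.+1.*2)) <=
  s ^+ 2 * p.*2.+1%:R * v * expect (fun w => \tr (H w ^+ p.*2)).
Proof.
pose q := p.*2.+1.
pose f i w := \tr (A i *m H w ^+ q).
pose f' i j w := \tr (A i *m (\sum_(a < q) H w ^+ a *m A j *m H w ^+ (p.*2 - a))).
have ff i : gpoly (f i) (f' i).
  apply: (gpoly_eq (mgpoly_tr (mgpoly_mul (mgpoly_cst (A i)) (mgpoly_exp q)))) => //.
  by move=> j w; rewrite mul0mx add0r.
have fi i : exists g', gpoly (f' i i) g' by exact: gpoly_diff (ff i).
pose g w := \sum_i f' i i w.
have HE w : \tr (H w ^+ p.+1.*2) = \sum_i xi i w * f i w.
  rewrite doubleS exprmxS {1}/gseries mulmx_suml raddf_sum /=.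
  by apply: eq_bigr => i _; rewrite -scalemxAl mxtraceZ.
under eq_fun do rewrite HE.
rewrite expect_sum; last by move=> i; eexists; exact: gpoly_var (ff i).
under eq_bigr do rewrite (gaussian_ibp s0 xi_gauss _ (ff _)).
rewrite -mulr_sumr -expect_sum// -[leRHS]mulrA -[leRHS]mulrA.
rewrite ler_wpM2l ?exprn_ge0 ?(ltW s0)//.
have [h hh] := gpoly_trexp p.*2.
have hi := gpoly_integ s0 xi_gauss hh.
rewrite [leRHS]mulrA -expectZ//.
apply: expect_le.
- have fin : forall k, {g' & gpoly (f' k k) g'} by move=> l; exact: cid.
  exact: (gpoly_integ s0 xi_gauss (gpoly_sum _ (fun k => projT2 (fin k)))).
- exact: integZ.
move=> w; set K := H w.
have KT : K^T = K by exact: tr_gseries.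
apply: (@le_trans _ _ (\sum_i q%:R * \tr (A i *m A i *m K ^+ p.*2))).
  apply: ler_sum => i _; rewrite /f' mulmx_sumr raddf_sum /=.
  apply: (@le_trans _ _ (\sum_(a < q) \tr (A i *m A i *m K ^+ p.*2))).
    apply: ler_sum => a _; rewrite !mulmxA.
    by apply: tr_sandwich_le => //; rewrite -ltnS.
  by rewrite sumr_const card_ord mulr_natl.
rewrite -mulr_sumr -[leRHS]mulrA ler_wpM2l//.
have := trace_quad_le (K ^+ p); rewrite tr_exprmx// -exprmxD addnn.
apply: le_trans; rewrite -mulmxA mxtrace_mulC -mulmxA -exprmxD addnn.
by rewrite mulmx_suml raddf_sum.
Qed.

Lemma expect_trace_le p : 0 <= v ->
  expect (fun w => \tr (H w ^+ p.*2)) <=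
  m%:R * (s ^+ 2 * v) ^+ p * \prod_(i < p) i.*2.+1%:R.
Proof.
move=> v0; elim: p => [|p IH].
  rewrite big_ord0 expr0 !mulr1; under [X in expect X]eq_fun do rewrite expr0mx mxtrace1.
  by rewrite expect_cst.
apply: (le_trans (expect_trace_step p)).
have c0 : 0 <= s ^+ 2 * p.*2.+1%:R * v by rewrite !mulr_ge0// ltW.
apply: (le_trans (ler_wpM2l c0 IH)).
rewrite big_ord_recr /= (exprS (s ^+ 2 * v)); set q := _.+1%:R; set pr := \prod_(_ < _) _.
by rewrite le_eqVlt; apply/orP; left; apply/eqP; ring.
Qed.

End gaussian_series.

(** * Moments of the squared length of a projected Gaussian vector *)

Section chi_square.
Context (R : realType) (d : measure_display) (T : measurableType d).
Variables (P : probability T R) (n : nat) (s : R) (xi : 'I_n -> {RV P >-> R}).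
Hypotheses (s0 : 0 < s) (xi_gauss : isotropic_gaussian s xi).
Notation gpoly := (@gpoly _ _ _ P n xi).
Notation expect := (@expect _ _ _ P).
Variable Pi : 'M[R]_n.
Hypotheses (PiT : Pi^T = Pi) (Pi2 : Pi *m Pi = Pi).

Definition gvec w : 'cV[R]_n := \col_i xi i w.
Notation y i w := ((Pi *m gvec w) i 0).

Definition quad w : R := mx_inner (gvec w) (Pi *m gvec w).

Lemma quadE w : quad w = \sum_i y i w ^+ 2.
Proof.
rewrite /quad -{1}Pi2 -{1}PiT -mulmxA -mx_inner_mull mx_innerE.
by apply: eq_bigr => i _; rewrite big_ord1 expr2.
Qed.

Lemma quad_ge0 w : 0 <= quad w.
Proof. by rewrite quadE; apply: sumr_ge0 => i _; rewrite sqr_ge0. Qed.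

Lemma quadE_xi w : quad w = \sum_i xi i w * y i w.
Proof.
by rewrite /quad mx_innerE; apply: eq_bigr => i _; rewrite big_ord1 [gvec _ _ _]mxE.
Qed.

Lemma gpoly_proj i : gpoly (fun w => y i w) (fun k _ => Pi i k).
Proof.
apply: (gpoly_eq (gpoly_sum (index_enum 'I_n)
  (fun j => gpoly_scale (Pi i j) (gpoly_xi xi j)))).
  by move=> w; rewrite mxE; apply: eq_bigr => j _; rewrite mxE.
move=> k w; rewrite (bigD1 k)//= eqxx mulr1 big1 ?addr0// => j jk.
by rewrite eq_sym (negPf jk) mulr0.
Qed.

Lemma gpoly_quad : gpoly quad (fun k w => 2 * y k w).
Proof.
apply: (gpoly_eq (gpoly_sum (index_enum 'I_n)
  (fun i => gpoly_mul (gpoly_xi xi i) (gpoly_proj i)))).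
  by move=> w; rewrite quadE_xi.
move=> k w; rewrite big_split /= (bigD1 k)//= eqxx mul1r big1 ?addr0; last first.
  by move=> i ik; rewrite eq_sym (negPf ik) mul0r.
rewrite mulr_natl mulr2n; congr (_ + _); rewrite mxE; apply: eq_bigr => i _.
by rewrite [gvec _ _ _]mxE mulrC -{1}PiT mxE.
Qed.

Lemma gpoly_quadX j : gpoly (fun w => quad w ^+ j)
  (fun k w => j%:R * quad w ^+ j.-1 * (2 * y k w)).
Proof.
elim: j => [|j IH].
  by apply: (gpoly_eq (gpoly_cst _ 1)) => // k w; rewrite !mul0r.
apply: (gpoly_eq (gpoly_mul gpoly_quad IH)) => [w|k w]; first by rewrite exprS.
case: j {IH} => [|j]; first by rewrite !expr0; ring.
by rewrite /= (exprS _ j); move: (quad w ^+ j) => z; ring.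
Qed.

(** Integration by parts in sum_i xi_i (Pi xi)_i quad^j: the divergence of Pi xi is tr Pi, and the
    gradient 2 Pi xi of quad, paired with Pi xi, gives 2 j quad^j. This is the chi-square recursion
    with tr Pi degrees of freedom. *)
Lemma expect_quadS j : expect (fun w => quad w ^+ j.+1) =
  s ^+ 2 * (\tr Pi + 2 * j%:R) * expect (fun w => quad w ^+ j).
Proof.
have yQ i := gpoly_mul (gpoly_proj i) (gpoly_quadX j).
have -> : (fun w => quad w ^+ j.+1) =
    (fun w => \sum_i xi i w * (y i w * quad w ^+ j)).
  apply/funext => w; rewrite exprS {1}quadE_xi mulr_suml.
  by apply: eq_bigr => i _; rewrite mulrA.
rewrite (expect_sum s0 xi_gauss); last by move=> i; eexists; exact: gpoly_var (yQ i).
under eq_bigr do rewrite (gaussian_ibp s0 xi_gauss _ (yQ _)).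
rewrite -mulr_sumr -(expect_sum s0 xi_gauss); last first.
  by move=> i; exact: gpoly_diff (yQ i).
rewrite -[RHS]mulrA; congr (_ * _).
rewrite -expectZ; last exact: (gpoly_integ s0 xi_gauss (gpoly_quadX j)).
congr expect; apply/funext => w.
rewrite big_split /= -mulr_suml -/(\tr Pi).
have -> : \sum_i y i w * (j%:R * quad w ^+ j.-1 * (2 * y i w)) =
    2 * j%:R * quad w ^+ j.-1 * quad w.
  rewrite [X in _ = _ * X]quadE mulr_sumr; apply: eq_bigr => i _.
  by rewrite expr2; move: (quad w ^+ _) => z; ring.
case: j {yQ} => [|j]; first by rewrite !mulr0 !mul0r !addr0.
rewrite /= (exprSr _ j).
by move: (quad w ^+ j) (quad w) (\tr Pi) => a b c; ring.
Qed.

(** K is a whole number bounding half the degrees of freedom, so that the moments are compared with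
    rising factorials of an integer. *)
Lemma expect_quad_le (K : nat) j : \tr Pi <= 2 * K%:R ->
  expect (fun w => quad w ^+ j) <=
  (2 * s ^+ 2) ^+ j * \prod_(i < j) (K + i)%:R.
Proof.
move=> trK; elim: j => [|j IH].
  by rewrite big_ord0 mulr1; under eq_fun do rewrite expr0; rewrite expect_cst.
rewrite expect_quadS big_ord_recr /= (exprS (2 * s ^+ 2)).
have E0 : 0 <= expect (fun w => quad w ^+ j).
  by apply: Rintegral_ge0 => w _; rewrite exprn_ge0// quad_ge0.
apply: (@le_trans _ _ (s ^+ 2 * (2 * (K + j)%:R) * expect (fun w => quad w ^+ j))).
  rewrite ler_wpM2r// ler_wpM2l ?exprn_ge0 ?(ltW s0)//.
  by rewrite natrD mulrDr lerD2r.
apply: (@le_trans _ _ (s ^+ 2 * (2 * (K + j)%:R) *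
    ((2 * s ^+ 2) ^+ j * \prod_(i < j) (K + i)%:R))).
  by rewrite ler_wpM2l// !mulr_ge0// ltW.
rewrite le_eqVlt; apply/orP; left; apply/eqP.
by move: (\prod_(_ < _) _) ((2 * s ^+ 2) ^+ j) (K + j)%:R => u z t; ring.
Qed.

End chi_square.

(** * Tail bounds *)

Section exponential_sums.
Variable R : realType.

Lemma cvg_exp_sum (x : R) :
  \sum_(0 <= i < N) x ^+ i / i`!%:R @[N --> \oo] --> expR x.
Proof. exact: is_cvg_series_exp_coeff. Qed.

Lemma exp_sum_le (x : R) N : 0 <= x -> \sum_(i < N) x ^+ i / i`!%:R <= expR x.
Proof.
move=> x0; rewrite -(big_mkord xpredT (fun i => x ^+ i / i`!%:R)).
apply: (nondecreasing_cvgn_le _ (is_cvg_series_exp_coeff x)).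
by apply: nondecreasing_series => i _ _; exact: exp_coeff_ge0.
Qed.

(** The limit of the right side is exp y + exp (- y), strictly above exp y, so a finite sum of even
    terms already suffices. *)
Lemma cosh_sum_ge (y : R) : exists N,
  expR y <= 2 * \sum_(j < N) y ^+ j.*2 / j.*2`!%:R.
Proof.
have h := cvgD (@cvg_exp_sum y) (@cvg_exp_sum (- y)).
have lt : expR y < expR y + expR (- y) by rewrite ltrDl expR_gt0.
have [N _ hN] := cvgr_ge _ (h _) _ lt.
exists N; have /= := hN N.*2 (_ : (N <= N.*2)%N).
rewrite -addnn leq_addl => /(_ isT); rewrite addnn => /le_trans; apply.
rewrite -[leLHS]/(\sum_(0 <= i < N.*2) y ^+ i / i`!%:R +
  \sum_(0 <= i < N.*2) (- y) ^+ i / i`!%:R).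
rewrite !big_mkord le_eqVlt; apply/orP; left; apply/eqP.
elim: N {hN} => [|N IH]; first by rewrite !big_ord0 addr0 mulr0.
rewrite doubleS !big_ord_recr /= mulrDr -IH.
have -> : (- y) ^+ N.*2 = y ^+ N.*2 by rewrite -mul2n !exprM sqrrN.
have -> : (- y) ^+ N.*2.+1 = - y ^+ N.*2.+1.
  by rewrite exprNn -signr_odd /= odd_double expr1 mulN1r.
by rewrite mulNr; set a := _ / _; set b := _ / _; ring.
Qed.

(** The product of odd numbers is the one bounding the trace moments; it cancels, and the even
    series becomes that of an exponential with halved argument. *)
Lemma fact_double j : (j.*2)`!%:R =
  2 ^+ j * j`!%:R * \prod_(i < j) i.*2.+1%:R :> R.
Proof.
elim: j => [|j IH]; first by rewrite big_ord0 double0 fact0 expr0 !mulr1.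
rewrite doubleS !factS big_ord_recr /= !natrM IH exprS.
have -> : j.*2.+2%:R = 2 * j.+1%:R :> R by rewrite -natrM mul2n doubleS.
by move: (\prod_(_ < _) _) (2 ^+ j) j.+1%:R j.*2.+1%:R j`!%:R => *; ring.
Qed.

(** These are partial sums of the binomial series of (1 - 1/2)^(- K). The rule [rS], a form of
    Pascal's, bounds the sum for K + 1 by the one for K plus half of itself. *)
Lemma rising_sum_le K N :
  \sum_(j < N) (2^-1 : R) ^+ j * \prod_(i < j) (K + i)%:R / j`!%:R <= 2 ^+ K.
Proof.
elim: K N => [|K IH] N.
  case: N => [|N]; first by rewrite big_ord0 expr0.
  rewrite big_ord_recl big_ord0 expr0 fact0 divr1 !mul1r big1 ?addr0// => j _.
  by rewrite /= big_ord_recl addn0 mul0r mulr0 mul0r.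
pose r k j : R := (2^-1) ^+ j * \prod_(i < j) (k + i)%:R / j`!%:R.
rewrite -[leLHS]/(\sum_(j < N) r K.+1 j).
have r0 k j : 0 <= r k j.
  by rewrite !mulr_ge0 ?invr_ge0 ?exprn_ge0 ?invr_ge0// prodr_ge0.
have rS j : r K.+1 j.+1 = 2^-1 * r K.+1 j + r K j.+1.
  rewrite /r (big_ord_recr j) /= (big_ord_recl j) /= addn0.
  have -> : \prod_(i < j) (K + bump 0 i)%:R = \prod_(i < j) (K.+1 + i)%:R :> R.
    by apply: eq_bigr => i _; rewrite /bump /= addnA addn1.
  rewrite factS natrM exprS.
  have -> : (K.+1 + j)%:R = K%:R + j.+1%:R :> R by rewrite -natrD addSnnS.
  have j1 : j.+1%:R != 0 :> R by rewrite pnatr_eq0.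
  have jf : j`!%:R != 0 :> R by rewrite pnatr_eq0 -lt0n fact_gt0.
  move: (\prod_(_ < _) _) => p; move: j1 jf.
  by move: (_ ^+ j) j.+1%:R j`!%:R => a b c b0 c0; field; rewrite b0 c0.
have h1 : \sum_(j < N) r K.+1 j <= \sum_(j < N.+1) r K.+1 j.
  by rewrite [leRHS]big_ord_recr lerDl.
have h2 := IH N.+1; rewrite -[leLHS]/(\sum_(j < N.+1) r K j) in h2.
have h3 : \sum_(j < N.+1) r K.+1 j =
    \sum_(j < N.+1) r K j + 2^-1 * \sum_(j < N) r K.+1 j.
  rewrite 2!big_ord_recl mulr_sumr -addrA; congr (_ + _).
    by rewrite /r !big_ord0.
  by rewrite addrC -big_split; apply: eq_bigr => j _; rewrite rS.
rewrite exprS; lra.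
Qed.

End exponential_sums.

(** * Tail bounds for the two noise terms *)

Section gaussian_tails.
Context (R : realType) (d : measure_display) (T : measurableType d).
Variables (P : probability T R) (n : nat) (s : R) (xi : 'I_n -> {RV P >-> R}).
Hypotheses (s0 : 0 < s) (xi_gauss : isotropic_gaussian s xi).
Notation gpoly := (@gpoly _ _ _ P n xi).
Notation expect := (@expect _ _ _ P).

Lemma measurable_gpoly f f' : gpoly f f' -> measurable_fun setT f.
Proof.
move=> /(gpoly_integ s0 xi_gauss) h.
by have /measurable_EFinP := measurable_int _ h.
Qed.

Lemma gpoly_markov f f' (c b : R) : gpoly f f' -> (forall w, 0 <= f w) ->
  0 < c -> expect f <= b -> (P [set w | (c <= f w)%R] <= (b / c)%:E)%E.
Proof.
move=> ff f0 c0 fb; have fi := gpoly_integ s0 xi_gauss ff.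
have mf : measurable_fun setT (fun w => (f w)%:E) by exact: measurable_int fi.
have := le_integral_abse P measurableT mf c0.
under eq_integral do rewrite gee0_abs ?lee_fin//.
have -> : (\int[P]_w (f w)%:E = (expect f)%:E)%E.
  by rewrite /expect /Rintegral fineK//; exact: integrable_fin_num.
have -> : setT `&` [set w | (c%:E <= `|(f w)%:E|)%E] = [set w | c <= f w].
  rewrite setTI; apply/seteqP; split => w /=;
    by rewrite lee_fin ger0_norm.
move=> h; rewrite -(@lee_pmul2l _ c%:E)// ?lte_fin// -EFinM mulrCA mulfV ?gt_eqF//.
by rewrite mulr1; apply: (le_trans h); rewrite lee_fin.
Qed.

(* Chernoff's bound at [th = 1 / (4 s^2)]; the exponential is replaced by its
   partial sums, so that only moments are needed. *)
Lemma quad_tail (Pi : 'M[R]_n) (K : nat) (q : R) :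
  Pi^T = Pi -> Pi *m Pi = Pi -> \tr Pi <= 2 * K%:R -> 0 <= q ->
  (P [set w | (q <= quad xi Pi w)%R] <=
    (2 ^+ K * expR (- (q / (4 * s ^+ 2))))%:E)%E.
Proof.
move=> PiT Pi2 trK q0; pose th := (4 * s ^+ 2)^-1.
have s20 : 0 < 4 * s ^+ 2 by rewrite mulr_gt0 ?exprn_gt0.
have th0 : 0 <= th by rewrite invr_ge0 ltW.
pose Y N w := \sum_(j < N) th ^+ j / j`!%:R * quad xi Pi w ^+ j.
have c0 j : 0 <= th ^+ j / j`!%:R by rewrite divr_ge0 ?exprn_ge0.
have gY N : exists f', gpoly (Y N) f'.
  eexists; apply: gpoly_sum => j; apply: gpoly_scale.
  exact: gpoly_quadX.
have EY N : expect (Y N) <= 2 ^+ K.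
  rewrite (expect_sum s0 xi_gauss); last first.
    by move=> j; eexists; apply: gpoly_scale; exact: gpoly_quadX.
  apply: le_trans (rising_sum_le R K N); apply: ler_sum => j _.
  rewrite expectZ; last exact: (gpoly_integ s0 xi_gauss (gpoly_quadX xi PiT j)).
  apply: (le_trans (ler_wpM2l (c0 j) (expect_quad_le s0 xi_gauss PiT Pi2 j trK))).
  rewrite le_eqVlt; apply/orP; left; apply/eqP.
  have -> : (2^-1 : R) ^+ j = th ^+ j * (2 * s ^+ 2) ^+ j.
    rewrite -exprMn; congr (_ ^+ _); rewrite /th; field; exact: lt0r_neq0.
  by move: (\prod_(_ < _) _) => p; ring.
set A := [set w | _]; pose p := fine (P A).
have mA : measurable A.
  rewrite /A (_ : [set w | _] = setT `&` quad xi Pi @^-1` `[q, +oo[%classic).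
    have := measurable_gpoly (gpoly_quad xi PiT) => mq.
    by apply: mq => //; exact: measurable_itv.
  by rewrite setTI; apply/seteqP; split => w /=; rewrite in_itv /= andbT.
have pE : P A = p%:E by rewrite /p fineK// fin_num_measure.
(* On the event the truncated exponential of quad is at least its value at q, so Markov's inequality
   applies for every N; N tends to infinity only at the end. *)
have pN N : p * \sum_(j < N) (q * th) ^+ j / j`!%:R <= 2 ^+ K.
  have [->|N0] := posnP N; first by rewrite big_ord0 mulr0 exprn_ge0.
  set e := \sum_(_ < _) _.
  have e0 : 0 < e.
    rewrite /e; case: N N0 @e => // N _; rewrite big_ord_recl /= expr0 fact0 divr1.
    by rewrite ltr_wpDr// sumr_ge0// => j _; rewrite divr_ge0 ?exprn_ge0 ?mulr_ge0.
  rewrite -ler_pdivlMr// -lee_fin -pE.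
  have [f' gf] := gY N.
  apply: le_trans (gpoly_markov gf _ e0 (EY N)).
    apply: le_measure; rewrite ?inE//.
      rewrite (_ : [set w | _] = setT `&` Y N @^-1` `[e, +oo[%classic).
        by apply: (measurable_gpoly gf) => //; exact: measurable_itv.
      by rewrite setTI; apply/seteqP; split => w /=; rewrite in_itv /= andbT.
    move=> w; rewrite /A /= => qw; apply: ler_sum => j _.
    rewrite exprMn [_ ^+ j * _]mulrC mulrAC ler_wpM2l//.
    by apply: lerXn2r => //; exact: quad_ge0.
  move=> w; apply: sumr_ge0 => j _; rewrite mulr_ge0// exprn_ge0//.
  exact: quad_ge0.
rewrite pE lee_fin expRN -/th ler_pdivlMr ?expR_gt0//.
rewrite leNgt; apply/negP => lt.
have cv : p * \sum_(0 <= i < N) (q * th) ^+ i / i`!%:R @[N --> \oo] --> p * expR (q * th).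
  by apply: cvgMr; exact: cvg_exp_sum.
have [N _ /(_ N (leqnn N))] := cvgr_gt _ cv _ lt.
by rewrite /= big_mkord ltNge pN.
Qed.

(* Markov's inequality for a truncation of [tr (cosh (th H))], with
   [th = t / (s^2 v)].  If all the inequalities [2 t^(2j) <= tr (H^(2j))] held,
   the truncated sum would be at least [expR (th t)]. *)
Lemma gseries_tail m (A : 'I_n -> 'M[R]_m) (v t : R) :
  (forall i, (A i)^T = A i) -> 0 < v -> 0 < t ->
  (forall u : 'cV_m, mx_inner u ((\sum_i A i *m A i) *m u) <= v * mx_inner u u) ->
  exists G : set T, [/\ measurable G,
    (P (~` G) <= (m%:R * expR (- (t ^+ 2 / (2 * s ^+ 2 * v))))%:E)%E &
    forall w, G w -> exists j, \tr (gseries xi A w ^+ j.*2) < 2 * t ^+ j.*2].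
Proof.
move=> AT v0 t0 Av; pose th := t / (s ^+ 2 * v).
have sv0 : 0 < s ^+ 2 * v by rewrite mulr_gt0// exprn_gt0.
have th0 : 0 < th by rewrite divr_gt0.
have [N hN] := cosh_sum_ge (th * t).
pose Y w := \sum_(j < N) th ^+ j.*2 / (j.*2)`!%:R * \tr (gseries xi A w ^+ j.*2).
have c0 j : 0 <= th ^+ j.*2 / (j.*2)`!%:R by rewrite divr_ge0 ?exprn_ge0// ltW.
have gtr j : exists f', gpoly (fun w => \tr (gseries xi A w ^+ j)) f'.
  exact: gpoly_trexp.
have [f' gY] : exists f', gpoly Y f'.
  have fin : forall j : 'I_N, {f' & gpoly (fun w => \tr (gseries xi A w ^+ j.*2)) f'}.
    by move=> j; exact: cid.
  by eexists; apply: gpoly_sum => j; apply: gpoly_scale; exact: (projT2 (fin j)).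
have EY : expect Y <= m%:R * expR (th ^+ 2 * s ^+ 2 * v / 2).
  rewrite (expect_sum s0 xi_gauss); last first.
    move=> j; have [g' gg] := gtr j.*2.
    by eexists; apply: gpoly_scale; exact: gg.
  have x0 : 0 <= th ^+ 2 * s ^+ 2 * v / 2.
    by rewrite divr_ge0// (mulr_ge0 _ (ltW v0))// mulr_ge0 ?sqr_ge0.
  apply: le_trans (ler_wpM2l (ler0n R m) (exp_sum_le N x0)).
  rewrite mulr_sumr; apply: ler_sum => j _.
  have [g' gg] := gtr j.*2.
  rewrite expectZ; last exact: (gpoly_integ s0 xi_gauss gg).
  apply: (le_trans (ler_wpM2l (c0 j) (expect_trace_le s0 xi_gauss AT Av j (ltW v0)))).
  rewrite fact_double le_eqVlt; apply/orP; left; apply/eqP.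
  have -> : th ^+ j.*2 = (th ^+ 2) ^+ j by rewrite -exprM mul2n.
  have -> : (th ^+ 2 * s ^+ 2 * v / 2) ^+ j =
      (th ^+ 2) ^+ j * (s ^+ 2 * v) ^+ j / 2 ^+ j.
    by rewrite -[th ^+ 2 * _ * v]mulrA expr_div_n exprMn.
  have : \prod_(i < j) i.*2.+1%:R != 0 :> R.
    by apply/prodf_neq0 => i _; rewrite pnatr_eq0.
  have : (2 : R) ^+ j != 0 by rewrite expf_neq0.
  have : j`!%:R != 0 :> R by rewrite pnatr_eq0 -lt0n fact_gt0.
  move: (\prod_(_ < _) _) => p.
  move: (2 ^+ j) ((th ^+ 2) ^+ j) ((s ^+ 2 * v) ^+ j) j`!%:R (m%:R : R).
  by move=> a b c e f e0 a0 p0; field; rewrite e0 a0 p0.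
pose Sg := 2 * \sum_(j < N) (th * t) ^+ j.*2 / (j.*2)`!%:R.
have Sg0 : 0 < Sg by apply: lt_le_trans hN; exact: expR_gt0.
have mY := measurable_gpoly gY.
have Y0 w : 0 <= Y w.
  apply: sumr_ge0 => j _; rewrite mulr_ge0// -addnn exprmxD.
  by rewrite -{1}(tr_exprmx _ (tr_gseries xi AT w)) mx_inner_ge0.
exists [set w | Y w < Sg]; split.
- rewrite (_ : [set w | _] = setT `&` Y @^-1` `]-oo, Sg[%classic).
    by apply: mY => //; exact: measurable_itv.
  by rewrite setTI; apply/seteqP; split => w /=; rewrite in_itv.
- have -> : ~` [set w | Y w < Sg] = [set w | Sg <= Y w].
    by apply/seteqP; split => w /=; [move/negP; rewrite -leNgt|rewrite leNgt => /negP].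
  apply: (le_trans (gpoly_markov gY Y0 Sg0 EY)); rewrite lee_fin -mulrA ler_wpM2l//.
  rewrite ler_pdivrMr//; apply: (@le_trans _ _ (expR (- (t ^+ 2 / (2 * s ^+ 2 * v))) * expR (th * t))).
    rewrite -expRD ler_expR le_eqVlt; apply/orP; left; apply/eqP.
    by rewrite /th; field; rewrite !gt_eqF.
  by rewrite ler_wpM2l ?expR_ge0.
- move=> w /= Yw; apply: contrapT => /forallNP h; move: Yw; apply/negP.
  rewrite -leNgt.
  rewrite /Sg mulr_sumr; apply: ler_sum => j _.
  have := h j => /negP; rewrite -leNgt => hj.
  rewrite exprMn; apply: le_trans (ler_wpM2l (c0 j) hj).
  by rewrite le_eqVlt; apply/orP; left; apply/eqP; ring.
Qed.

End gaussian_tails.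

(** * Hermitian dilation and the projected design *)

Section dilation_matrix.
Variables (R : realType) (m1 m2 : nat).

Definition dilmx (Z : 'M[R]_(m1, m2)) : 'M[R]_(m1 + m2) := block_mx 0 Z Z^T 0.

Lemma tr_dilmx Z : (dilmx Z)^T = dilmx Z.
Proof. by rewrite /dilmx tr_block_mx !trmx0 trmxK. Qed.

Lemma dilmx_sqr Z : dilmx Z *m dilmx Z = block_mx (Z *m Z^T) 0 0 (Z^T *m Z).
Proof. by rewrite mulmx_block !mulmx0 !mul0mx !addr0 !add0r. Qed.

Lemma mx_inner_col_mx k (A A' : 'M[R]_(m1, k)) (B B' : 'M[R]_(m2, k)) :
  mx_inner (col_mx A B) (col_mx A' B') = mx_inner A A' + mx_inner B B'.
Proof. by rewrite /mx_inner tr_col_mx mul_row_col mxtraceD. Qed.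

Lemma dilmx_sqr_quad (I : finType) (X : I -> 'M[R]_(m1, m2)) (v : R) :
  (forall u : 'cV_m1, mx_inner u ((\sum_i X i *m (X i)^T) *m u) <= v * mx_inner u u) ->
  (forall u : 'cV_m2, mx_inner u ((\sum_i (X i)^T *m X i) *m u) <= v * mx_inner u u) ->
  forall u : 'cV_(m1 + m2), mx_inner u ((\sum_i dilmx (X i) *m dilmx (X i)) *m u) <=
    v * mx_inner u u.
Proof.
move=> h1 h2 u; rewrite -(vsubmxK u).
have -> : \sum_i dilmx (X i) *m dilmx (X i) =
    block_mx (\sum_i X i *m (X i)^T) 0 0 (\sum_i (X i)^T *m X i).
  under eq_bigr do rewrite dilmx_sqr.
  by elim/big_rec3: _ => [|i y1 y2 y3 _ ->];
    rewrite ?add_block_mx ?addr0 // -block_mx0.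
rewrite mul_block_col !mul0mx addr0 add0r !mx_inner_col_mx mulrDr.
by rewrite lerD.
Qed.

(** The numbers b j = |H^j e|^2 satisfy b(j+1)^2 <= b(j) b(j+2) by Cauchy-Schwarz and b 0 = 1, hence
    their ratios are at least b 1. No diagonalization is involved. *)
Lemma moment_ge m (H : 'M[R]_m) (e : 'cV[R]_m) k : H^T = H ->
  mx_inner e e = 1 ->
  mx_inner (H *m e) (H *m e) ^+ k <= mx_inner (H ^+ k *m e) (H ^+ k *m e).
Proof.
move=> HT e1; pose b k := mx_inner (H ^+ k *m e) (H ^+ k *m e).
have b0 j : 0 <= b j by exact: mx_inner_ge0.
have bcs j : b j.+1 ^+ 2 <= b j * b j.+2.
  have -> : b j.+1 = mx_inner (H ^+ j *m e) (H ^+ j.+2 *m e).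
    by rewrite /b {1}exprmxS -mulmxA mx_inner_mull HT mulmxA -exprmxS.
  exact: mx_inner_cs.
have bS j : b 1%N * b j <= b j.+1.
  elim: j => [|j IH].
    by rewrite {2}/b expr0mx mul1mx e1 mulr1.
  have := b0 j.+1; rewrite le_eqVlt => /orP[/eqP <-|bj]; first by rewrite mulr0.
  rewrite -(ler_pM2l bj) mulrCA -expr2.
  apply: (le_trans (ler_wpM2l (b0 1%N) (bcs j))).
  by rewrite mulrA ler_wpM2r.
rewrite -/(b k); have -> : mx_inner (H *m e) (H *m e) = b 1%N by [].
elim: k => [|k IH]; first by rewrite /b expr0mx mul1mx e1.
by rewrite exprS; apply: le_trans (bS k); rewrite ler_wpM2l.
Qed.

(** The orthonormal vectors (u, 0) and (0, v) each contribute at least t^(2j) to the trace, by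
    [moment_ge] and Bessel. This is the source of the factor 2, which offsets the one in 2 cosh. *)
Lemma dilmx_trace_ge (Z : 'M[R]_(m1, m2)) (u : 'cV_m1) (v : 'cV_m2) t j :
  mx_inner u u = 1 -> mx_inner v v = 1 -> 0 <= t -> t <= mx_inner u (Z *m v) ->
  2 * t ^+ j.*2 <= \tr (dilmx Z ^+ j.*2).
Proof.
move=> u1 v1 t0 tuv; set H := dilmx Z; have HT : H^T = H := tr_dilmx Z.
pose e1 : 'cV[R]_(m1 + m2) := col_mx u 0; pose e2 : 'cV[R]_(m1 + m2) := col_mx 0 v.
have e11 : mx_inner e1 e1 = 1 by rewrite mx_inner_col_mx u1 mx_inner0l addr0.
have e21 : mx_inner e2 e2 = 1 by rewrite mx_inner_col_mx v1 mx_inner0l add0r.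
have o1 (e : 'cV[R]_(m1 + m2)) : mx_inner e e = 1 -> orthonormal e.
  move=> e1e; apply/matrixP => a b; rewrite !ord1 [RHS]mxE eqxx mulr1n.
  by rewrite -e1e /mx_inner /mxtrace big_ord1.
have oE : orthonormal (row_mx e1 e2).
  apply: orthonormal_row_mx; [exact: o1|exact: o1|].
  by rewrite tr_col_mx mul_row_col mulmx0 trmx0 mul0mx addr0.
have b1 (e : 'cV[R]_(m1 + m2)) : mx_inner e e = 1 ->
    t ^+ 2 <= mx_inner (H *m e) (H *m e) -> t ^+ j.*2 <= mx_inner (H ^+ j *m e) (H ^+ j *m e).
  move=> ee he; apply: le_trans (moment_ge j HT ee).
  by rewrite -mul2n exprM; apply: lerXn2r => //; rewrite ?nnegrE ?exprn_ge0 ?mx_inner_ge0.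
have := bessel (H ^+ j) oE; rewrite tr_row_mx mul_col_mx.
have colE (e : 'cV[R]_(m1 + m2)) : mx_inner (e^T *m H ^+ j) (e^T *m H ^+ j) =
    mx_inner (H ^+ j *m e) (H ^+ j *m e).
  by rewrite -mx_inner_trmx trmx_mul trmxK (tr_exprmx _ HT).
have colD (A B : 'M[R]_(1, m1 + m2)) :
    mx_inner (col_mx A B) (col_mx A B) = mx_inner A A + mx_inner B B.
  by rewrite /mx_inner tr_col_mx mul_row_col mxtraceD.
rewrite colD !colE {3}/mx_inner (tr_exprmx _ HT) -exprmxD addnn; apply: le_trans.
rewrite mulr_natl mulr2n lerD// b1//.
- rewrite /H /e1 mul_block_col !(mulmx0, mul0mx, addr0, add0r)
     mx_inner_col_mx mx_inner0l add0r.
  rewrite -(mulr1 (mx_inner _ _)) -v1; apply: le_trans (mx_inner_cs _ _).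
  rewrite mx_inner_mull trmxK; apply: lerXn2r => //.
  by rewrite nnegrE (le_trans t0).
- rewrite /H /e2 mul_block_col !(mulmx0, mul0mx, addr0, add0r) mx_inner_col_mx mx_inner0l addr0.
  rewrite -(mul1r (mx_inner _ _)) -u1; apply: le_trans (mx_inner_cs _ _).
  by apply: lerXn2r => //; rewrite nnegrE (le_trans t0).
Qed.

Lemma op_le_dilmx_trace (Z : 'M[R]_(m1, m2)) t : 0 <= t ->
  (exists j, \tr (dilmx Z ^+ j.*2) < 2 * t ^+ j.*2) -> op_le t Z.
Proof.
move=> t0 [j hj] u v u1 v1; rewrite leNgt; apply/negP => /ltW h.
by have := dilmx_trace_ge j u1 v1 t0 h; rewrite leNgt hj.
Qed.

End dilation_matrix.

(** * Design constant, projected design and fitted values *)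

Section design.
Variable R : realType.

Lemma design_quad n m1 m2 (X : 'I_n -> 'M[R]_(m1, m2)) : (0 < n)%N ->
  (forall u : 'cV_m1, mx_inner u ((\sum_i X i *m (X i)^T) *m u) <=
    n%:R * design_constant X ^+ 2 * mx_inner u u) /\
  (forall u : 'cV_m2, mx_inner u ((\sum_i (X i)^T *m X i) *m u) <=
    n%:R * design_constant X ^+ 2 * mx_inner u u).
Proof.
move=> n0; have nR : (0 : R) < n%:R by rewrite ltr0n.
have key m (M : 'M[R]_m) (v : R) (u : 'cV_m) : M^T = M ->
    Num.sqrt (op_norm (n%:R^-1 *: M)) <= v ->
    mx_inner u (M *m u) <= n%:R * v ^+ 2 * mx_inner u u.
  move=> MT Mv; have MT' : (n%:R^-1 *: M)^T = n%:R^-1 *: M by rewrite linearZ /= MT.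
  have := op_norm_quad u MT'; rewrite -scalemxAl mx_innerZr => h.
  rewrite -mulrA -ler_pdivrMl//; apply: (le_trans h).
  rewrite ler_wpM2r ?mx_inner_ge0//.
  have := op_norm_ge0 (n%:R^-1 *: M) => o0.
  rewrite -(sqr_sqrtr o0); apply: lerXn2r => //; rewrite nnegrE ?sqrtr_ge0//.
  exact: le_trans (sqrtr_ge0 _) Mv.
split=> u; apply: key.
- by rewrite linear_sum /=; apply: eq_bigr => i _; rewrite trmx_mul trmxK.
- by rewrite /design_constant le_max lexx.
- by rewrite linear_sum /=; apply: eq_bigr => i _; rewrite trmx_mul trmxK.
- by rewrite /design_constant le_max lexx orbT.
Qed.

Variables (n : nat) (Pi : 'M[R]_n).
Hypotheses (PiT : Pi^T = Pi) (Pi2 : Pi *m Pi = Pi).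

(** Chosen so that sum_k x_k [residual_design X k] = sum_i ((1 - Pi) x)_i X_i: the noise orthogonal
    to Pi is again a series in the independent variables x_k. *)
Definition residual_design m1 m2 (X : 'I_n -> 'M[R]_(m1, m2)) k :=
  \sum_i (1%:M - Pi) i k *: X i.

(** Stack the vectors X_i^T u as rows of Y. The two forms are the squared Frobenius norms of (1 -
    Pi) Y and of Y, and 1 - Pi is a contraction. *)
Lemma residual_design_quad m1 m2 (X : 'I_n -> 'M[R]_(m1, m2)) (u : 'cV_m1) :
  mx_inner u ((\sum_k residual_design X k *m (residual_design X k)^T) *m u) <=
  mx_inner u ((\sum_i X i *m (X i)^T) *m u).
Proof.
pose Y : 'M[R]_(n, m2) := \matrix_(i, j) ((X i)^T *m u) j 0.
have quadE (V : 'I_n -> 'M[R]_(m1, m2)) :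
    mx_inner u ((\sum_k V k *m (V k)^T) *m u) =
    \sum_k \sum_j (((V k)^T *m u) j 0) ^+ 2.
  rewrite mulmx_suml mx_inner_sumr; apply: eq_bigr => k _.
  rewrite -mulmxA -{1}[V k]trmxK -mx_inner_mull.
  by rewrite mx_innerE; apply: eq_bigr => j _; rewrite big_ord1 expr2.
have YE : mx_inner Y Y = \sum_k \sum_j (((X k)^T *m u) j 0) ^+ 2.
  by rewrite mx_innerE; do 2 (apply: eq_bigr => ? _); rewrite mxE expr2.
rewrite !quadE -YE.
have -> : \sum_k \sum_j (((residual_design X k)^T *m u) j 0) ^+ 2 =
    mx_inner ((1%:M - Pi) *m Y) ((1%:M - Pi) *m Y).
  rewrite mx_innerE; apply: eq_bigr => k _; apply: eq_bigr => j _.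
  rewrite -expr2; congr (_ ^+ 2).
  rewrite /residual_design linear_sum /= mulmx_suml summxE [RHS]mxE.
  apply: eq_bigr => i _; rewrite linearZ /= -scalemxAl mxE [Y _ _]mxE.
  congr (_ * _); rewrite !mxE; congr (_ - _); first by rewrite eq_sym.
  by rewrite -{1}PiT mxE.
rewrite mulmxBl mul1mx !(mx_innerBl, mx_innerBr).
have e : mx_inner (Pi *m Y) (Pi *m Y) = mx_inner Y (Pi *m Y).
  by rewrite mx_inner_mull PiT mulmxA Pi2.
rewrite (mx_innerC (Pi *m Y) Y) e.
have := mx_inner_ge0 (Pi *m Y); rewrite e; lra.
Qed.

Lemma residual_design_trmx m1 m2 (X : 'I_n -> 'M[R]_(m1, m2)) k :
  (residual_design X k)^T = residual_design (fun i => (X i)^T) k.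
Proof.
by rewrite /residual_design linear_sum /=; apply: eq_bigr => i _; rewrite linearZ.
Qed.

Definition fit m1 m2 (X : 'I_n -> 'M[R]_(m1, m2)) (U : 'M[R]_(m1, m2)) : 'cV[R]_n :=
  \col_i mx_inner (X i) U.

Lemma fit_sqnorm m1 m2 (X : 'I_n -> 'M[R]_(m1, m2)) U : (0 < n)%N ->
  mx_inner (fit X U) (fit X U) = n%:R * sqnorm_L2X X U.
Proof.
move=> n0; rewrite /sqnorm_L2X mulrA mulfV ?pnatr_eq0 -?lt0n// mul1r mx_innerE.
by apply: eq_bigr => i _; rewrite big_ord1 !mxE expr2.
Qed.

Lemma residual_noise m1 m2 (X : 'I_n -> 'M[R]_(m1, m2)) (x : 'cV_n) U :
  mx_inner (\sum_k x k 0 *: residual_design X k) U =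
  mx_inner x (fit X U) - mx_inner x (Pi *m fit X U).
Proof.
rewrite -mx_innerBr -[X in X - _]mul1mx -mulmxBl mx_inner_suml mx_innerE.
apply: eq_bigr => k _; rewrite big_ord1 mx_innerZl; congr (_ * _).
rewrite /residual_design mx_inner_suml [RHS]mxE; apply: eq_bigr => i _.
rewrite mx_innerZl [fit _ _ _ _]mxE; congr (_ * _); rewrite !mxE.
by congr (_ - _); [rewrite eq_sym|rewrite -{1}PiT mxE].
Qed.

End design.

(** * Compatibility factor and the deterministic oracle inequality *)

Section compat_upper_bound.
Variable R : realType.

(** Each sign is chosen against the sum already formed, which makes the new cross term
    nonpositive. *)
Lemma exists_signs n (I : eqType) (F : I -> 'cV[R]_n) (s : seq I) : uniq s ->
  exists e : I -> R, (forall j, e j ^+ 2 = 1) /\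
    mx_inner (\sum_(j <- s) e j *: F j) (\sum_(j <- s) e j *: F j) <=
    \sum_(j <- s) mx_inner (F j) (F j).
Proof.
elim: s => [_|x s IH /= /andP[xs us]].
  by exists (fun=> 1); rewrite !big_nil mx_inner0l expr1n.
have [e [e1 he]] := IH us; set S := \sum_(j <- s) e j *: F j in he.
pose c : R := if 0 <= mx_inner (F x) S then -1 else 1.
have c1 : c ^+ 2 = 1 by rewrite /c; case: ifP => _; rewrite ?sqrrN expr1n.
exists (fun j => if j == x then c else e j); split.
  by move=> j; case: ifP.
rewrite !big_cons eqxx.
have -> : \sum_(j <- s) (if j == x then c else e j) *: F j = S.
  apply: eq_big_seq => j js; case: eqP => // jx; move: xs.
  by rewrite -jx js.
rewrite mx_innerDl !mx_innerDr !mx_innerZl !mx_innerZr mulrA -expr2 c1 mul1r.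
rewrite (mx_innerC S (F x)).
have : c * mx_inner (F x) S <= 0.
  by rewrite /c; case: (lerP 0 (mx_inner (F x) S)) => h; lra.
lra.
Qed.

(* The columns of [A] are signed basis vectors, shifted cyclically: averaging
   over the shifts and choosing the signs greedily gives the bound. *)
Lemma exists_low_energy n m1 m2 k (X : 'I_n -> 'M[R]_(m1, m2)) (V : 'M[R]_(m1, k)) v :
  orthonormal V -> (0 < m2)%N -> (k <= m2)%N ->
  (forall u : 'cV_m1, mx_inner u ((\sum_i X i *m (X i)^T) *m u) <= v * mx_inner u u) ->
  exists A : 'M[R]_(m2, k), orthonormal A /\
    m2%:R * \sum_i mx_inner (X i) (V *m A^T) ^+ 2 <= k%:R * v.
Proof.
case: m2 X => // m X oV _ km hv.
pose f (j : 'I_k) (l : 'I_m.+1) : 'cV[R]_n := \col_i ((X i)^T *m V) l j.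
pose h (j : 'I_k) : 'I_m.+1 := widen_ord km j.
have hi : injective h by move=> a b /(congr1 val) /= /val_inj.
pose g c := \sum_j mx_inner (f j (h j + c)) (f j (h j + c)).
have gsum : \sum_c g c <= k%:R * v.
  rewrite /g exchange_big /= mulr_natl -[X in _ *+ X]card_ord -sumr_const.
  apply: ler_sum => j _.
  have -> : \sum_(c < m.+1) mx_inner (f j (h j + c)) (f j (h j + c)) =
      \sum_(l < m.+1) mx_inner (f j l) (f j l).
    by rewrite [RHS](reindex_inj (addrI (h j))).
  have := hv (col j V); rewrite orthonormal_col// mulr1; apply: le_trans.
  rewrite mulmx_suml mx_inner_sumr.
  have -> : \sum_(l < m.+1) mx_inner (f j l) (f j l) =
      \sum_(l < m.+1) \sum_i (((X i)^T *m V) l j) ^+ 2.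
    apply: eq_bigr => l _; rewrite mx_innerE; apply: eq_bigr => i _.
    by rewrite big_ord1 !mxE expr2.
  rewrite exchange_big /=; apply: ler_sum => i _.
  rewrite -mulmxA -[X in X *m (_ *m _)]trmxK -mx_inner_mull mx_innerE.
  apply: ler_sum => l _; rewrite big_ord1 -expr2 colE mulmxA -colE.
  by rewrite [in leRHS]mxE.
have [c hc] : exists c, m.+1%:R * g c <= k%:R * v.
  apply: contrapT => /forallNP hn; move: gsum; apply/negP; rewrite -ltNge.
  have : \sum_(c < m.+1) (k%:R * v) < \sum_(c < m.+1) (m.+1%:R * g c).
    apply: ltr_sum => [|c _]; last by rewrite ltNge; apply/negP/hn.
    by apply/hasP; exists ord0; rewrite // mem_index_enum.
  rewrite sumr_const card_ord -mulr_sumr -[ltLHS]mulr_natl.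
  by rewrite ltr_pM2l// ltr0n.
have [e [e1 he]] := exists_signs (fun j => f j (h j + c)) (index_enum_uniq 'I_k).
pose A : 'M[R]_(m.+1, k) := \matrix_(l, j) (e j * (l == h j + c)%:R).
exists A; split.
  apply/matrixP => i j; rewrite !mxE (bigD1 (h j + c))//= big1 ?addr0.
    rewrite !mxE eqxx mulr1 (inj_eq (addIr c)) (inj_eq hi) eq_sym.
    by case: eqP => [->|_]; rewrite ?mulr1 -?expr2 ?e1// mulr0 mul0r.
  by move=> l /negPf lj; rewrite !mxE lj !mulr0.
apply: le_trans hc; rewrite ler_pM2l ?ltr0n//; apply: le_trans he.
rewrite le_eqVlt; apply/orP; left; apply/eqP.
rewrite [RHS]mx_innerE; apply: eq_bigr => i _; rewrite big_ord1 -expr2; congr (_ ^+ 2).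
rewrite mx_innerC mx_inner_mull mx_innerE summxE; apply: eq_bigr => j _.
rewrite (bigD1 (h j + c))//= big1 ?addr0 => [|l /negPf lj].
  rewrite !mxE eqxx mulr1; congr (_ * _).
  by apply: eq_bigr => l _; rewrite !mxE mulrC.
by rewrite [A^T _ _]mxE [A _ _]mxE lj mulr0 mul0r.
Qed.

Lemma sub_proj_mul m k (V : 'M[R]_(m, k)) : orthonormal V ->
  (1%:M - V *m V^T) *m V = 0.
Proof. by move=> oV; rewrite mulmxBl mul1mx -mulmxA oV mulmx1 subrr. Qed.

Lemma mul_sub_proj m k (V : 'M[R]_(m, k)) : orthonormal V ->
  V^T *m (1%:M - V *m V^T) = 0.
Proof. by move=> oV; rewrite mulmxBr mulmx1 mulmxA oV mul1mx subrr. Qed.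

Lemma orthonormal_leq m k (V : 'M[R]_(m, k)) : orthonormal V -> (k <= m)%N.
Proof. exact: mulmx1_min. Qed.

Lemma orthonormal_cols_in m r (J : {set 'I_r}) (V : 'M[R]_(m, r)) :
  orthonormal V -> orthonormal (cols_in J V).
Proof.
move=> oV; apply/matrixP => i j; transitivity ((V^T *m V) (enum_val i) (enum_val j)).
  by rewrite !mxE; apply: eq_bigr => l _; rewrite !mxE.
by rewrite oV !mxE (inj_eq enum_val_inj).
Qed.

Section compat.
Variables (n m1 m2 : nat) (X : 'I_n -> 'M[R]_(m1, m2)).
Hypothesis svd : forall B : 'M[R]_(m1, m2), compact_svd B.
Hypotheses (n_gt0 : (0 < n)%N) (m1_gt0 : (0 < m1)%N) (m2_gt0 : (0 < m2)%N).
Variables (B : 'M[R]_(m1, m2)) (s : compact_svd B) (J : {set 'I_(\rank B)}).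
Hypothesis J_gt0 : (0 < #|J|)%N.
Let v := design_constant X.

(** V W^T is feasible because [projJc] kills it, and its nuclear norm is at least |J|; the ratio at
    this point is therefore at most 9 |J| q / (3 |J|)^2. *)
Lemma compat_factor_le_partial_isometry (V : 'M[R]_(m1, #|J|)) (W : 'M[R]_(m2, #|J|)) :
  orthonormal V -> orthonormal W -> projJc s J (V *m W^T) = 0 ->
  (compat_factor X s J 3 <= (sqnorm_L2X X (V *m W^T) / #|J|%:R)%:E)%E.
Proof.
move=> oV oW P0; have k0 : (0 : R) < #|J|%:R by rewrite ltr0n.
have nk := nuclear_norm_partial_isometry svd oV oW.
have n0 : nuclear_norm (0 : 'M[R]_(m1, m2)) = 0.
  apply/eqP; rewrite eq_le (nuclear_norm_ge0 svd) andbT.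
  by rewrite (nuclear_norm_le svd)// => Y _; rewrite mx_inner0r.
set q := sqnorm_L2X X (V *m W^T).
have q0 : 0 <= q.
  by rewrite mulr_ge0 ?invr_ge0 ?ler0n// sumr_ge0// => i _; rewrite sqr_ge0.
pose N := nuclear_norm (V *m W^T).
have perp : projJc_perp s J (V *m W^T) = V *m W^T by rewrite /projJc_perp P0 subr0.
apply: (@le_trans _ _ (3 ^+ 2 * #|J|%:R * q / (3 * N - 0) ^+ 2)%:E).
  apply: ereal_inf_lbound; exists (V *m W^T); rewrite /= perp P0 n0//.
  by rewrite mulr_gt0// (lt_le_trans k0).
have N0 : 0 < N by exact: lt_le_trans nk.
rewrite lee_fin subr0 ler_pdivrMr ?exprn_gt0 ?mulr_gt0//.
have kN : #|J|%:R ^+ 2 <= N ^+ 2 by rewrite lerXn2r// nnegrE ltW.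
have -> : q / #|J|%:R * (3 * N) ^+ 2 =
    3 ^+ 2 * #|J|%:R * q + 9 * (q / #|J|%:R) * (N ^+ 2 - #|J|%:R ^+ 2).
  by field; rewrite gt_eqF.
by rewrite lerDl mulr_ge0 ?subr_ge0// mulr_ge0// divr_ge0// ltW.
Qed.

(* This is what makes [lam ^+ 2 * |J| / kappa] dominate the noise level
   [sigma ^+ 2 * |J| * (m1 + m2) / n] of the directions in the range of
   [projJc_perp]. *)
Lemma compat_factor_le :
  (compat_factor X s J 3 <= (v ^+ 2 / (maxn m1 m2)%:R)%:E)%E.
Proof.
have k0 : (0 : R) < #|J|%:R by rewrite ltr0n.
have nR : (0 : R) < n%:R by rewrite ltr0n.
have o1 := orthonormal_cols_in J (svdV1_orthonormal s).
have o2 := orthonormal_cols_in J (svdV2_orthonormal s).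
have [q1 q2] := design_quad X n_gt0.
have bound m (S : R) : (0 < m)%N -> m%:R * (n%:R * S) <= #|J|%:R * (n%:R * v ^+ 2) ->
    S / #|J|%:R <= v ^+ 2 / m%:R.
  move=> m0 h; have mR : (0 : R) < m%:R by rewrite ltr0n.
  rewrite ler_pdivrMr// mulrAC ler_pdivlMr// -(ler_pM2l nR); lra.
have sE U : n%:R * sqnorm_L2X X U = \sum_i mx_inner (X i) U ^+ 2.
  by rewrite /sqnorm_L2X mulrA mulfV ?mul1r// gt_eqF.
(* The free factor is taken on the larger side, where averaging over shifts gains the most. The
   other factor is the block of singular vectors indexed by J, which makes [projJc] vanish. *)
have [m12|m21] := leqP m1 m2.
  have [A [oA hA]] := exists_low_energy o1 m2_gt0 (orthonormal_leq o2) q1.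
  apply: (le_trans (compat_factor_le_partial_isometry o1 oA _)).
    by rewrite /projJc [in X in X *m _]mulmxA sub_proj_mul// !mul0mx.
  by rewrite lee_fin; apply: bound => //; rewrite sE.
have q2' (u : 'cV_m2) : mx_inner u ((\sum_i (X i)^T *m ((X i)^T)^T) *m u) <=
    n%:R * v ^+ 2 * mx_inner u u.
  by under eq_bigr do rewrite trmxK; exact: q2.
have [A [oA hA]] := exists_low_energy o2 m1_gt0 (orthonormal_leq o1) q2'.
apply: (le_trans (compat_factor_le_partial_isometry oA o2 _)).
  by rewrite /projJc -mulmxA -[_ *m _^T *m _]mulmxA mul_sub_proj// !mulmx0.
rewrite lee_fin; apply: bound => //; rewrite sE.
by under eq_bigr do rewrite -mx_inner_trmx trmx_mul trmxK.
Qed.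
End compat.
End compat_upper_bound.

(** * Projections along singular vectors and the oracle inequality *)

Section oracle.
Variable R : realType.

Lemma mx_inner_mxvec m n (A B : 'M[R]_(m, n)) :
  mx_inner (mxvec A) (mxvec B) = mx_inner A B.
Proof.
rewrite !mx_innerE big_ord1 pair_bigA /= (reindex _ (curry_mxvec_bij _ _)) /=.
by apply: eq_bigr => -[i j] _ /=; rewrite !mxvecE.
Qed.

Lemma mulmx_width0 m k n (A : 'M[R]_(m, k)) (B : 'M[R]_(k, n)) : k = 0%N ->
  A *m B = 0.
Proof. by move=> k0; subst k; rewrite (flatmx0 B) mulmx0. Qed.

Section projection.
Variables (m1 m2 : nat).
Hypothesis svd : forall B : 'M[R]_(m1, m2), compact_svd B.
Variables (Bb : 'M[R]_(m1, m2)) (s : compact_svd Bb) (J : {set 'I_(\rank Bb)}).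
Let V1 := cols_in J (svdV1 s).
Let V2 := cols_in J (svdV2 s).
Let o1 : orthonormal V1. Proof. exact: orthonormal_cols_in (svdV1_orthonormal s). Qed.
Let o2 : orthonormal V2. Proof. exact: orthonormal_cols_in (svdV2_orthonormal s). Qed.

Let dJ : 'rV[R]_#|J| := \row_j svdS s 0 (enum_val j).

Lemma tr_cols_in_mul m (V : 'M[R]_(m, \rank Bb)) k (W : 'M[R]_(\rank Bb, k)) :
  orthonormal V -> (cols_in J V)^T *m (V *m W) = rowsub (@enum_val _ (mem J)) W.
Proof.
move=> oV; rewrite mulmxA; apply/matrixP => i j; rewrite [RHS]mxE -[W in RHS]mul1mx -oV.
by rewrite !mxE; apply: eq_bigr => l _; congr (_ * _); rewrite !mxE;
  apply: eq_bigr => h _; rewrite !mxE.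
Qed.

Lemma tr_cols_in_svd : V1^T *m Bb = diag_mx dJ *m V2^T.
Proof.
have -> : V1^T *m Bb = V1^T *m (svdV1 s *m (diag_mx (svdS s) *m (svdV2 s)^T)).
  by congr (_ *m _); rewrite mulmxA; exact: svdE.
rewrite (tr_cols_in_mul _ (svdV1_orthonormal s)); apply/matrixP => i j.
by rewrite mul_diag_mx [LHS]mxE mul_diag_mx !mxE.
Qed.

Lemma mul_cols_in_svd : Bb *m V2 = V1 *m diag_mx dJ.
Proof.
apply: trmx_inj; rewrite trmx_mul.
have -> : Bb^T = svdV2 s *m (diag_mx (svdS s) *m (svdV1 s)^T).
  by apply: trmx_inj; rewrite trmxK !trmx_mul trmxK tr_diag_mx; exact: svdE.
rewrite (tr_cols_in_mul _ (svdV2_orthonormal s)) trmx_mul tr_diag_mx; apply/matrixP => i j.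
by rewrite [LHS]mxE !mul_diag_mx !mxE.
Qed.

(** The columns in J are singular vectors, so the left, right and two-sided corrections all equal V1
    diag V2^T, and the projection removes exactly those singular triples. *)
Lemma projJc_svd : projJc s J Bb = Bb - V1 *m diag_mx dJ *m V2^T.
Proof.
rewrite /projJc -/V1 -/V2 mulmxBl mul1mx. rewrite -[V1 *m _ *m Bb]mulmxA tr_cols_in_svd.
rewrite mulmxBr mulmx1 mulmxBl [Bb *m _]mulmxA mul_cols_in_svd !mulmxA.
rewrite -[_ *m V2^T *m V2]mulmxA o2 mulmx1. by rewrite subrr subr0.
Qed.

Lemma tr_mul_projJc U : V1^T *m projJc s J U = 0.
Proof. by rewrite /projJc !mulmxA mul_sub_proj// !mul0mx. Qed.

Lemma projJc_mul U : projJc s J U *m V2 = 0.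
Proof. by rewrite /projJc -!mulmxA sub_proj_mul// !mulmx0. Qed.

Lemma projJc_perpE U :
  projJc_perp s J U = V1 *m (V1^T *m U) + ((1%:M - V1 *m V1^T) *m U *m V2) *m V2^T.
Proof.
rewrite /projJc_perp /projJc -/V1 -/V2 mulmxBr mulmx1 -!mulmxA.
by rewrite opprB addrCA addrC !mulmxBl mul1mx !mulmxA subKr.
Qed.

(* The triangle inequality combined with the additivity of the nuclear norm on
   the orthogonal pieces [V1 diag V2^T] and [projJc D]. *)
Lemma nuclear_norm_decrease B :
  nuclear_norm Bb - nuclear_norm B <= 2 * nuclear_norm (projJc s J Bb) +
    nuclear_norm (projJc_perp s J (Bb - B)) - nuclear_norm (projJc s J (Bb - B)).
Proof.
set D := Bb - B; set BJ := V1 *m diag_mx dJ *m V2^T.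
have BbE : Bb = BJ + projJc s J Bb by rewrite projJc_svd addrC subrK.
have h1 : mx_inner (V1 *m V2^T) BJ + nuclear_norm (projJc s J D) <=
    nuclear_norm (BJ - projJc s J D).
  rewrite -(nuclear_normN (projJc s J D)); apply: nuclear_norm_add_orth => //.
  - by rewrite mulmxN tr_mul_projJc oppr0.
  - by rewrite mulNmx projJc_mul oppr0.
have h2 : nuclear_norm BJ <= mx_inner (V1 *m V2^T) BJ.
  by apply: nuclear_norm_diag_le => // i; rewrite mxE ltW// svdS_gt0.
have h3 := nuclear_norm_triangle svd BJ (projJc s J Bb).
rewrite -BbE in h3.
have e : BJ - projJc s J D = B - projJc s J Bb + projJc_perp s J D.
  have -> : BJ = Bb - projJc s J Bb by apply/eqP; rewrite eq_sym subr_eq -BbE.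
  rewrite /projJc_perp addrA; congr (_ - _).
  by rewrite [RHS]addrAC; congr (_ - _); rewrite /D addrC subrK.
have h4 := nuclear_norm_triangle svd (B - projJc s J Bb) (projJc_perp s J D).
have h5 := nuclear_norm_triangle svd B (- projJc s J Bb).
rewrite nuclear_normN in h5; rewrite -e in h4.
move: h1 h2 h3 h4 h5; rewrite -/BJ.
move: (nuclear_norm BJ) (nuclear_norm (BJ - _)) (nuclear_norm (B - _)) (nuclear_norm B).
move: (nuclear_norm Bb) (nuclear_norm (projJc s J Bb)) (nuclear_norm (projJc s J D)).
by move: (nuclear_norm (projJc_perp s J D)) (mx_inner _ _) => *; lra.
Qed.

Variables (n : nat) (X : 'I_n -> 'M[R]_(m1, m2)).
Hypotheses (n_gt0 : (0 < n)%N) (m1_gt0 : (0 < m1)%N) (m2_gt0 : (0 < m2)%N).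

Lemma fitD U V : fit X (U + V) = fit X U + fit X V.
Proof. by apply/colP => i; rewrite !mxE mx_innerDr. Qed.

Lemma fit_mxvec a b (G : 'I_n -> 'M[R]_(a, b)) U Y :
  (forall i, mx_inner (X i) U = mx_inner (G i) Y) ->
  fit X U = (\matrix_(i, j) mxvec (G i) 0 j) *m (mxvec Y)^T.
Proof.
move=> h; apply/colP => i; rewrite !mxE h -mx_inner_mxvec mx_innerE big_ord1.
by apply: eq_bigr => j _; rewrite !mxE.
Qed.

(* The range of [projJc_perp] is spanned by [V1 *m Y1] and [Y2 *m V2^T], a space
   of dimension at most [#|J| * (m1 + m2)]. *)
Lemma fit_projection : exists Pi : 'M[R]_n, [/\ Pi^T = Pi, Pi *m Pi = Pi,
  \tr Pi <= 2 * (#|J| * maxn m1 m2)%:R &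
  forall U, Pi *m fit X (projJc_perp s J U) = fit X (projJc_perp s J U)].
Proof.
pose F1 : 'M[R]_(n, _) := \matrix_(i, j) mxvec (V1^T *m X i) 0 j.
pose F2 : 'M[R]_(n, _) := \matrix_(i, j) mxvec (X i *m V2) 0 j.
have [Pi [PiT Pi2 PiF trPi]] := orthogonal_projection (row_mx F1 F2).
exists Pi; split => //.
  apply: (le_trans trPi); rewrite -natrM ler_nat.
  have := leq_maxl m1 m2; have := leq_maxr m1 m2; set M := maxn _ _ => h1 h2.
  rewrite mulnA (mulnC 2 #|J|) -mulnA (mulnC m1) -mulnDr leq_mul2l; apply/orP; right.
  by rewrite mul2n -addnn leq_add.
have [P1 P2] : Pi *m F1 = F1 /\ Pi *m F2 = F2.
  by move: PiF; rewrite mul_mx_row => /eq_row_mx.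
move=> U; rewrite projJc_perpE fitD mulmxDr.
have inn1 Y i : mx_inner (X i) (V1 *m Y) = mx_inner (V1^T *m X i) Y.
  by rewrite mx_innerC mx_inner_mull mx_innerC.
have inn2 Y i : mx_inner (X i) (Y *m V2^T) = mx_inner (X i *m V2) Y.
  by rewrite mx_inner_mulr.
congr (_ + _).
  by rewrite (fit_mxvec (inn1 _)) mulmxA P1.
by rewrite (fit_mxvec (inn2 _)) mulmxA P2.
Qed.

Lemma sqnorm_ge0 U : 0 <= sqnorm_L2X X U.
Proof.
by rewrite mulr_ge0 ?invr_ge0 ?ler0n// sumr_ge0// => i _; rewrite sqr_ge0.
Qed.

Lemma compat_factor_ge0 c : (0 <= compat_factor X s J c)%E.
Proof.
apply: le_ereal_inf_tmp => _ [U _ <-]; rewrite lee_fin.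
by rewrite divr_ge0 ?sqr_ge0// mulr_ge0 ?sqnorm_ge0// mulr_ge0 ?sqr_ge0.
Qed.

(** The cone condition excludes empty J, for which [projJc_perp] is 0, and the finite ratio [rho]
    excludes kappa = 0. What remains is the definition of the infimum at U, cleared of
    denominators. *)
Lemma card_over_compat_bound rho U : card_over_compat X s J 3 = rho%:E ->
  nuclear_norm (projJc s J U) < 3 * nuclear_norm (projJc_perp s J U) ->
  (3 * nuclear_norm (projJc_perp s J U) - nuclear_norm (projJc s J U)) ^+ 2 <=
  9 * (rho * sqnorm_L2X X U).
Proof.
set a := nuclear_norm (projJc_perp s J U); set b := nuclear_norm (projJc s J U).
move=> hrho hU; have e0 : 0 < (3 * a - b) ^+ 2 by rewrite exprn_gt0// subr_gt0.
have : (compat_factor X s J 3 <=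
    (3 ^+ 2 * #|J|%:R * sqnorm_L2X X U / (3 * a - b) ^+ 2)%:E)%E.
  by apply: ereal_inf_lbound; exists U.
have J0 : #|J| != 0%N.
  apply/eqP => J0; move: hU; rewrite ltNge => /negP; apply.
  rewrite /a; suff -> : projJc_perp s J U = 0.
    by apply: (@le_trans _ _ 0); rewrite ?nuclear_norm_ge0// mulr_ge0_le0//
      (nuclear_norm_le svd)// => W _; rewrite mx_inner0r.
  rewrite projJc_perpE.
  by rewrite [V1 *m _]mulmx_width0// [X in _ + X]mulmx_width0// addr0.
have := compat_factor_ge0 3; move: hrho; rewrite /card_over_compat.
case: (compat_factor X s J 3) => [k| |]//=; rewrite !lee_fin => hrho k0 hk.
have k_gt0 : 0 < k.
  rewrite lt_neqAle k0 andbT; apply/eqP => k00; move: hrho.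
  by rewrite -k00 inve0 gt0_muley// lte_fin ltr0n lt0n.
move: hrho; rewrite inver gt_eqF// -EFinM => -[<-].
rewrite ler_pdivlMr// in hk.
rewrite -(ler_pM2l k_gt0); apply: (le_trans hk).
by rewrite le_eqVlt; apply/orP; left; apply/eqP; field; rewrite gt_eqF.
Qed.

Lemma card_over_compat_ge rho : card_over_compat X s J 3 = rho%:E ->
  0 <= rho /\ (#|J| * maxn m1 m2)%:R <= rho * design_constant X ^+ 2.
Proof.
have [J0 h|J0] := posnP #|J|.
  rewrite J0 mul0n; have -> : rho = 0.
    by move: h; rewrite /card_over_compat J0 mul0e => -[].
  by rewrite mul0r.
have M0 : (0 : R) < (maxn m1 m2)%:R by rewrite ltr0n leq_max m1_gt0.
have := compat_factor_le X svd n_gt0 m1_gt0 m2_gt0 s J0.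
have := compat_factor_ge0 3; rewrite /card_over_compat.
case: (compat_factor X s J 3) => [k| |]//=; rewrite !lee_fin => k0 hk hrho.
have k_gt0 : 0 < k.
  rewrite lt_neqAle k0 andbT; apply/eqP => k00; move: hrho.
  by rewrite -k00 inve0 gt0_muley// lte_fin ltr0n.
move: hrho; rewrite inver gt_eqF// -EFinM => -[<-].
split; first by rewrite divr_ge0.
rewrite mulrAC ler_pdivlMr// natrM -mulrA ler_wpM2l//.
by rewrite mulrC -ler_pdivlMr.
Qed.

Variables (Bstar : 'M[R]_(m1, m2)) (x : 'cV[R]_n) (y : 'I_n -> R) (lam rho : R).
Hypotheses (yE : forall i, y i = mx_inner (X i) Bstar + x i 0) (lam_gt0 : 0 < lam).
Hypothesis rhoE : card_over_compat X s J 3 = rho%:E.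
Variable Pi : 'M[R]_n.
Hypotheses (PiT : Pi^T = Pi) (Pi2 : Pi *m Pi = Pi).
Hypothesis Pi_fit : forall U,
  Pi *m fit X (projJc_perp s J U) = fit X (projJc_perp s J U).
Hypothesis noise_res :
  op_le (n%:R * (2 / 3 * lam)) (\sum_k x k 0 *: residual_design Pi X k).
Hypothesis noise_proj : mx_inner x (Pi *m x) <= 4 / 25 * lam ^+ 2 * rho * n%:R.

(** The residual noise is orthogonal to [fit X (projJc_perp s J D)], which Pi fixes, so it pairs
    with [projJc s J D] only. The rest is <Pi x, fit D>, bounded by Cauchy-Schwarz; 2/5 is the
    square root of the 4/25 in [noise_proj]. *)
Lemma noise_le D : `|mx_inner x (fit X D)| <= n%:R *
  (2 / 3 * lam * nuclear_norm (projJc s J D) +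
   2 / 5 * lam * (Num.sqrt rho * Num.sqrt (sqnorm_L2X X D))).
Proof.
have [rho0 _] := card_over_compat_ge rhoE.
have nR : (0 : R) < n%:R by rewrite ltr0n.
have fE : fit X D = fit X (projJc s J D) + fit X (projJc_perp s J D).
  by rewrite -fitD /projJc_perp addrC subrK.
have -> : mx_inner x (fit X D) =
    mx_inner (\sum_k x k 0 *: residual_design Pi X k) (projJc s J D) +
    mx_inner (Pi *m x) (fit X D).
  rewrite residual_noise// mx_inner_mull PiT fE mulmxDr Pi_fit !mx_innerDr; ring.
rewrite mulrDr; apply: (le_trans (ler_normD _ _)); apply: lerD.
  by rewrite mulrA; exact: nuclear_norm_dual_norm.
set r := Num.sqrt rho; set q := Num.sqrt (sqnorm_L2X X D).
have r0 : 0 <= r := sqrtr_ge0 _; have q0 : 0 <= q := sqrtr_ge0 _.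
have r2 : r ^+ 2 = rho := sqr_sqrtr rho0.
have q2 : q ^+ 2 = sqnorm_L2X X D := sqr_sqrtr (sqnorm_ge0 D).
have t0 : 0 <= n%:R * (2 / 5 * lam * (r * q)).
  by rewrite !mulr_ge0// ltW.
rewrite -(ler_pXn2r (n := 2))// ?nnegrE// real_normK ?num_real//.
apply: (le_trans (mx_inner_cs _ _)).
rewrite mx_inner_mull PiT mulmxA Pi2 fit_sqnorm// -q2.
have -> : (n%:R * (2 / 5 * lam * (r * q))) ^+ 2 =
    (4 / 25 * lam ^+ 2 * r ^+ 2 * n%:R) * (n%:R * q ^+ 2) by field.
by rewrite r2 ler_wpM2r// mulr_ge0// sqr_ge0.
Qed.

Lemma loss_le B : prediction_loss X B Bstar <=
  prediction_loss X Bb Bstar + 4 * lam * nuclear_norm (projJc s J Bb) +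
  9 * lam ^+ 2 / 4 * rho +
  2 * (potential X y lam B - potential X y lam Bb + 4 / 9 * sqnorm_L2X X (Bb - B)).
Proof.
have [rho0 _] := card_over_compat_ge rhoE.
have nR : (0 : R) < n%:R by rewrite ltr0n.
set D := Bb - B.
(* An exact identity, so no curvature is lost in passing between loss and potential. *)
have lossE : 2 * (potential X y lam B - potential X y lam Bb) =
    prediction_loss X B Bstar - prediction_loss X Bb Bstar +
    2 / n%:R * mx_inner x (fit X D) + 2 * lam * (nuclear_norm B - nuclear_norm Bb).
  rewrite /potential /prediction_loss /sqnorm_L2X.
  have -> : mx_inner x (fit X D) = \sum_i x i 0 * mx_inner (X i) D.
    by rewrite mx_innerE; apply: eq_bigr => i _; rewrite big_ord1 [fit _ _ _ _]mxE.
  set SB := \sum_i (y i - mx_inner (X i) B) ^+ 2.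
  set Sb := \sum_i (y i - mx_inner (X i) Bb) ^+ 2.
  have : SB - Sb = \sum_i mx_inner (X i) (B - Bstar) ^+ 2 -
      \sum_i mx_inner (X i) (Bb - Bstar) ^+ 2 + 2 * \sum_i x i 0 * mx_inner (X i) D.
    rewrite mulr_sumr -!sumrB -big_split /=; apply: eq_bigr => i _.
    by rewrite yE /D !mx_innerBr; ring.
  set U1 := \sum_i _; set U2 := \sum_i _; set U3 := \sum_i _ => e.
  have -> : SB = U1 - U2 + 2 * U3 + Sb by lra.
  by field; rewrite gt_eqF.
have hN := nuclear_norm_decrease B; rewrite -/D in hN.
have := noise_le D.
set a := nuclear_norm (projJc_perp s J D) in hN *.
set b := nuclear_norm (projJc s J D) in hN *.
set r := Num.sqrt rho; set q := Num.sqrt (sqnorm_L2X X D) => hnoise.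
have r0 : 0 <= r := sqrtr_ge0 _; have q0 : 0 <= q := sqrtr_ge0 _.
have r2 : r ^+ 2 = rho := sqr_sqrtr rho0.
have q2 : q ^+ 2 = sqnorm_L2X X D := sqr_sqrtr (sqnorm_ge0 D).
(* Valid for every D: outside the cone the left side is nonpositive. *)
have hc : 3 * a - b <= 3 * (r * q).
  have [ab|ab] := ltP b (3 * a); last first.
    by apply: (@le_trans _ _ 0); [lra|rewrite !mulr_ge0].
  have := card_over_compat_bound rhoE ab; rewrite -/a -/b -r2 -q2 => h.
  rewrite -(ler_pXn2r (n := 2))// ?nnegrE ?subr_ge0 ?(ltW ab)// ?mulr_ge0//.
  by apply: (le_trans h); lra.
set G := mx_inner x (fit X D) / n%:R.
have hG : - G <= 2 / 3 * lam * b + 2 / 5 * lam * (r * q).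
  rewrite /G -mulNr ler_pdivrMr// mulrC; apply: le_trans hnoise.
  by rewrite -normrN ler_norm.
have hN' : lam * (nuclear_norm Bb - nuclear_norm B) <=
  lam * (2 * nuclear_norm (projJc s J Bb) + a - b) by rewrite ler_wpM2l// ltW.
have hc' : lam * (3 * a - b) <= lam * (3 * (r * q)) by rewrite ler_wpM2l// ltW.
rewrite mulrDr lossE -q2 -r2 -[2 / n%:R * _]mulrA [n%:R^-1 * _]mulrC -/G.
(* [9 / 4 t^2 - 14 / 5 t q + 8 / 9 q^2 >= 0], with [t = lam * r]. *)
have sq1 := sqr_ge0 (3 / 2 * (lam * r) - 14 / 15 * q); have sq2 := sqr_ge0 q.
lra.
Qed.

End projection.
End oracle.

(** * The pseudo-posterior *)

Section measurability.
Variable R : realType.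

Section nuclear_norm.
Variables m n : nat.
Hypothesis svd : forall B : 'M[R]_(m, n), compact_svd B.

Let c (E : 'M[R]_(m, n)) :=
  \sum_i \sum_j `|E i j| * nuclear_norm (delta_mx i j : 'M[R]_(m, n)).

Let nuclear_norm_le_entries E : nuclear_norm E <= c E.
Proof.
have nsum I (s : seq I) (F : I -> 'M[R]_(m, n)) :
    nuclear_norm (\sum_(i <- s) F i) <= \sum_(i <- s) nuclear_norm (F i).
  elim: s => [|a s IH]; rewrite ?big_nil ?big_cons.
    by rewrite (nuclear_norm_le svd)// => W _; rewrite mx_inner0r.
  by apply: (le_trans (nuclear_norm_triangle svd _ _)); rewrite lerD2l.
rewrite {1}(matrix_sum_delta E); apply: (le_trans (nsum _ _ _)).
apply: ler_sum => i _; apply: (le_trans (nsum _ _ _)).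
apply: ler_sum => j _; have [e0|e0] := leP 0 (E i j).
  by rewrite ger0_norm// nuclear_normZ_le.
by rewrite ltr0_norm// -nuclear_normN -scaleNr nuclear_normZ_le// oppr_ge0 ltW.
Qed.

Let ratm (q : 'M[rat]_(m, n)) : 'M[R]_(m, n) := map_mx ratr q.

Let rat_approx (E : 'M[R]_(m, n)) e : 0 < e -> exists q, c (E - ratm q) < e.
Proof.
move=> e0.
pose K := \sum_i \sum_j nuclear_norm (delta_mx i j : 'M[R]_(m, n)).
have K0 : 0 <= K by do 2 (apply: sumr_ge0 => ? _); exact: nuclear_norm_ge0.
have K1 : 0 < K + 1 by rewrite ltr_wpDl.
pose d := e / (K + 1); have d0 : 0 < d by rewrite divr_gt0.
have rE i j : exists r : rat, `|E i j - ratr r| < d.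
  have /rat_in_itvoo[r] : E i j - d < E i j + d by lra.
  by rewrite in_itv /= => /andP[r1 r2]; exists r; rewrite ltr_norml; apply/andP; split; lra.
pose q : 'M[rat]_(m, n) := \matrix_(i, j) sval (cid (rE i j)).
exists q; apply: (@le_lt_trans _ _ (d * K)).
  rewrite /c mulr_sumr; apply: ler_sum => i _; rewrite mulr_sumr; apply: ler_sum => j _.
  rewrite ler_wpM2r ?nuclear_norm_ge0// !mxE; case: cid => r /= rd; exact: ltW.
by rewrite /d mulrAC ltr_pdivrMr// ltr_pM2l// ltrDl.
Qed.

(** The nuclear norm is continuous for the entrywise bound [c]. Each open sublevel set is thus a
    countable union, over rational matrices q, of sets described by the entries alone. *)
Lemma measurable_nuclear_norm : measurable_fun setT (@nuclear_norm R m n).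
Proof.
apply: (measurability (@RGenInftyO.G R)) => [|_ [_ [a ->] <-]].
  exact: RGenInftyO.measurableE.
rewrite setTI.
have -> : @nuclear_norm R m n @^-1` `]-oo, a[%classic =
    \bigcup_q [set B | nuclear_norm (ratm q) + c (B - ratm q) < a].
  apply/seteqP; split => B; rewrite /= in_itv /=.
    (* The gap is halved because the distance to q is paid twice: once as [c (B - ratm q)] and once
       in comparing the norms of q and B. *)
    move=> Ba; have /(rat_approx B)[q hq] : 0 < (a - nuclear_norm B) / 2.
      by rewrite divr_gt0// subr_gt0.
    exists q => //=; have := nuclear_norm_triangle svd B (ratm q - B).
    have := nuclear_norm_le_entries (B - ratm q).
    rewrite -(nuclear_normN (ratm q - B)) opprB addrCA subrr addr0; lra.
  move=> [q _ /=]; apply: le_lt_trans.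
  have := nuclear_norm_triangle svd (ratm q) (B - ratm q).
  have := nuclear_norm_le_entries (B - ratm q).
  rewrite addrCA subrr addr0; lra.
apply: countable_bigcupT_measurable => [|q]; first exact: countableP.
have mc : measurable_fun setT
    (fun B : 'M[R]_(m, n) => nuclear_norm (ratm q) + c (B - ratm q)).
  apply: measurable_funD => //; apply: measurable_sum => i; apply: measurable_sum => j.
  apply: measurable_funM => //; apply: measurableT_comp => //=.
  under eq_fun do rewrite !mxE; apply: measurable_funB => //.
  exact: measurable_mx_entry.
rewrite -[X in measurable X]setTI.
have := mc measurableT _ (measurable_itv `]-oo, a[).
by congr (measurable (_ `&` _)); apply/seteqP; split => B; rewrite /= in_itv.
Qed.

End nuclear_norm.

Section posterior.
Variables (n m1 m2 : nat) (X : 'I_n -> 'M[R]_(m1, m2)).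
Hypothesis svd : forall B : 'M[R]_(m1, m2), compact_svd B.

Lemma measurable_mx_inner A : measurable_fun setT (fun B : 'M[R]_(m1, m2) => mx_inner A B).
Proof.
under eq_fun do rewrite mx_innerE.
apply: measurable_sum => i; apply: measurable_sum => j.
by apply: measurable_funM => //; exact: measurable_mx_entry.
Qed.

Lemma measurable_prediction_loss B' :
  measurable_fun setT (fun B => prediction_loss X B B').
Proof.
apply: measurable_funM => //; apply: measurable_sum => i; apply: measurable_funX => //.
under eq_fun do rewrite mx_innerBr; apply: measurable_funB => //.
exact: measurable_mx_inner.
Qed.

Lemma measurable_loss_ball B' K :
  measurable [set B | ((prediction_loss X B B')%:E <= K)%E].
Proof.
rewrite -[X in measurable X]setTI; apply: emeasurable_fun_infty_c => //.
by apply/measurable_EFinP; exact: measurable_prediction_loss.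
Qed.

Lemma measurable_potential y lam : measurable_fun setT (potential X y lam).
Proof.
apply: measurable_funD; apply: measurable_funM => //.
  apply: measurable_sum => i; apply: measurable_funX.
  by apply: measurable_funB => //; exact: measurable_mx_inner.
exact: measurable_nuclear_norm.
Qed.

Variables (d : measure_display) (T : measurableType d) (y : 'I_n -> T -> R).
Hypothesis my : forall i, measurable_fun setT (y i).

Lemma measurable_posterior_mass lam tau A : measurable A ->
  measurable_fun setT (fun w => (\int[@lebesgue_mx R m1 m2]_(B in A)
    (expR (- potential X (fun i => y i w) lam B / tau))%:E)%E).
Proof.
move=> mA.
pose f (z : T * 'M[R]_(m1, m2)) :=
  (expR (- potential X (fun i => y i z.1) lam z.2 / tau))%:E.
have mf : measurable_fun setT f.
  apply/measurable_EFinP/measurableT_comp => //.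
  apply: measurable_funM => //; apply: measurable_funN.
  apply: measurable_funD; apply: measurable_funM => //.
    apply: measurable_sum => i; apply: measurable_funX; apply: measurable_funB.
      exact: measurableT_comp.
    exact: (measurableT_comp (measurable_mx_inner (X i))).
  exact: (measurableT_comp (measurable_nuclear_norm svd)).
pose g := f \_ (setT `*` A).
have mg : measurable_fun setT g.
  by apply/(measurable_restrictT f) => //; [exact: measurableX|exact: measurable_funTS].
have g0 z : (0 <= g z)%E by rewrite /g patchE; case: ifP => // _; rewrite lee_fin expR_ge0.
have := measurable_fun_fubini_tonelli_F g mg g0; move=> /(_ (@lebesgue_mx R m1 m2)).
congr (measurable_fun _ _); apply/funext => w; rewrite /fubini_F [RHS]integral_mkcond.
apply: eq_integral => B _; rewrite /g /= !patchE; congr (if _ then _ else _).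
by rewrite in_setX in_setT.
Qed.

(** Since the normalizer lies strictly between 0 and +oo, the ratio can be cleared, and Tonelli
    makes both integrals measurable in the noise. *)
Lemma measurable_posterior_event lam tau A c : measurable A ->
  (forall w, 0 < \int[@lebesgue_mx R m1 m2]_B
    (expR (- potential X (fun i => y i w) lam B / tau))%:E < +oo)%E ->
  measurable [set w |
    (c%:E < pseudo_posterior X (fun i => y i w) lam tau A)%E].
Proof.
move=> mA hden; set num := fun w => (\int[@lebesgue_mx R m1 m2]_(B in A)
    (expR (- potential X (fun i => y i w) lam B / tau))%:E)%E.
pose den := fun w => (\int[@lebesgue_mx R m1 m2]_B
    (expR (- potential X (fun i => y i w) lam B / tau))%:E)%E.
have -> : [set w | (c%:E < pseudo_posterior X (fun i => y i w) lam tau A)%E] =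
    setT `&` [set w | (c%:E * den w < num w)%E].
  rewrite setTI; apply/funext => w /=; rewrite /pseudo_posterior -/(num w) -/(den w).
  have /andP[] := hden w; rewrite -/(den w).
  case: (den w) => [r| |]//; rewrite lte_fin => r0 _.
  by rewrite inver gt_eqF// lte_pdivlMr.
apply: measurable_lte => //; first apply: measurable_funeM.
  exact: measurable_posterior_mass.
exact: measurable_posterior_mass.
Qed.

End posterior.
End measurability.

(** * Concentration of the pseudo-posterior *)

Section posterior_concentration.
Variables (R : realType) (n m1 m2 : nat) (X : 'I_n -> 'M[R]_(m1, m2)).
Hypothesis svd : forall B : 'M[R]_(m1, m2), compact_svd B.
Hypotheses (n_gt0 : (0 < n)%N) (m1_gt0 : (0 < m1)%N) (m2_gt0 : (0 < m2)%N).
Variables (y : 'I_n -> R) (lam tau : R).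
Hypotheses (lam_gt0 : 0 < lam) (tau_gt0 : 0 < tau).
Local Notation leb := (@lebesgue_mx R m1 m2).

(** The quadratic part satisfies an exact identity, which produces the curvature term; the nuclear
    norm contributes plain convexity only. *)
Lemma potential_convex a B Bb : 0 <= a -> a <= 1 ->
  potential X y lam ((1 - a) *: B + a *: Bb) <=
  (1 - a) * potential X y lam B + a * potential X y lam Bb
    - a * (1 - a) / 2 * sqnorm_L2X X (Bb - B).
Proof.
move=> a0 a1; rewrite /potential /sqnorm_L2X.
have hN : lam * nuclear_norm ((1 - a) *: B + a *: Bb) <=
    lam * ((1 - a) * nuclear_norm B + a * nuclear_norm Bb).
  by rewrite ler_wpM2l ?(ltW lam_gt0)// nuclear_norm_convex.
set S := \sum_i (y i - mx_inner (X i) ((1 - a) *: B + a *: Bb)) ^+ 2.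
set S1 := \sum_i (y i - mx_inner (X i) B) ^+ 2.
set S2 := \sum_i (y i - mx_inner (X i) Bb) ^+ 2.
set S3 := \sum_i mx_inner (X i) (Bb - B) ^+ 2.
have -> : S = (1 - a) * S1 + a * S2 - a * (1 - a) * S3.
  rewrite /S /S1 /S2 /S3 !mulr_sumr -big_split -sumrB /=; apply: eq_bigr => i _.
  by rewrite mx_innerDr mx_innerBr !mx_innerZr; ring.
rewrite -subr_ge0 in hN; rewrite -subr_ge0; apply: le_trans hN _.
rewrite le_eqVlt; apply/orP; left; apply/eqP; field.
by rewrite pnatr_eq0 -lt0n.
Qed.

Lemma pseudo_posterior_normalizer :
  (0 < \int[leb]_B (expR (- potential X y lam B / tau))%:E < +oo)%E.
Proof.
have mV : measurable_fun setT (fun B => potential X y lam B / tau).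
  by apply: measurable_funM => //; exact: measurable_potential.
apply/andP; split.
  by under eq_integral do rewrite mulNr; exact: (gibbs_gt0 mV).
have fin : (\int[leb]_B (expR (- (lam / tau * nuclear_norm B)))%:E < +oo)%E.
  apply: gibbs_lty; first exact: divr_gt0.
  - exact: measurable_nuclear_norm.
  - exact: entry_le_nuclear_norm.
  - exact: nuclear_norm_ge0.
  (* Equality comes from the scaling inequality used twice, with factor 2 and with factor 1/2. *)
  - move=> A; apply/eqP; rewrite eq_le nuclear_normZ_le//=.
    have := @nuclear_normZ_le _ _ _ svd 2^-1 (2 *: A).
    rewrite scalerA mulVf ?pnatr_eq0// scale1r invr_ge0 => /(_ (ler0n _ _)); lra.
apply: le_lt_trans fin; apply: ge0_le_integral => //.
- apply/measurable_EFinP/measurableT_comp => //.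
  by under eq_fun do rewrite mulNr; exact: measurable_funN.
- apply/measurable_EFinP/measurableT_comp => //; apply: measurable_funN.
  by apply: measurable_funM => //; exact: measurable_nuclear_norm.
move=> B _; rewrite lee_fin ler_expR mulNr lerN2 mulrAC ler_wpM2r ?invr_ge0 ?(ltW tau_gt0)//.
by rewrite lerDr mulr_ge0 ?invr_ge0 ?mulr_ge0// sumr_ge0// => i _; rewrite sqr_ge0.
Qed.

Lemma pseudo_posterior_gt Bb Bstar C (A : set 'M[R]_(m1, m2)) :
  (forall B, prediction_loss X B Bstar <= C +
    2 * (potential X y lam B - potential X y lam Bb + 4 / 9 * sqnorm_L2X X (Bb - B))) ->
  measurable A ->
  (forall B, prediction_loss X B Bstar <= C + 7 * (m1 * m2)%:R * tau -> A B) ->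
  ((1 - 2 * expR (- (Num.sqrt (m1 * m2)%:R / 16)))%:E <
    pseudo_posterior X y lam tau A)%E.
Proof.
move=> hloss mA hA; set p : R := (m1 * m2)%:R.
have p1 : 1 <= p by rewrite /p ler1n muln_gt0 m1_gt0.
pose V B := potential X y lam B / tau.
have mV : measurable_fun setT V.
  by apply: measurable_funM => //; exact: measurable_potential.
have VE B : - potential X y lam B / tau = - V B by rewrite mulNr.
(* At a = 1/9 the curvature coefficient (1 - a) / 2 is the 4/9 of [hloss]. The excess 7 p tau of the
   loss is 7/2 p tau in the potential, of which the move towards Bb recovers one ninth: 7/18 p
   tau. *)
have bad B : (~` A) B -> V ((1 - 9^-1) *: B + 9^-1 *: Bb) <= V B - 7 / 18 * p.
  move=> nA; have hB : C + 7 * p * tau < prediction_loss X B Bstar.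
    by rewrite ltNge; apply/negP => h; apply: nA; exact: hA.
  have a0 : 0 <= 9^-1 :> R by lra.
  have a1 : 9^-1 <= 1 :> R by lra.
  have h := @potential_convex 9^-1 B Bb a0 a1; rewrite /V ler_pdivrMr//.
  have -> : (potential X y lam B / tau - 7 / 18 * p) * tau =
    potential X y lam B - 7 / 18 * p * tau by field; rewrite gt_eqF.
  by have := hloss B; lra.
have a1 : 9^-1 < 1 :> R by lra.
have := gibbs_chernoff a1 mV (measurableC mA) bad.
have := pseudo_posterior_normalizer; rewrite /pseudo_posterior.
have VI D : (\int[leb]_(B in D) (expR (- potential X y lam B / tau))%:E =
    \int[leb]_(B in D) (expR (- V B))%:E)%E.
  by apply: eq_integral => B _; rewrite VE.
rewrite !VI => /andP[].
have -> : (\int[leb]_B (expR (- V B))%:E = \int[leb]_(B in A) (expR (- V B))%:E +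
    \int[leb]_(B in ~` A) (expR (- V B))%:E)%E.
  rewrite -ge0_integral_setU//; first by rewrite setUv.
  - exact: measurableC.
  - apply/measurable_EFinP; apply: measurableT_comp => //.
    rewrite setUv; exact: measurable_funN.
  - exact/disj_setPCl.
have I0 D : (0 <= \int[leb]_(B in D) (expR (- V B))%:E)%E.
  by apply: integral_ge0 => B _; rewrite lee_fin expR_ge0.
move: (I0 A) (I0 (~` A)).
case: (\int[leb]_(B in A) _)%E => [u| |]//; case: (\int[leb]_(B in ~` A) _)%E => [b| |]//.
rewrite -EFinD !lee_fin lte_fin => u0 b0 r0 _ hb.
rewrite inver gt_eqF// -EFinM lte_fin ltr_pdivlMr//.
(* (9/8)^p <= exp(p/8) and 7/18 - 1/8 = 19/72. *)
have {}hb : b <= expR (- (19 / 72 * p)) * (u + b).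
  rewrite -(ler_pM2l (expR_gt0 (19 / 72 * p))) mulrA -expRD subrr expR0 mul1r.
  apply: le_trans hb; rewrite ler_wpM2r//.
  have -> : 19 / 72 * p = - (p / 8) + 7 / 18 * p by field.
  rewrite expRD ler_wpM2r ?expR_ge0//.
  have -> : - (p / 8) = - 8^-1 * (m1 * m2)%:R by rewrite -/p; field.
  rewrite expRM_natr; apply: lerXn2r; rewrite ?nnegrE ?expR_ge0//; first lra.
  have e8 : 9 / 8 <= expR (8^-1) :> R by apply: le_trans (expR_ge1Dx _); lra.
  have -> : 1 - 9^-1 = (9 / 8)^-1 :> R by field.
  by rewrite expRN lef_pV2 ?posrE ?expR_gt0// divr_gt0.
have E0 := expR_gt0 (- (Num.sqrt p / 16)).
have hE : expR (- (19 / 72 * p)) <= expR (- (Num.sqrt p / 16)).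
  rewrite ler_expR lerN2; set s := Num.sqrt p.
  have s1 : 1 <= s by rewrite -sqrtr1 ler_wsqrtr.
  have -> : p = s ^+ 2 by rewrite sqr_sqrtr// (le_trans _ p1).
  have : s * 1 <= s * s by rewrite ler_wpM2l// (le_trans _ s1).
  by rewrite expr2; lra.
have h1 : b <= expR (- (Num.sqrt p / 16)) * (u + b).
  by apply: (le_trans hb); rewrite ler_wpM2r// ltW.
have h2 : 0 < expR (- (Num.sqrt p / 16)) * (u + b) by rewrite mulr_gt0.
lra.
Qed.
End posterior_concentration.

(** * The noise events and the theorem *)

Section noise.
Context (R : realType) (d : measure_display) (T : measurableType d).
Variables (P : probability T R) (n m1 m2 : nat) (sigma : R) (xi : 'I_n -> {RV P >-> R}).
Hypotheses (sigma_gt0 : 0 < sigma) (xi_gauss : isotropic_gaussian sigma xi).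
Variable X : 'I_n -> 'M[R]_(m1, m2).
Hypothesis n_gt0 : (0 < n)%N.

Lemma dilmx_sum I (r : seq I) (c : I -> R) (Z : I -> 'M[R]_(m1, m2)) :
  \sum_(i <- r) c i *: dilmx (Z i) = dilmx (\sum_(i <- r) c i *: Z i).
Proof.
elim: r => [|i r IH]; rewrite ?big_nil ?big_cons.
  by rewrite /dilmx trmx0 block_mx_const.
rewrite IH /dilmx scale_block_mx add_block_mx !scaler0 !addr0.
by rewrite raddfD /= linearZ.
Qed.

Variables (lam L : R) (Pi : 'M[R]_n).
Hypotheses (PiT : Pi^T = Pi) (Pi2 : Pi *m Pi = Pi).
Hypotheses (lam_gt0 : 0 < lam) (L_gt0 : 0 < L).
Hypothesis lam_ge : 8 * sigma ^+ 2 * design_constant X ^+ 2 * L <= lam ^+ 2 * n%:R.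

Lemma residual_noise_op : exists G : set T, [/\ measurable G,
  (P (~` G) <= ((m1 + m2)%:R * expR (- (16 / 9 * L)))%:E)%E &
  forall w, G w -> op_le (n%:R * (2 / 3 * lam))
    (\sum_k gvec xi w k 0 *: residual_design Pi X k)].
Proof.
have nR : (0 : R) < n%:R by rewrite ltr0n.
(* The upper bound on n times the squared design constant given by [lam_ge]. It is positive even if
   the design is zero, and makes the exponent t^2 / (2 sigma^2 v) equal to 16/9 L. *)
pose v := n%:R ^+ 2 * lam ^+ 2 / (8 * sigma ^+ 2 * L).
have s2 : 0 < 8 * sigma ^+ 2 * L by rewrite mulr_gt0// mulr_gt0// exprn_gt0.
have v0 : 0 < v by rewrite divr_gt0// mulr_gt0// exprn_gt0.
have nv : n%:R * design_constant X ^+ 2 <= v.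
  by rewrite /v ler_pdivlMr//; have := ler_wpM2l (ltW nR) lam_ge; lra.
have [q1 q2] := design_quad X n_gt0.
have dT k : (dilmx (residual_design Pi X k))^T = dilmx (residual_design Pi X k).
  exact: tr_dilmx.
have t0 : 0 < n%:R * (2 / 3 * lam) by rewrite !mulr_gt0.
have dq := dilmx_sqr_quad (X := residual_design Pi X) (v := v).
have [|G [mG PG hG]] := gseries_tail sigma_gt0 xi_gauss dT v0 t0.
  apply: dq => u.
    apply: (le_trans (residual_design_quad PiT Pi2 X u)); apply: (le_trans (q1 u)).
    by rewrite ler_wpM2r// mx_inner_ge0.
  have -> : \sum_i (residual_design Pi X i)^T *m residual_design Pi X i =
      \sum_i residual_design Pi (fun i => (X i)^T) i *m
        (residual_design Pi (fun i => (X i)^T) i)^T.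
    by apply: eq_bigr => i _; rewrite -residual_design_trmx trmxK.
  apply: (le_trans (residual_design_quad PiT Pi2 _ u)).
  have -> : \sum_i (X i)^T *m ((X i)^T)^T = \sum_i (X i)^T *m X i.
    by apply: eq_bigr => i _; rewrite trmxK.
  by apply: (le_trans (q2 u)); rewrite ler_wpM2r// mx_inner_ge0.
exists G; split => //.
  have -> : 16 / 9 * L = (n%:R * (2 / 3 * lam)) ^+ 2 / (2 * sigma ^+ 2 * v) => //.
  rewrite /v; field.
  by rewrite !gt_eqF.
move=> w Gw; apply: op_le_dilmx_trace; first exact: ltW.
have [j hj] := hG w Gw; exists j; move: hj; rewrite /gseries dilmx_sum.
set Z := \sum_k _ *: _; have -> // : Z = \sum_k gvec xi w k 0 *: residual_design Pi X k.
by apply: eq_bigr => k _; rewrite mxE.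
Qed.

Lemma projected_noise (K : nat) rho : \tr Pi <= 2 * K%:R ->
  (0 < K)%N ==> (10 < K)%N -> 0 <= rho -> K%:R <= rho * design_constant X ^+ 2 ->
  4 * ln 2 <= L ->
  exists G : set T, [/\ measurable G, (P (~` G) <= (8 * expR (- L))%:E)%E &
  forall w, G w -> mx_inner (gvec xi w) (Pi *m gvec xi w) <=
    4 / 25 * lam ^+ 2 * rho * n%:R].
Proof.
move=> trK K10 rho0 Kv L4.
have q0 : 0 <= 4 / 25 * lam ^+ 2 * rho * n%:R.
  by rewrite mulr_ge0 ?ler0n// mulr_ge0// mulr_ge0 ?sqr_ge0.
set q := 4 / 25 * lam ^+ 2 * rho * n%:R in q0 *.
(* If K = 0, the trace of Pi, which is its squared Frobenius norm, vanishes, so there is no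
   projected noise. *)
have [K0|K0] := posnP K.
  exists setT; split => [//||w _].
    by rewrite setCT measure0 lee_fin mulr_ge0// expR_ge0.
  have -> : Pi = 0.
    apply: mx_inner_eq0; apply/eqP; rewrite eq_le mx_inner_ge0 andbT /mx_inner PiT Pi2.
    by move: trK; rewrite K0 mulr0.
  by rewrite mul0mx mx_inner0r.
have {}K10 : (11 : R) <= K%:R by rewrite ler_nat; move: K10; rewrite K0.
exists [set w | quad xi Pi w < q]; split => [||w].
- rewrite -[X in measurable X]setTI.
  have mq := measurable_gpoly sigma_gt0 xi_gauss (gpoly_quad xi PiT).
  have := mq measurableT _ (measurable_itv `]-oo, q[).
  by congr (measurable (_ `&` _)); apply/seteqP; split => w; rewrite /= in_itv.
- rewrite (_ : ~` _ = [set w | q <= quad xi Pi w]); last first.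
    by apply/seteqP; split => w /=; [move/negP; rewrite -leNgt|
      move=> h; apply/negP; rewrite -leNgt].
  apply: (le_trans (quad_tail sigma_gt0 xi_gauss PiT Pi2 trK q0)); rewrite lee_fin.
  (* In the exponent the claim reads (K - 3) l + L <= q / (4 sigma^2), where the right side is at
     least (8/25) K L. It follows from L >= 4 l and K >= 11. *)
  set l := ln 2 in L4 *; have l2 : 2 = expR l by rewrite lnK// posrE.
  have -> : 8 = expR (3%:R * l) :> R by rewrite expRM_natl -l2; ring.
  have -> : 2 ^+ K = expR (K%:R * l) by rewrite expRM_natl -l2.
  rewrite -!expRD ler_expR.
  have hq : 8 / 25 * (K%:R * L) <= q / (4 * sigma ^+ 2).
    rewrite ler_pdivlMr ?mulr_gt0// ?exprn_gt0//.
    have := ler_wpM2r rho0 lam_ge => h1.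
    have h2 : K%:R * (sigma ^+ 2 * L) <= rho * design_constant X ^+ 2 * (sigma ^+ 2 * L).
      by rewrite ler_wpM2r// mulr_ge0 ?sqr_ge0// ltW.
    by rewrite /q; lra.
  have l0 : 0 <= l by rewrite ln_ge0// ler1n.
  have h1 : (8 / 25 * K%:R - 1) * (4 * l) <= (8 / 25 * K%:R - 1) * L.
    by rewrite ler_wpM2l//; lra.
  have h2 : 11 * l <= K%:R * l by rewrite ler_wpM2r.
  lra.
- exact: ltW.
Qed.

End noise.

(** * The oracle and the numerical constants *)

Section assembly.
Variables (R : realType).

(** The zero matrix with empty J shows that the infimum is finite. Any near-minimizer then has a
    finite ratio |J| / kappa, since an infinite one would make its value infinite. *)
Lemma oracle_set_inf (n m1 m2 : nat) (X : 'I_n -> 'M[R]_(m1, m2)) (Bstar : 'M[R]_(m1, m2))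
    (lam : R) (svd : forall B : 'M[R]_(m1, m2), compact_svd B) (e : R) :
  0 < lam -> 0 < e ->
  exists (I : R) (Bb : 'M[R]_(m1, m2)) (J : {set 'I_(\rank Bb)}) (rho : R),
  [/\ ereal_inf [set b | exists (Bb : 'M[R]_(m1, m2)) (J : {set 'I_(\rank Bb)}),
        b = ((prediction_loss X Bb Bstar
              + 4 * lam * nuclear_norm (projJc (svd Bb) J Bb))%:E
             + (9 * lam ^+ 2 / 4)%:E * card_over_compat X (svd Bb) J 3)%E] = I%:E,
      card_over_compat X (svd Bb) J 3 = rho%:E &
      prediction_loss X Bb Bstar + 4 * lam * nuclear_norm (projJc (svd Bb) J Bb)
        + 9 * lam ^+ 2 / 4 * rho < I + e].
Proof.
move=> lam_gt0 e0; have lam0 := ltW lam_gt0; set S := [set b | _].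
have coc0 Bb (J : {set 'I_(\rank Bb)}) : (0 <= card_over_compat X (svd Bb) J 3)%E.
  by rewrite mule_ge0 ?lee_fin// inve_ge0 compat_factor_ge0.
have c0 : (0 : R) <= 9 * lam ^+ 2 / 4 by rewrite divr_ge0// mulr_ge0// sqr_ge0.
have S0 : (0 <= ereal_inf S)%E.
  apply: le_ereal_inf_tmp => _ [Bb [J ->]]; apply: adde_ge0; last by rewrite mule_ge0.
  rewrite lee_fin; apply: addr_ge0; first exact: sqnorm_ge0.
  by rewrite mulr_ge0 ?nuclear_norm_ge0 ?mulr_ge0.
have Sfin : ereal_inf S \is a fin_num.
  rewrite ge0_fin_numE//.
  pose B0 : 'M[R]_(m1, m2) := 0; pose J0 : {set 'I_(\rank B0)} := finset.set0.
  apply: (@le_lt_trans _ _ ((prediction_loss X B0 Bstar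
    + 4 * lam * nuclear_norm (projJc (svd B0) J0 B0))%:E
    + (9 * lam ^+ 2 / 4)%:E * card_over_compat X (svd B0) J0 3)%E).
    by apply: ereal_inf_lbound; exists B0, J0.
  by rewrite /card_over_compat cards0 mul0e mule0 adde0 ltry.
have [_ [Bb [J ->]] hb] := lb_ereal_inf_adherent e0 Sfin.
move: hb (coc0 Bb J); rewrite -(fineK Sfin) -EFinD.
case E : (card_over_compat X (svd Bb) J 3) => [rho| |]// hb _.
  by exists (fine (ereal_inf S)), Bb, J, rho; split.
by move: hb; rewrite gt0_muley ?lte_fin ?divr_gt0 ?mulr_gt0 ?exprn_gt0// addey.
Qed.

Lemma expR_half_lt (s : R) : s <= 10 -> 1 < 2 * expR (- (s / 16)).
Proof.
(* 10/16 = 5/8 and exp(-1/8) >= 7/8, with (7/8)^5 > 1/2. The rational lower bounds for x^2 and x^4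
   keep this slim margin. *)
move=> s10; apply: (@lt_le_trans _ _ (2 * expR (- 8^-1 * 5%:R))).
  have : 7 / 8 <= expR (- 8^-1) :> R by apply: le_trans (expR_ge1Dx _); lra.
  rewrite expRM_natr; set x := expR _ => x7.
  have x2 : 16 / 21 <= x ^+ 2.
    have : 0 <= (x - 7 / 8) ^+ 2 := sqr_ge0 _; lra.
  have x4 : 4 / 7 + 1 / 125 <= x ^+ 4.
    rewrite (_ : x ^+ 4 = (x ^+ 2) ^+ 2); last by rewrite -exprM.
    have : 0 <= (x ^+ 2 - 16 / 21) ^+ 2 := sqr_ge0 _; lra.
  rewrite exprS.
  have : (7 / 8) * x ^+ 4 <= x * x ^+ 4 by rewrite ler_wpM2r// exprn_ge0// expR_ge0.
  lra.
by rewrite ler_pM2l// ler_expR; lra.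
Qed.

End assembly.

Theorem theorem4 (R : realType) (d : measure_display) (T : measurableType d)
    (P : probability T R) (n m1 m2 : nat)
    (n_gt0 : (0 < n)%N) (m1_gt0 : (0 < m1)%N) (m2_gt0 : (0 < m2)%N)
    (X : 'I_n -> 'M[R]_(m1, m2)) (Bstar : 'M[R]_(m1, m2))
    (sigma : R) (sigma_gt0 : 0 < sigma)
    (xi : 'I_n -> {RV P >-> R}) (xi_gauss : isotropic_gaussian sigma xi)
    (y : 'I_n -> T -> R)
    (y_model : forall i w, y i w = \tr ((X i)^T *m Bstar) + xi i w)
    (tau lam : R) (tau_gt0 : 0 < tau) (lam_gt0 : 0 < lam)
    (delta : R) (delta_gt0 : 0 < delta) (delta_lt1 : delta < 1)
    (lam_ge : 2 * sigma * design_constant X *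
      Num.sqrt (2 / n%:R * ln ((m1 + m2)%:R / delta)) <= lam)
    (svd : forall B : 'M[R]_(m1, m2), compact_svd B) :
  ((1 - delta)%:E <= P [set w |
     (1 - 2 * expR (- (Num.sqrt (m1 * m2)%:R / 16)))%:E <
     pseudo_posterior X (fun i => y i w) lam tau
       [set B | (prediction_loss X B Bstar)%:E <=
          ereal_inf [set b | exists (Bb : 'M[R]_(m1, m2))
                                    (J : {set 'I_(\rank Bb)}),
            b = (prediction_loss X Bb Bstar
                 + 4 * lam * nuclear_norm (projJc (svd Bb) J Bb))%:E
                + (9 * lam ^+ 2 / 4)%:E * card_over_compat X (svd Bb) J 3]
          + (8 * m1%:R * m2%:R * tau)%:E]])%E.
Proof.
set E := [set w | _].
have my i : measurable_fun setT (y i).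
  by rewrite (_ : y i = fun w => \tr ((X i)^T *m Bstar) + xi i w);
    [exact: measurable_funD|apply/funext => w; exact: y_model].
have mE : measurable E.
  apply: measurable_posterior_event => //; first exact: measurable_loss_ball.
  by move=> w; exact: pseudo_posterior_normalizer.
suff [G [mG PG GE]] : exists G : set T,
    [/\ measurable G, (P (~` G) <= delta%:E)%E & G `<=` E].
  apply: (@le_trans _ _ (P G)); last by apply: le_measure; rewrite ?inE.
  by rewrite -(setCK G) probability_setC ?EFinB ?leeB//; exact: measurableC.
have [p100|p100] := leqP (m1 * m2) 100.
  exists setT; split => //; first by rewrite setCT measure0 lee_fin ltW.
  move=> w _; rewrite /E /=.
  apply: (@lt_le_trans _ _ 0%E).
    rewrite lte_fin subr_lt0 expR_half_lt//.
    have -> : 10 = Num.sqrt (10 ^+ 2) :> R by rewrite sqrtr_sqr ger0_norm.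
    by rewrite ler_wsqrtr// -natrX ler_nat.
  rewrite /pseudo_posterior mule_ge0 ?inve_ge0 ?integral_ge0//; move=> B _;
    by rewrite lee_fin expR_ge0.
(* The slack granted to the near-minimizer is p tau, completing 7 p tau to 8 p tau. *)
have p0 : (0 : R) < (m1 * m2)%:R by rewrite ltr0n (leq_trans _ p100).
have [I [Bb [J [rho [infE rhoE hI]]]]] :=
  oracle_set_inf X Bstar svd lam_gt0 (mulr_gt0 p0 tau_gt0).
set m := (m1 + m2)%N in lam_ge; set v := design_constant X in lam_ge.
set L := ln (m%:R / delta) in lam_ge.
(* From p > 100: max(m1, m2) > 10, so K = |J| max(m1, m2) is 0 or at least 11; and m1 + m2 >= 16,
   which yields L >= ln 16 = 4 ln 2. *)
have M10 : (10 < maxn m1 m2)%N.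
  rewrite ltnNge; apply/negP => M10; move: p100; apply/negP; rewrite -leqNgt.
  by rewrite (@leq_mul _ _ 10 10)// (leq_trans _ M10) ?leq_maxl ?leq_maxr.
have m16 : (16 <= m)%N.
  rewrite leqNgt; apply/negP => m16; move: p100; apply/negP; rewrite -leqNgt.
  have := (nat_AGM2 m1 m2).1; rewrite -/m => h.
  rewrite -(leq_pmul2l (isT : (0 < 4)%N)) (leq_trans h)//.
  by rewrite (@leq_trans (15 ^ 2)%N)// leq_exp2r.
have mR : (16 : R) <= m%:R by rewrite ler_nat.
have m0 : (0 : R) < m%:R by exact: lt_le_trans mR.
have nR : (0 : R) < n%:R by rewrite ltr0n.
have md : 16 <= m%:R / delta.
  by rewrite ler_pdivlMr//; apply: le_trans mR; rewrite ler_piMr// ltW.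
have md0 : 0 < m%:R / delta by rewrite divr_gt0.
have l2 : 0 < ln 2 :> R by rewrite ln_gt0// ltr1n.
have L4 : 4 * ln 2 <= L.
  rewrite mulr_natl -lnXn// /L ler_ln ?posrE ?exprn_gt0//.
  by apply: le_trans md; rewrite -natrX ler_nat.
have L0 : 0 < L by apply: lt_le_trans L4; rewrite mulr_gt0.
have eL : expR (- L) = delta / m%:R by rewrite expRN lnK ?posrE// invf_div.
have v0 : 0 <= v by rewrite le_max sqrtr_ge0.
have lam2 : 8 * sigma ^+ 2 * v ^+ 2 * L <= lam ^+ 2 * n%:R.
  have z2 : Num.sqrt (2 / n%:R * L) ^+ 2 = 2 / n%:R * L.
    by rewrite sqr_sqrtr// mulr_ge0 ?divr_ge0// ltW.
  have : (2 * sigma * v * Num.sqrt (2 / n%:R * L)) ^+ 2 <= lam ^+ 2.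
    by rewrite lerXn2r// ?nnegrE ?(ltW lam_gt0)// !mulr_ge0 ?sqrtr_ge0// ltW.
  rewrite exprMn z2 => h; rewrite -ler_pdivrMr//; apply: le_trans h.
  by rewrite le_eqVlt; apply/orP; left; apply/eqP; field; rewrite gt_eqF.
have [Pi [PiT Pi2 trPi PiX]] := fit_projection (svd Bb) J X.
have [rho0 rhoM] := card_over_compat_ge svd n_gt0 m1_gt0 m2_gt0 rhoE.
have [G1 [mG1 PG1 hG1]] :=
  residual_noise_op sigma_gt0 xi_gauss n_gt0 PiT Pi2 lam_gt0 L0 lam2.
have K10 : (0 < #|J| * maxn m1 m2)%N ==> (10 < #|J| * maxn m1 m2)%N.
  rewrite muln_gt0; apply/implyP => /andP[J0 _].
  by rewrite (leq_trans M10)// leq_pmull.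
have [G2 [mG2 PG2 hG2]] := projected_noise sigma_gt0 xi_gauss PiT Pi2 L0
  lam2 trPi K10 rho0 rhoM L4.
exists (G1 `&` G2); split; first exact: measurableI.
- rewrite setCI; apply: (le_trans (measureU2 _ _ _)); try exact: measurableC.
  (* The budget: the factor exp(- 7/9 L) <= 1/4 brings the operator-norm event down to delta / 4,
     and 8 delta / (m1 + m2) <= delta / 2 for the chi-square event. *)
  apply: (le_trans (leeD PG1 PG2)); rewrite -EFinD lee_fin eL.
  have h1 : expR (- (16 / 9 * L)) <= delta / m%:R * 4^-1.
    rewrite -eL; apply: (@le_trans _ _ (expR (- L) * expR (- (2%:R * ln 2)))).
      by rewrite -expRD ler_expR; lra.
    by rewrite ler_pM2l ?expR_gt0// expRN expRM_natl lnK ?posrE// -natrX.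
  have h2 := ler_wpM2l (ltW m0) h1.
  have h3 : m%:R * (delta / m%:R * 4^-1) = delta / 4 by field; rewrite gt_eqF.
  have h4 : delta / m%:R <= delta / 16.
    by rewrite ler_wpM2l ?(ltW delta_gt0)// lef_pV2 ?posrE.
  rewrite h3 in h2; move: h2 h4; rewrite -/m; move: (m%:R * _) (delta / m%:R) => a b.
  by move: delta_gt0; clear; lra.
move=> w [/hG1 op1 /hG2 op2]; rewrite /E /= infE.
have yE i : y i w = mx_inner (X i) Bstar + gvec xi w i 0 by rewrite mxE y_model.
pose C := prediction_loss X Bb Bstar + 4 * lam * nuclear_norm (projJc (svd Bb) J Bb)
  + 9 * lam ^+ 2 / 4 * rho.
apply: (@pseudo_posterior_gt _ _ _ _ _ svd _ _ _ _ _ _ _ _ Bb Bstar C) => //.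
- by move=> B; exact: (loss_le svd n_gt0 m1_gt0 m2_gt0 yE lam_gt0 rhoE PiT Pi2 PiX op1 op2).
- exact: measurable_loss_ball.
- move=> B hB /=; rewrite -EFinD lee_fin; apply: (le_trans hB).
  move: hI; rewrite -/C natrM; lra.
Qed.
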